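(* Let $G$ be a discrete submonoid, $R$ a commutative unital $(2\mathbb{Z}\oplus0)$-graded real algebra, and $(C,d)$ a dg $R$-module with $HC=H(C,d)$. Let $(\mathcal{B}(C^G),m)$ be a ($G$-gapped) twisted $A_\infty$ algebra over $R$ which is a perturbation of $(C,d)$, and let $(\Pi_{1,\mathbf 0},I_{1,\mathbf 0},h_{1,\mathbf 0})$ be a retraction of $(C,d)$ to $HC$. Then there exist (1) a perturbation $(\mathcal{B}((HC)^G),m^{can})$ of $(HC,0)$; (2) twisted $A_\infty$ morphisms $\Pi:(\mathcal{B}(C^G),m)\to(\mathcal{B}((HC)^G),m^{can})$ and $I:(\mathcal{B}((HC)^G),m^{can})\to(\mathcal{B}(C^G),m)$ with $\Pi\circ I=\mathrm{id}_{\mathcal{B}((HC)^G)}$; and (3) a homotopy $h:\mathrm{id}_{\mathcal{B}(C^G)}\Rightarrow I\circ\Pi$.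
   Context: Gradings. ''Graded'' means $(\mathbb{Z}\oplus\mathbb{Z}/2)$-graded; for homogeneous $x$ of degree $(a,b)$ write $\mathrm{cd}\,x=a$, $\mathrm{ls}\,x=b$. Shifts: $(C[p,q])^{a,b}=C^{a+p,b+q}$, $C[p]=C[p,0]$. Maps preserve gradings unless stated otherwise. A $(2\mathbb{Z}\oplus 0)$-graded algebra $R$ satisfies $R^{a,b}=0$ unless $a$ is even and $b=0$. Discrete submonoid. A submonoid $G\subset\mathbb{R}_{\ge 0}\times\mathbb{Z}$ (containing $\mathbf 0=(0,0)$) with projections $E,\mu$ to the two factors, such that $E(G)$ is discrete and $E^{-1}(\lambda)$ is finite for each $\lambda$. Novikov ring. $\Lambda=\{\sum_{\beta\in G}a_\beta\epsilon^{\mu(\beta)}T^{E(\beta)}: a_\beta\in R\}$ (possibly infinite formal sums), $\deg\epsilon=(1,1)$, $\deg T=(0,0)$, filtered by $\mathcal{F}^{E_0}\Lambda=\{\text{sums over }\beta\text{ with }E(\beta)\ge E_0\}$. For a graded $R$-module $C$ (with discrete filtration $\mathcal F^{>0}C=0$), $C^G=\Lambda\hat\otimes_R C$ (completed for the energy filtration), with $\Lambda$-bimodule structure $\epsilon^{r_1}T^{E_1}\cdot(c\,\epsilon^rT^E)\cdot\epsilon^{r_2}T^{E_2}=(-1)^{(\mathrm{cd}\,c+\mathrm{ls}\,c+1)r_1}c\,\epsilon^{r_1+r+r_2}T^{E_1+E+E_2}$; $C^G[1]$ carries the same multiplications. Bar coalgebra. $\mathcal{B}(C^G)=\widehat{\bigoplus}_{k\ge0}(C^G[1])^{\hat\otimes_\Lambda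 k}$ (sequences $(x_k)_k$ with $x_k\in\mathcal F^{E_k}$ for some $E_k\to\infty$), with inclusions $i_k$ and projections $\pi_k$, $\Delta(x_1\otimes\cdots\otimes x_k)=\sum_{i=0}^k(x_1\otimes\cdots\otimes x_i)\overline\otimes(x_{i+1}\otimes\cdots\otimes x_k)$, counit $\eta=\pi_0$. Maps. All maps of bar coalgebras preserve filtrations and local system degree; a degree $d$ map raises codimension degree by $d$ and satisfies $h(axb)=(-1)^{d\cdot\mathrm{cd}\,a}a\,h(x)\,b$ for $a,b\in\Lambda$. Coalgebra morphisms are degree $0$ maps commuting with $\Delta$ and $\eta$. For coalgebra morphisms $f_1,f_2:\mathcal B\to\mathcal B'$, an $(f_1,f_2)$-coderivation of degree $d$ is a degree $d$ map $h:\mathcal B\to\mathcal B'$ with $\eta'h=0$ and $\Delta'h=(h\otimes f_2\pm f_1\otimes h)\Delta$, where $(h\otimes f_2\pm f_1\otimes h)(x\otimes y)=hx\otimes f_2y+(-1)^{d\cdot\mathrm{cd}\,x}f_1x\otimes hy$ (codimension degree in $\mathcal B$: a letter $x_j\in C^G$ contributes $\mathrm{cd}\,x_j-1$). A differential is an $(\mathrm{id},\mathrm{id})$-coderivation $m$ of degree $1$ with $m^2=0$. A differential or morphism $f$ is tame if $(\pi_1\circ f\circ i_0)(1_\Lambda)\in\mathcal F^{>0}=\bigcup_{E>0}\mathcal F^E$. A twisted $A_\infty$ algebra is a pair $(\mathcal B(C^G),m)$ with $m$ a tame differential. Its components are the $R$-linear maps $m_{k,\beta}:C^{\otimes_Rk}\to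 C[2-k-\mu(\beta),\mu(\beta)\bmod2]$ with $\pi_1m(x_1\otimes\cdots\otimes x_k)=\sum_\beta\epsilon^{\mu(\beta)}T^{E(\beta)}m_{k,\beta}(x_1,\dots,x_k)$, $x_i\in C$. A twisted $A_\infty$ morphism $f:(\mathcal B,m)\to(\mathcal B',m')$ is a tame coalgebra morphism with $fm=m'f$. A homotopy $h:f_1\Rightarrow f_2$ between twisted $A_\infty$ morphisms is an $(f_1,f_2)$-coderivation of degree $-1$ with $m'h+hm=f_2-f_1$. dg modules. A dg $R$-module $(C,d)$ is a graded $R$-module with an $R$-linear $d:C\to C[1]$, $d^2=0$. Put $d'x=(-1)^{\mathrm{cd}\,x}dx$. $(\mathcal B(C^G),m)$ is a perturbation of $(C,d)$ if $m_{1,\mathbf 0}=d'$. Retraction. A retraction of $(C,d)$ to $HC$ is a triple of $R$-module maps $\Pi_{1,\mathbf 0}:C\to HC$, $I_{1,\mathbf 0}:HC\to C$, $h_{1,\mathbf 0}:C\to C[-1]$ with $\Pi_{1,\mathbf 0}d'=0$, $d'I_{1,\mathbf 0}=0$, $\Pi_{1,\mathbf 0}I_{1,\mathbf 0}=\mathrm{id}_{HC}$, $d'h_{1,\mathbf 0}+h_{1,\mathbf 0}d'=I_{1,\mathbf 0}\Pi_{1,\mathbf 0}-\mathrm{id}_C$, and the side conditions $h_{1,\mathbf 0}^2=0$, $\Pi_{1,\mathbf 0}h_{1,\mathbf 0}=0$, $h_{1,\mathbf 0}I_{1,\mathbf 0}=0$. *)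

(* Defs.v *)
From Stdlib Require List.
From HB Require Import structures.
From mathcomp Require Import all_boot all_order all_algebra finmap.
From mathcomp Require Import all_classical all_reals all_analysis.
Set Implicit Arguments.
Unset Strict Implicit.
Unset Printing Implicit Defensive.
Import Order.TTheory GRing.Theory Num.Theory.
Import numFieldNormedType.Exports.
Local Open Scope classical_set_scope.
Local Open Scope ring_scope.

Record submod (R : pzRingType) (V : lmodType R) := Submod {
  sm_set :> V -> Prop;
  sm0 : sm_set 0;
  smD : forall x y, sm_set x -> sm_set y -> sm_set (x + y);
  smZ : forall a x, sm_set x -> sm_set (a *: x) }.

Section Submod.
Variables (R : pzRingType) (V : lmodType R) (N : submod V).

Lemma smN x : N x -> N (- x).
Proof. by move=> Nx; rewrite -scaleN1r; apply: smZ. Qed.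

Lemma smB x y : N x -> N y -> N (x - y).
Proof. by move=> Nx Ny; apply: smD => //; apply: smN. Qed.

End Submod.

Section Subquotient.
Variables (R : pzRingType) (V : lmodType R) (Z N : submod V).

(* The chosen representative in Z of the class of x modulo N; by extensionality
   it depends only on that class.  The subquotient Z / (Z `&` N) is realized as
   the set of chosen representatives. *)
Definition sq_can (x : V) : V := xget 0 [set y | Z y /\ N (x - y)].

Definition subquot : Type := {x : V | `[< Z x /\ sq_can x = x >]}.

HB.instance Definition _ := [isSub of subquot for sval].
HB.instance Definition _ := [Choice of subquot by <:].

Lemma sq_canP x : Z x -> Z (sq_can x) /\ N (x - sq_can x).
Proof.
move=> Zx; rewrite /sq_can; case: xgetP => [y _ //|/(_ x)[]].
by split=> //; rewrite subrr; apply: sm0.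
Qed.

Lemma sq_can_eq x y : N (x - y) -> sq_can x = sq_can y.
Proof.
move=> Nxy; congr (xget 0 _); apply/seteqP; split=> z /= [Zz Nz]; split=> //.
  by rewrite -[y](subKr x) addrAC; apply: smB.
by rewrite -[x](subrK y) -addrA; apply: smD.
Qed.

Lemma sq_can_id x : Z x -> sq_can (sq_can x) = sq_can x.
Proof. by move=> /sq_canP[_ Nx]; apply/esym/sq_can_eq. Qed.

Lemma sq_can0P : `[< Z (sq_can 0) /\ sq_can (sq_can 0) = sq_can 0 >].
Proof.
apply/asboolP; split; last exact/sq_can_id/sm0.
by have [] := sq_canP (sm0 Z).
Qed.

Definition sq_rep0 : subquot :=
  exist (fun x => `[< Z x /\ sq_can x = x >]) _ sq_can0P.

End Subquotient.

(* The class of x; only meaningful for x in Z. *)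
HB.lock Definition sq_pi (R : pzRingType) (V : lmodType R) (Z N : submod V)
  (x : V) : subquot Z N := insubd (sq_rep0 Z N) (sq_can Z N x).

HB.lock Definition sq_zero (R : pzRingType) (V : lmodType R) (Z N : submod V) :
  subquot Z N := sq_pi Z N 0.
HB.lock Definition sq_add (R : pzRingType) (V : lmodType R) (Z N : submod V)
  (p q : subquot Z N) : subquot Z N := sq_pi Z N (val p + val q).
HB.lock Definition sq_opp (R : pzRingType) (V : lmodType R) (Z N : submod V)
  (p : subquot Z N) : subquot Z N := sq_pi Z N (- val p).
HB.lock Definition sq_scale (R : pzRingType) (V : lmodType R) (Z N : submod V)
  (a : R) (p : subquot Z N) : subquot Z N := sq_pi Z N (a *: val p).

Section SubquotientTheory.
Variables (R : pzRingType) (V : lmodType R) (Z N : submod V).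
Local Notation subquot := (subquot Z N).
Local Notation sq_can := (sq_can Z N).
Local Notation sq_pi := (sq_pi Z N).
Local Notation sq_zero := (sq_zero Z N).
Local Notation sq_add := (@sq_add _ _ Z N).
Local Notation sq_opp := (@sq_opp _ _ Z N).
Local Notation sq_scale := (@sq_scale _ _ Z N).

Lemma sq_valP (q : subquot) : Z (val q).
Proof. by case: q => x /= /asboolP[]. Qed.

Lemma val_sq_pi x : Z x -> val (sq_pi x) = sq_can x.
Proof.
move=> Zx; rewrite sq_pi.unlock val_insubd; case: asboolP => // -[].
by split; [have [] := sq_canP N Zx | apply: sq_can_id].
Qed.

Lemma sq_piK x : Z x -> N (x - val (sq_pi x)).
Proof. by move=> Zx; rewrite val_sq_pi//; have [] := sq_canP N Zx. Qed.

Lemma sq_pi_eq x y : N (x - y) -> sq_pi x = sq_pi y.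
Proof. by move=> /(sq_can_eq Z) e; rewrite sq_pi.unlock e. Qed.

Lemma sq_valK (q : subquot) : sq_pi (val q) = q.
Proof.
apply: val_inj; rewrite val_sq_pi; last exact: sq_valP.
by case: q => x /= /asboolP[].
Qed.

Lemma sq_addE x y : Z x -> Z y -> sq_add (sq_pi x) (sq_pi y) = sq_pi (x + y).
Proof.
move=> Zx Zy; rewrite sq_add.unlock; apply: sq_pi_eq; rewrite -opprB; apply: smN.
by rewrite opprD addrACA; apply: smD; apply: sq_piK.
Qed.

Lemma sq_scaleE a x : Z x -> sq_scale a (sq_pi x) = sq_pi (a *: x).
Proof.
move=> Zx; rewrite sq_scale.unlock; apply: sq_pi_eq; rewrite -opprB; apply: smN.
by rewrite -scalerBr; apply: smZ; apply: sq_piK.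
Qed.

Lemma sq_oppE x : Z x -> sq_opp (sq_pi x) = sq_pi (- x).
Proof.
move=> Zx; rewrite -scaleN1r -sq_scaleE// sq_opp.unlock sq_scale.unlock.
by rewrite scaleN1r.
Qed.

Lemma sq_ind (P : subquot -> Prop) :
  (forall x, Z x -> P (sq_pi x)) -> forall q, P q.
Proof. by move=> H q; rewrite -[q]sq_valK; apply/H/sq_valP. Qed.

Fact sq_addA : associative sq_add.
Proof.
elim/sq_ind=> x Zx; elim/sq_ind=> y Zy; elim/sq_ind=> z Zz.
by rewrite !sq_addE ?addrA //; apply: smD.
Qed.
Fact sq_addC : commutative sq_add.
Proof. by move=> p q; rewrite sq_add.unlock addrC. Qed.
Fact sq_add0 : left_id sq_zero sq_add.
Proof.
elim/sq_ind=> x Zx; rewrite sq_zero.unlock sq_addE ?add0r //.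
exact: sm0.
Qed.
Fact sq_addN : left_inverse sq_zero sq_opp sq_add.
Proof.
elim/sq_ind=> x Zx; rewrite sq_oppE // sq_addE //; last exact: smN.
by rewrite addNr sq_zero.unlock.
Qed.
HB.instance Definition _ :=
  GRing.isZmodule.Build subquot sq_addA sq_addC sq_add0 sq_addN.

Fact sq_scaleA a b q : sq_scale a (sq_scale b q) = sq_scale (a * b) q.
Proof.
by elim/sq_ind: q => x Zx; rewrite !sq_scaleE ?scalerA //; apply: smZ.
Qed.
Fact sq_scale1 : left_id 1 sq_scale.
Proof. by elim/sq_ind => x Zx; rewrite sq_scaleE ?scale1r. Qed.
Fact sq_scaleDr : right_distributive sq_scale +%R.
Proof.
move=> a; elim/sq_ind=> x Zx; elim/sq_ind=> y Zy.
rewrite [_ + _]sq_addE // !sq_scaleE //; last exact: smD.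
by rewrite [RHS]sq_addE ?scalerDr //; apply: smZ.
Qed.
Fact sq_scaleDl q : {morph sq_scale^~ q : a b / a + b}.
Proof.
elim/sq_ind: q => x Zx a b; rewrite !sq_scaleE //.
by rewrite [RHS]sq_addE ?scalerDl //; apply: smZ.
Qed.
HB.instance Definition _ :=
  GRing.Zmodule_isLmodule.Build R subquot sq_scaleA sq_scale1 sq_scaleDr
    sq_scaleDl.

Lemma sq_piD x y : Z x -> Z y -> sq_pi (x + y) = sq_pi x + sq_pi y.
Proof. by move=> Zx Zy; rewrite -sq_addE. Qed.
Lemma sq_piZ a x : Z x -> sq_pi (a *: x) = a *: sq_pi x.
Proof. by move=> Zx; rewrite -sq_scaleE. Qed.
Lemma sq_pi0 x : N x -> sq_pi x = 0.
Proof.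
move=> Nx; rewrite -[RHS]/sq_zero sq_zero.unlock.
by apply: sq_pi_eq; rewrite subr0.
Qed.

End SubquotientTheory.

Section Span.
Variables (R : pzRingType) (V : lmodType R) (S : set V).

Definition span_set : set V := [set x | forall N : submod V, S `<=` sm_set N -> N x].

Fact span0 : span_set 0. Proof. by move=> N _; apply: sm0. Qed.
Fact spanD x y : span_set x -> span_set y -> span_set (x + y).
Proof. by move=> Sx Sy N SN; apply: smD; [apply: Sx|apply: Sy]. Qed.
Fact spanZ a x : span_set x -> span_set (a *: x).
Proof. by move=> Sx N SN; apply/smZ/Sx. Qed.

Definition sm_span : submod V := Submod span0 spanD spanZ.

Lemma span_incl x : S x -> sm_span x.
Proof. by move=> Sx N; apply. Qed.
End Span.

(* The R-module with generators T and relations S, where the free module on T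
   consists of the finitely supported functions T -> R. *)
Section Presented.
Variables (R : comPzRingType) (T : choiceType).

Definition fin_supp_set : set (T -> R^o) :=
  [set f | finite_set [set t | f t != 0]].

Fact fin_supp0 : fin_supp_set 0.
Proof.
rewrite /fin_supp_set /= (_ : [set _ | _] = set0) //.
by apply/seteqP; split=> t //=; rewrite eqxx.
Qed.
Fact fin_suppD f g : fin_supp_set f -> fin_supp_set g -> fin_supp_set (f + g).
Proof.
move=> ff fg; apply: (@sub_finite_set _ _
  ([set t | f t != 0] `|` [set t | g t != 0])); last by rewrite finite_setU.
move=> t /=; have [ft0|] := eqVneq (f t) 0; last by left.
rewrite (_ : (f + g) t = g t); first by right.
by rewrite -[RHS]add0r -ft0.
Qed.
Fact fin_suppZ a f : fin_supp_set f -> fin_supp_set (a *: f).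
Proof.
apply: sub_finite_set => t /=; apply: contra => /eqP ft0; apply/eqP.
by rewrite -[RHS](mulr0 a) -ft0.
Qed.
Definition fin_supp : submod (T -> R^o) := Submod fin_supp0 fin_suppD fin_suppZ.

Definition single (t : T) : T -> R^o := fun s => (s == t)%:R.

Definition presented (S : set (T -> R^o)) := subquot fin_supp (sm_span S).

HB.instance Definition _ S := GRing.Lmodule.on (presented S).

Definition gen (S : set (T -> R^o)) (t : T) : presented S :=
  sq_pi fin_supp (sm_span S) (single t).

Definition lin_ext (W : lmodType R) (phi : T -> W) (f : T -> R^o) : W :=
  \sum_(t \in [set: T]) (f t : R) *: phi t.

End Presented.
Arguments gen {R T} S t.

(* The linear map sending gen t to phi t, provided that phi respects S
   (see lift_gen below). *)
HB.lock Definition gen_lift (R : comPzRingType) (T : choiceType)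
  (S : set (T -> R^o)) (W : lmodType R) (phi : T -> W) (q : presented S) : W :=
  lin_ext phi (val q).
Arguments gen_lift {R T S W} phi q.
Arguments fin_supp {R T}.

Section PresentedTheory.
Variables (R : comPzRingType) (T : choiceType).
Implicit Types (f g : T -> R^o) (S : set (T -> R^o)).

Lemma lin_extE (W : lmodType R) (phi : T -> W) (A : {fset T}) f :
  (forall t, t \notin A -> f t = 0) ->
  lin_ext phi f = \sum_(t <- A) (f t : R) *: phi t.
Proof. by move=> Af; apply: fsbigTE => t /Af ->; apply: scale0r. Qed.

Lemma fin_supp_fset f : fin_supp f ->
  exists A : {fset T}, forall t, t \notin A -> f t = 0.
Proof.
move=> /finite_fsetP[A eA]; exists A => t; apply: contraNeq => ft.
by have : [set t | f t != 0] t by []; rewrite eA.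
Qed.

Lemma lin_extD (W : lmodType R) (phi : T -> W) f g :
  fin_supp f -> fin_supp g -> lin_ext phi (f + g) = lin_ext phi f + lin_ext phi g.
Proof.
move=> /fin_supp_fset[A Af] /fin_supp_fset[B Bg].
have sAB t : t \notin (A `|` B)%fset -> (f t = 0) * (g t = 0).
  by rewrite inE negb_or => /andP[/Af -> /Bg ->].
rewrite !(@lin_extE _ _ (A `|` B)%fset); last 3 first.
- by move=> t /sAB[].
- by move=> t /sAB[].
- by move=> t /sAB[f0 g0]; rewrite -[RHS](add0r (0 : R)) -{1}f0 -g0.
by rewrite -big_split; apply: eq_bigr => t _; apply: scalerDl.
Qed.

Lemma lin_extZ (W : lmodType R) (phi : T -> W) a f :
  fin_supp f -> lin_ext phi (a *: f) = a *: lin_ext phi f.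
Proof.
move=> /fin_supp_fset[A Af]; rewrite !(@lin_extE _ _ A) //; last first.
  by move=> t /Af f0; rewrite -[RHS](mulr0 a) -f0.
by rewrite scaler_sumr; apply: eq_bigr => t _; rewrite [RHS]scalerA.
Qed.

Lemma lin_ext_single (W : lmodType R) (phi : T -> W) t :
  lin_ext phi (single R t) = phi t.
Proof.
rewrite (@lin_extE _ _ [fset t]%fset); last first.
  by move=> s; rewrite inE /single => /negPf ->.
by rewrite big_seq_fset1 /single eqxx scale1r.
Qed.

Lemma fin_supp_single t : @fin_supp R T (single R t).
Proof.
apply: (@sub_finite_set _ _ [set t]); last exact: finite_set1.
by move=> s /=; rewrite /single; case: (s =P t) => // _; rewrite eqxx.
Qed.

Definition respects S (W : lmodType R) (phi : T -> W) :=
  forall s, S s -> fin_supp s /\ lin_ext phi s = 0.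

Section Lift.
Variables (S : set (T -> R^o)) (W : lmodType R) (phi : T -> W).
Hypothesis phiS : respects S phi.

Fact lift_ker0 : @fin_supp R T 0 /\ lin_ext phi 0 = 0.
Proof.
by split; [apply: sm0|rewrite (@lin_extE _ _ fset0) // big_seq_fset0].
Qed.
Fact lift_kerD f g : fin_supp f /\ lin_ext phi f = 0 ->
  fin_supp g /\ lin_ext phi g = 0 -> fin_supp (f + g) /\ lin_ext phi (f + g) = 0.
Proof.
move=> [ff f0] [fg g0]; split; first exact: smD.
by rewrite lin_extD // f0 g0 addr0.
Qed.
Fact lift_kerZ a f : fin_supp f /\ lin_ext phi f = 0 ->
  fin_supp (a *: f) /\ lin_ext phi (a *: f) = 0.
Proof.
move=> [ff f0]; split; first exact: smZ.
by rewrite lin_extZ // f0 scaler0.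
Qed.
Definition lift_ker := @Submod _ (T -> R^o) [set f | fin_supp f /\ lin_ext phi f = 0]
  lift_ker0 lift_kerD lift_kerZ.

Lemma lift_pi f : fin_supp f ->
  gen_lift (S := S) phi (sq_pi fin_supp (sm_span S) f) = lin_ext phi f.
Proof.
move=> ff; have /= [fd d0] : lift_ker (f - val (sq_pi fin_supp (sm_span S) f)).
  by apply: (sq_piK (sm_span S) ff) => s /phiS.
rewrite gen_lift.unlock; move: d0; rewrite lin_extD //; last first.
  by apply: smN; apply: sq_valP.
rewrite -scaleN1r lin_extZ; last exact: sq_valP.
by rewrite scaleN1r => /subr0_eq.
Qed.

Lemma lift_gen t : gen_lift phi (gen S t) = phi t.
Proof. by rewrite lift_pi ?lin_ext_single //; apply: fin_supp_single. Qed.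

Lemma liftD x y : gen_lift (S := S) phi (x + y) = gen_lift phi x + gen_lift phi y.
Proof.
elim/sq_ind: x => x Zx; elim/sq_ind: y => y Zy.
by rewrite -sq_piD // !lift_pi ?lin_extD //; apply: smD.
Qed.

Lemma liftZ a x : gen_lift (S := S) phi (a *: x) = a *: gen_lift phi x.
Proof.
elim/sq_ind: x => x Zx.
by rewrite -sq_piZ // !lift_pi ?lin_extZ //; apply: smZ.
Qed.

End Lift.

Lemma fin_supp_ind (P : (T -> R^o) -> Prop) :
  P 0 -> (forall a t f, fin_supp f -> P f -> P (a *: single R t + f)) ->
  forall f, fin_supp f -> P f.
Proof.
move=> P0 PD f /fin_supp_fset[A].
move: {2}#|`A|%fset (erefl #|`A|%fset) => n.
elim: n A f => [|n IH] A f /eqP.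
  rewrite cardfs_eq0 => /eqP -> f0.
  by rewrite (_ : f = 0) //; apply/funext => t; rewrite f0.
case: (fset_0Vmem A) => [->|[t tA] cA]; first by rewrite cardfs0.
move=> Af.
pose g : T -> R^o := fun s => if s == t then 0 else f s.
have -> : f = f t *: single R t + g.
  apply/funext => s; rewrite /g -[RHS]/((f t * (s == t)%:R + _)%R : R).
  by case: eqP => [->|_]; rewrite ?mulr1 ?mulr0 ?addr0 ?add0r.
have Ag s : s \notin (A `\ t)%fset -> g s = 0.
  by rewrite !inE /g; case: (s =P t) => //= _ /Af.
have cAt : #|` (A `\ t)%fset| = n.
  by apply/eqP; rewrite -eqSS -(eqP cA) (cardfsD1 t A) tA.
apply: PD; last exact: IH Ag.
apply: (@sub_finite_set _ _ [set` (A `\ t)%fset]); last exact: finite_fset.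
by move=> s /=; apply: contraNT => /Ag ->.
Qed.

Lemma presented_ind S (P : presented S -> Prop) :
  P 0 -> (forall a t x, P x -> P (a *: gen S t + x)) -> forall x, P x.
Proof.
move=> P0 PD; elim/sq_ind => f ff; move: f ff; apply: fin_supp_ind.
  by rewrite sq_pi0 //; apply: sm0.
move=> a t f ff Pf; rewrite sq_piD //; last exact/smZ/fin_supp_single.
by rewrite sq_piZ; [apply: PD|apply: fin_supp_single].
Qed.

End PresentedTheory.

Section Tensor.
Variable R : comPzRingType.

Definition bilin_rel (M N : lmodType R) : set (M * N -> R^o) :=
  [set r | (exists a x x' y, r = single R (a *: x + x', y)
              - a *: single R (x, y) - single R (x', y))
        \/ (exists a x y y', r = single R (x, a *: y + y')
              - a *: single R (x, y) - single R (x, y'))].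

Definition tensor (M N : lmodType R) := presented (@bilin_rel M N).
HB.instance Definition _ M N := GRing.Lmodule.on (tensor M N).
Definition tens (M N : lmodType R) (x : M) (y : N) : tensor M N :=
  gen (@bilin_rel M N) (x, y).

(* The tensor algebra T(M) = \bigoplus_k M^{\otimes_R k} as an R-module:
   word [:: x_1; ...; x_k] is x_1 \otimes ... \otimes x_k. *)
Definition multilin_rel (M : lmodType R) : set (seq M -> R^o) :=
  [set r | exists a x x' u v, r = single R (u ++ (a *: x + x') :: v)
              - a *: single R (u ++ x :: v) - single R (u ++ x' :: v)].

Definition talg (M : lmodType R) := presented (@multilin_rel M).
HB.instance Definition _ M := GRing.Lmodule.on (talg M).
Definition word (M : lmodType R) (w : seq M) : talg M :=
  gen (@multilin_rel M) w.

(* Projection to the summand M^{\otimes k}, and its identification with R, M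
   for k = 0, 1. *)
Definition tpart (M : lmodType R) (k : nat) : talg M -> talg M :=
  gen_lift (fun w => if size w == k then word w else 0).
Definition tpart0 (M : lmodType R) : talg M -> R^o :=
  gen_lift (fun w => if w is [::] then 1 : R^o else 0).
Definition tpart1 (M : lmodType R) : talg M -> M :=
  gen_lift (fun w => if w is [:: x] then x else 0).

Definition tsplit (M : lmodType R) : talg M -> tensor (talg M) (talg M) :=
  gen_lift (fun w => \sum_(i < (size w).+1) tens (word (take i w)) (word (drop i w))).

(* The algebra endomorphism of T(M) extending a linear endomorphism of M. *)
Definition tmap (M : lmodType R) (s : M -> M) : talg M -> talg M :=
  gen_lift (fun w => word (map s w)).

End Tensor.

Section TensorTheory.
Variable R : comPzRingType.

Lemma lin_ext_rel (T : choiceType) (W : lmodType R) (phi : T -> W) a t0 t1 t2 :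
  phi t0 = a *: phi t1 + phi t2 ->
  fin_supp (single R t0 - a *: single R t1 - single R t2) /\
  lin_ext phi (single R t0 - a *: single R t1 - single R t2) = 0.
Proof.
move=> e; have f0 := @fin_supp_single R T t0.
have f1 := smZ a (@fin_supp_single R T t1); have f2 := @fin_supp_single R T t2.
have f01 := smB f0 f1; split; first exact: smB.
rewrite lin_extD //; last exact: smN.
rewrite lin_extD //; last exact: smN.
rewrite -!scaleN1r !lin_extZ //; last exact: fin_supp_single.
by rewrite !lin_ext_single e !scaleN1r -addrA -opprD subrr.
Qed.

Lemma gen_rel (T : choiceType) (S : set (T -> R^o)) a t0 t1 t2 :
  S (single R t0 - a *: single R t1 - single R t2) ->
  gen S t0 = a *: gen S t1 + gen S t2.
Proof.
move=> /span_incl Sr; have f0 := @fin_supp_single R T t0.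
have f1 := smZ a (@fin_supp_single R T t1); have f2 := @fin_supp_single R T t2.
rewrite /gen -sq_piZ; last exact: fin_supp_single.
rewrite -sq_piD //; apply: sq_pi_eq.
by move: Sr; rewrite -addrA -opprD.
Qed.

Section Bilinear.
Variables M N : lmodType R.

Lemma tensPl a (x x' : M) (y : N) :
  tens (a *: x + x') y = a *: tens x y + tens x' y.
Proof. by apply: gen_rel; left; exists a, x, x', y. Qed.

Lemma tensPr a (x : M) (y y' : N) :
  tens x (a *: y + y') = a *: tens x y + tens x y'.
Proof. by apply: gen_rel; right; exists a, x, y, y'. Qed.

Lemma bilin_respects (W : lmodType R) (phi : M * N -> W) :
  (forall a x x' y, phi (a *: x + x', y) = a *: phi (x, y) + phi (x', y)) ->
  (forall a x y y', phi (x, a *: y + y') = a *: phi (x, y) + phi (x, y')) ->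
  respects (@bilin_rel R M N) phi.
Proof.
by move=> Hl Hr r [] [a [x [x' [y ->]]]]; apply: lin_ext_rel; rewrite (Hl, Hr).
Qed.

End Bilinear.

Section Multilinear.
Variable M : lmodType R.

Lemma wordP a (x x' : M) u v : word (u ++ (a *: x + x') :: v) =
  a *: word (u ++ x :: v) + word (u ++ x' :: v).
Proof. by apply: gen_rel; exists a, x, x', u, v. Qed.

Lemma multilin_respects (W : lmodType R) (phi : seq M -> W) :
  (forall a x x' u v, phi (u ++ (a *: x + x') :: v) =
     a *: phi (u ++ x :: v) + phi (u ++ x' :: v)) ->
  respects (@multilin_rel R M) phi.
Proof.
by move=> H r [a [x [x' [u [v ->]]]]]; apply: lin_ext_rel; rewrite H.
Qed.

Lemma tpart_respects k :
  respects (@multilin_rel R M) (fun w => if size w == k then word w else 0).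
Proof.
apply: multilin_respects => a x x' u v; rewrite !size_cat /=.
by case: eqP => _; [apply: wordP|rewrite scaler0 addr0].
Qed.

Lemma tpart0_respects :
  respects (@multilin_rel R M) (fun w => if w is [::] then 1 : R^o else 0).
Proof.
by apply: multilin_respects => a x x' [|? ?] v /=; rewrite scaler0 addr0.
Qed.

Lemma tpart1_respects :
  respects (@multilin_rel R M) (fun w => if w is [:: x] then x else 0).
Proof.
by apply: multilin_respects => a x x' [|y [|? ?]] [|? ?] //=; rewrite scaler0 addr0.
Qed.

Lemma tsplit_respects : respects (@multilin_rel R M)
  (fun w => \sum_(i < (size w).+1) tens (word (take i w)) (word (drop i w))).
Proof.
apply: multilin_respects => a x x' u v; rewrite !size_cat /=.
rewrite scaler_sumr -big_split; apply: eq_bigr => i _ /=.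
rewrite !take_cat !drop_cat; case: ltnP => iu; first by rewrite wordP tensPr.
case: (i - size u)%N => [|j] /=; first by rewrite -[_ :: v]cat0s wordP tensPr.
by rewrite wordP tensPl.
Qed.

Lemma tmap_respects (s : M -> M) :
  (forall a x y, s (a *: x + y) = a *: s x + s y) ->
  respects (@multilin_rel R M) (fun w => word (map s w)).
Proof.
move=> sP; apply: multilin_respects => a x x' u v.
by rewrite !map_cat /= sP wordP.
Qed.

Lemma tsplit_word (w : seq M) : tsplit (word w) =
  \sum_(i < (size w).+1) tens (word (take i w)) (word (drop i w)).
Proof. exact/lift_gen/tsplit_respects. Qed.

Lemma tpart_word k (w : seq M) :
  tpart k (word w) = if size w == k then word w else 0.
Proof. exact/lift_gen/tpart_respects. Qed.

Lemma tpartP k a (x y : talg M) : tpart k (a *: x + y) = a *: tpart k x + tpart k y.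
Proof. by rewrite /tpart liftD ?liftZ //; apply: tpart_respects. Qed.

Lemma tpart0r k : tpart k (0 : talg M) = 0.
Proof. by have := tpartP k (-1) 0 0; rewrite scaler0 addr0 scaleN1r addNr. Qed.

Lemma tpartK j k (t : talg M) :
  tpart j (tpart k t) = if j == k then tpart k t else 0.
Proof.
elim/presented_ind: t => [|a w t IH]; first by rewrite !tpart0r if_same.
rewrite !tpartP IH tpart_word; case: (size w =P k) => [wk|_].
  rewrite tpart_word wk [k == j]eq_sym.
  by case: eqP => // _; rewrite scaler0 addr0.
by rewrite tpart0r; case: eqP => _; rewrite ?scaler0 ?addr0.
Qed.

Lemma tpart_bound (t : talg M) :
  exists n, (forall k, (n <= k)%N -> tpart k t = 0) /\
    t = \sum_(k < n) tpart k t.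
Proof.
suff [n Hn] : exists n, forall m, (n <= m)%N ->
    tpart m t = 0 /\ t = \sum_(k < m) tpart k t.
  by exists n; split=> [k /Hn[]|] //; have [] := Hn n (leqnn n).
elim/presented_ind: t => [|a w t [n IH]].
  exists 0%N => m _; rewrite tpart0r big1 // => k _; exact: tpart0r.
exists (maxn n (size w).+1) => m; rewrite geq_max => /andP[nm wm].
have [t0 et] := IH m nm; split.
  by rewrite tpartP t0 tpart_word ltn_eqF // scaler0 addr0.
under eq_bigr do rewrite tpartP tpart_word.
rewrite big_split /= -et -scaler_sumr; congr (_ *: _ + _).
rewrite (bigD1 (Ordinal wm)) //= eqxx big1 ?addr0 // => i.
by rewrite -val_eqE /= eq_sym => /negPf ->.
Qed.

End Multilinear.
End TensorTheory.

(* The degree (cd, ls). *)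
Notation degree := (int * 'Z_2)%type.

(* A direct sum decomposition of V indexed by degrees, given by its projections. *)
Record grading (V : zmodType) := Grading {
  gr_proj : degree -> V -> V;
  gr_projD : forall p, {morph gr_proj p : x y / x + y};
  gr_projK : forall p q x,
    gr_proj p (gr_proj q x) = if p == q then gr_proj p x else 0;
  gr_finite : forall x, finite_set [set p | gr_proj p x != 0];
  gr_sum : forall x, \sum_(p \in [set: degree]) gr_proj p x = x }.

Definition gr_homog (V : zmodType) (g : grading V) (p : degree) : set V :=
  [set x | gr_proj g p x = x].

(* (2Z (+) 0)-graded commutative algebras. *)
Record gr_alg (K : realType) := GrAlg {
  ga_alg :> comAlgType K;
  ga_gr : grading ga_alg;
  ga_scale : forall p (a : K) r, gr_homog ga_gr p r -> gr_homog ga_gr p (a *: r);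
  ga_one : gr_homog ga_gr 0 1;
  ga_mul : forall p q r s, gr_homog ga_gr p r -> gr_homog ga_gr q s ->
    gr_homog ga_gr (p + q) (r * s);
  ga_even : forall p r, gr_homog ga_gr p r -> r != 0 ->
    (2 %| p.1)%Z /\ p.2 = 0 }.

Record gr_mod (K : realType) (R : gr_alg K) := GrMod {
  gm_mod :> lmodType R;
  gm_gr : grading gm_mod;
  gm_scale : forall p q r x, gr_homog (ga_gr R) p r -> gr_homog gm_gr q x ->
    gr_homog gm_gr (p + q) (r *: x) }.

Notation homog := (gr_homog (gm_gr _)).

Definition gsign (K : realType) (R : gr_alg K) (C : gr_mod R)
    (chi : degree -> int) (x : C) : C :=
  \sum_(p \in [set: degree]) (-1) ^+ `|chi p|%N *: gr_proj (gm_gr C) p x.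

(* Parity of ls, as an integer usable in sign exponents. *)
Definition lsz (p : degree) : int := (p.2 : nat)%:Z.

Definition is_graded (K : realType) (R : gr_alg K) (C D : gr_mod R)
    (e : degree) (f : C -> D) :=
  forall p x, homog p x -> homog (p + e) (f x).

Record dg_mod (K : realType) (R : gr_alg K) := DgMod {
  dg_gm :> gr_mod R;
  dg_d : {linear dg_gm -> dg_gm};
  dg_deg : is_graded (1, 0) dg_d;
  dg_sq : forall x, dg_d (dg_d x) = 0 }.

Definition dg_d' (K : realType) (R : gr_alg K) (C : dg_mod R) (x : C) : C :=
  dg_d C (gsign (fun p => p.1) x).

Section GradingTheory.
Variables (V : zmodType) (g : grading V).

Lemma gr_proj0 p : gr_proj g p 0 = 0.
Proof. by apply: (addrI (gr_proj g p 0)); rewrite -gr_projD !addr0. Qed.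

Lemma gr_proj_sum p (I : Type) (r : seq I) (F : I -> V) :
  gr_proj g p (\sum_(i <- r) F i) = \sum_(i <- r) gr_proj g p (F i).
Proof. exact: (big_morph _ (gr_projD g p) (gr_proj0 p)). Qed.

Lemma gr_homog_proj p x : gr_homog g p (gr_proj g p x).
Proof. by rewrite /gr_homog /= gr_projK eqxx. Qed.

Lemma gr_proj_homog p q x :
  gr_homog g p x -> gr_proj g q x = if q == p then x else 0.
Proof. by move=> <-; rewrite gr_projK; case: eqP => // ->. Qed.

Lemma gr_sum_fset x : exists A : {fset degree},
  (forall p, p \notin A -> gr_proj g p x = 0) /\
  x = \sum_(p <- A) gr_proj g p x.
Proof.
have /finite_fsetP[A eA] := gr_finite g x.
have A0 p : p \notin A -> gr_proj g p x = 0.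
  apply: contraNeq => xp.
  by have : [set p | gr_proj g p x != 0] p by []; rewrite eA.
by exists A; split=> //; rewrite -[LHS](gr_sum g x) (fsbigTE A).
Qed.

End GradingTheory.

Section DgTheory.
Variables (K : realType) (R : gr_alg K).

Lemma dg_proj (C : dg_mod R) p x :
  dg_d C (gr_proj (gm_gr C) p x) = gr_proj (gm_gr C) (p + (1, 0)) (dg_d C x).
Proof.
have [A [A0 ex]] := gr_sum_fset (gm_gr C) x.
rewrite {2}ex raddf_sum gr_proj_sum.
rewrite (eq_bigr (fun q => if q == p then dg_d C (gr_proj (gm_gr C) p x) else 0)).
  case: (boolP (p \in A)) => pA.
    rewrite (bigD1_seq p) ?fset_uniq //= eqxx big1 ?addr0 // => q.
    by move=> /negPf ->.
  rewrite A0 // raddf0 big1 // => q _; by case: eqP.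
move=> q _; rewrite (gr_proj_homog _ (dg_deg (gr_homog_proj (gm_gr C) q x))).
rewrite (inj_eq (addIr _)) eq_sym.
by case: eqP => [->|].
Qed.

End DgTheory.

Section Cohomology.
Variables (K : realType) (R : gr_alg K) (C : dg_mod R).

Fact cocycle0 : dg_d C 0 = 0. Proof. exact: raddf0. Qed.
Fact cocycleD (x y : C) : dg_d C x = 0 -> dg_d C y = 0 -> dg_d C (x + y) = 0.
Proof. by move=> x0 y0; rewrite raddfD /= x0 y0 addr0. Qed.
Fact cocycleZ a (x : C) : dg_d C x = 0 -> dg_d C (a *: x) = 0.
Proof. by move=> x0; rewrite linearZ /= x0 scaler0. Qed.
Definition cocycle : submod C :=
  @Submod _ C [set x | dg_d C x = 0] cocycle0 cocycleD cocycleZ.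

Definition coboundary_set : set C := [set x | exists y, x = dg_d C y].
Fact coboundary0 : coboundary_set 0. Proof. by exists 0; rewrite raddf0. Qed.
Fact coboundaryD x y :
  coboundary_set x -> coboundary_set y -> coboundary_set (x + y).
Proof. by move=> [u ->] [v ->]; exists (u + v); rewrite raddfD. Qed.
Fact coboundaryZ a x : coboundary_set x -> coboundary_set (a *: x).
Proof. by move=> [u ->]; exists (a *: u); rewrite linearZ. Qed.
Definition coboundary : submod C :=
  Submod coboundary0 coboundaryD coboundaryZ.

Definition coh_mod : lmodType R := subquot cocycle coboundary.
Definition coh_class (x : C) : coh_mod := sq_pi cocycle coboundary x.

Definition coh_proj (p : degree) (h : coh_mod) : coh_mod :=
  coh_class (gr_proj (gm_gr C) p (val h)).

Lemma cocycle_proj p x : cocycle x -> cocycle (gr_proj (gm_gr C) p x).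
Proof. by move=> /= x0; rewrite dg_proj x0 gr_proj0. Qed.

Lemma coh_projE p x :
  cocycle x -> coh_proj p (coh_class x) = coh_class (gr_proj (gm_gr C) p x).
Proof.
move=> cx; apply: sq_pi_eq.
have [y exy] := sq_piK coboundary cx.
exists (- gr_proj (gm_gr C) (p - (1, 0)) y).
rewrite raddfN /= dg_proj subrK -exy gr_projD.
rewrite opprD [RHS]addrC; congr (_ + _).
by apply/eqP; rewrite -addr_eq0 -gr_projD subrr gr_proj0.
Qed.

Lemma coh_class0 : coh_class 0 = 0.
Proof. exact/sq_pi0/sm0. Qed.

Lemma coh_class_sum (I : Type) (r : seq I) (F : I -> C) :
  (forall i, cocycle (F i)) ->
  coh_class (\sum_(i <- r) F i) = \sum_(i <- r) coh_class (F i).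
Proof.
move=> cF; elim: r => [|i r IH]; first by rewrite !big_nil coh_class0.
rewrite !big_cons -IH; apply: sq_piD => //.
elim: r {IH} => [|j r IHr]; first by rewrite big_nil; apply: sm0.
by rewrite big_cons; apply: smD.
Qed.

Fact coh_projD p : {morph coh_proj p : x y / x + y}.
Proof.
elim/sq_ind=> x cx; elim/sq_ind=> y cy.
rewrite -sq_piD // !coh_projE //; last exact: smD.
by rewrite gr_projD; apply: sq_piD; [apply: cocycle_proj cx|apply: cocycle_proj cy].
Qed.

Fact coh_projK p q h :
  coh_proj p (coh_proj q h) = if p == q then coh_proj p h else 0.
Proof.
elim/sq_ind: h => x cx.
rewrite (coh_projE q cx) (coh_projE p (cocycle_proj q cx)) (coh_projE p cx).
by rewrite gr_projK; case: eqP => // _; apply: coh_class0.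
Qed.

Lemma coh_proj_fset h : exists A : {fset degree},
  (forall p, p \notin A -> coh_proj p h = 0) /\
  h = \sum_(p <- A) coh_proj p h.
Proof.
elim/sq_ind: h => x cx.
have [A [A0 ex]] := gr_sum_fset (gm_gr C) x.
exists A; split=> [p pA|]; first by rewrite coh_projE // A0 // coh_class0.
under eq_bigr do rewrite coh_projE //.
by rewrite -coh_class_sum -?ex // => p; apply: cocycle_proj.
Qed.

Fact coh_finite h : finite_set [set p | coh_proj p h != 0].
Proof.
have [A [A0 _]] := coh_proj_fset h.
apply: (@sub_finite_set _ _ [set` A]); last exact: finite_fset.
by move=> p /=; apply: contraNT => /A0 ->.
Qed.

Fact coh_sum h : \sum_(p \in [set: degree]) coh_proj p h = h.
Proof. by have [A [A0 eh]] := coh_proj_fset h; rewrite (fsbigTE A). Qed.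

Definition coh_gr : grading coh_mod :=
  Grading coh_projD coh_projK coh_finite coh_sum.

Fact coh_scale p q r h : gr_homog (ga_gr R) p r -> gr_homog coh_gr q h ->
  gr_homog coh_gr (p + q) (r *: h).
Proof.
move=> rp; elim/sq_ind: h => x cx; rewrite /gr_homog /= coh_projE // => <-.
have cq := cocycle_proj q cx.
rewrite -sq_piZ // coh_projE; last exact: smZ.
by rewrite (gm_scale rp (gr_homog_proj (gm_gr C) q x)).
Qed.

Definition cohomology : gr_mod R := GrMod coh_scale.

End Cohomology.

Section ZeroDg.
Variables (K : realType) (R : gr_alg K) (H : gr_mod R).

Fact zero_dg_deg : is_graded (1, 0) (\0 : H -> H).
Proof. by move=> p x _; apply: gr_proj0. Qed.
Fact zero_dg_sq (x : H) : (\0 : H -> H) ((\0 : H -> H) x) = 0.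
Proof. by []. Qed.
Definition zero_dg : dg_mod R := @DgMod K R H \0 zero_dg_deg zero_dg_sq.
End ZeroDg.

Record retraction (K : realType) (R : gr_alg K) (C : dg_mod R) (H : gr_mod R) :=
  Retraction {
  rt_Pi : {linear C -> H};
  rt_I : {linear H -> C};
  rt_h : {linear C -> C};
  rt_Pi_deg : is_graded 0 rt_Pi;
  rt_I_deg : is_graded 0 rt_I;
  rt_h_deg : is_graded (-1, 0) rt_h;
  rt_Pid : forall x : C, rt_Pi (dg_d' x) = 0;
  rt_dI : forall y : H, dg_d' (rt_I y) = 0;
  rt_PiI : forall y : H, rt_Pi (rt_I y) = y;
  rt_htpy : forall x : C,
    dg_d' (rt_h x) + rt_h (dg_d' x) = rt_I (rt_Pi x) - x;
  rt_hh : forall x : C, rt_h (rt_h x) = 0;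
  rt_Pih : forall x : C, rt_Pi (rt_h x) = 0;
  rt_hI : forall y : H, rt_h (rt_I y) = 0 }.

(* E(G) is required to be discrete in the sense of having no accumulation point
   in the real line (closed, with isolated points): this is what makes the
   convolution products below finite (finite_decomp). *)
Record discrete_submonoid (K : realType) := DiscreteSubmonoid {
  ds_set :> set (K * int);
  ds0 : ds_set 0;
  dsD : forall a b, ds_set a -> ds_set b -> ds_set (a + b);
  ds_ge0 : forall a, ds_set a -> 0 <= a.1;
  ds_closed : closed (fst @` ds_set);
  ds_discrete : fst @` ds_set `<=` isolated (fst @` ds_set);
  ds_fibre : forall l : K, finite_set (ds_set `&` [set a | a.1 = l]) }.

Section Energy.
Variables (K : realType) (G : discrete_submonoid K).

Definition gelt : Type := set_type (ds_set G).
HB.instance Definition _ := Choice.on gelt.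

Definition gzero : gelt := SigSub (mem_set (ds0 G)).
Definition energy (b : gelt) : K := (val b).1.
Definition mu (b : gelt) : int := (val b).2.
Definition gdeg (b : gelt) : degree := (mu b, (mu b)%:~R).

Definition decomp (b : gelt) : set (gelt * gelt) :=
  [set p | val p.1 + val p.2 = val b].

(* A family x : gelt -> V is the formal sum \sum_b x_b epsilon^mu(b) T^E(b), with
   the Novikov variables written on the right; for V a graded R-module this is
   \Lambda \hat\otimes_R V, and V = R gives the Novikov ring \Lambda. *)
Definition filt (V : zmodType) (e : K) : set (gelt -> V) :=
  [set x | forall b, energy b < e -> x b = 0].
Definition filt_pos (V : zmodType) : set (gelt -> V) :=
  [set x | exists2 e, 0 < e & filt e x].

(* The formal sum with single term v T^0 epsilon^0. *)
Definition gconst (V : zmodType) (v : V) : gelt -> V :=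
  fun b => if b == gzero then v else 0.

End Energy.

Section FiniteDecomp.
Variables (K : realType) (G : discrete_submonoid K).

Lemma energy_ge0 (b : gelt G) : 0 <= energy b.
Proof. by case: b => b Gb; apply: (@ds_ge0 _ G); apply: set_mem. Qed.

Lemma finite_energy (c : K) : finite_set [set b : gelt G | energy b <= c].
Proof.
pose E := fst @` ds_set G; pose Ec := E `&` [set l | l <= c].
have finE : finite_set Ec.
  apply: contrapT => /infinite_bounded_limit_point_nonempty.
  case.
    exists c; split; first exact: num_real.
    move=> M cM l [[a Ga <-] /= ac].
    by rewrite ger0_norm ?(ds_ge0 Ga) // (le_trans ac) // ltW.
  move=> l lEc; have lE : limit_point E l.
    by move=> V /lEc[y [yl [Ey _] Vy]]; exists y.
  have El : E l by apply/(@ds_closed _ G)/subset_limit_point.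
  have /disj_setPS/(_ l) := @disjoint_isolated_limit_point _ E.
  by apply; split=> //; apply: ds_discrete.
apply: (@sub_finite_set _ _ (\bigcup_(l in Ec)
    (val @^-1` (ds_set G `&` [set a | a.1 = l])))).
  move=> b /= bc; have Gb : ds_set G (val b) by case: (b) => a /= /set_mem.
  by exists (energy b) => //; split=> //; exists (val b).
apply: bigcup_finite => // l _.
apply: finite_preimage; last exact: ds_fibre.
by move=> x y _ _; apply: val_inj.
Qed.

Lemma finite_decomp (b : gelt G) : finite_set (decomp b).
Proof.
apply: (@sub_finite_set _ _ ([set b1 : gelt G | energy b1 <= energy b] `*`
    [set b2 : gelt G | energy b2 <= energy b])); last first.
  by apply: finite_setX; apply: finite_energy.
move=> [b1 b2] /= e.
have -> : energy b = energy b1 + energy b2 by rewrite /energy -e.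
by split; rewrite /= ?lerDl ?lerDr energy_ge0.
Qed.

End FiniteDecomp.

Section Bar.
Variables (K : realType) (G : discrete_submonoid K) (R : gr_alg K).
Implicit Types (C : gr_mod R) (b : gelt G).

(* A word of letters x_j of degrees q_j has degree \sum_j (q_j - (1, 0)). *)
Inductive t_homog C : degree -> talg C -> Prop :=
| TH_zero p : t_homog p 0
| TH_add p t u : t_homog p t -> t_homog p u -> t_homog p (t + u)
| TH_word p r (qs : seq degree) (w : seq C) :
    gr_homog (ga_gr R) p r -> List.Forall2 homog qs w ->
    t_homog (p + \sum_(q <- qs) (q - (1, 0))) (r *: word w).

(* t |-> (-1)^(chi x_1 + ... + chi x_k) t on words t = x_1 ... x_k. *)
Definition t_sign C (chi : degree -> int) : talg C -> talg C :=
  tmap (gsign chi).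

(* Exponent of the sign produced when epsilon^n moves past a letter of C^G[1]. *)
Definition eps_chi (n : int) (q : degree) : int := (q.1 + lsz q + 1) * n.

Definition novikov : Type := gelt G -> R.
HB.instance Definition _ := GRing.Zmodule.on novikov.
Definition completed C : Type := gelt G -> C.

(* Writing Novikov variables on the right identifies the k-fold completed
   tensor power of C^G[1] over \Lambda with formal sums with coefficients in
   the k-fold tensor power of C over R, so that the completed direct sum of these
   consists of formal sums with coefficients in T(C): see bar_seqP. *)
Definition bar C : Type := gelt G -> talg C.
HB.instance Definition _ C := GRing.Lmodule.on (bar C).

(* \mathcal{B} \overline\otimes \mathcal{B} in the same normal form. *)
Definition bar2 C : Type := gelt G -> tensor (talg C) (talg C).
HB.instance Definition _ C := GRing.Lmodule.on (bar2 C).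

Definition nov_homog (p : degree) : set novikov :=
  [set a | forall b, gr_homog (ga_gr R) (p - gdeg b) (a b)].
Definition bar_homog C (p : degree) : set (bar C) :=
  [set x | forall b, t_homog (p - gdeg b) (x b)].

Definition lact C (a : novikov) (x : bar C) : bar C := fun b =>
  \sum_(p \in decomp b) a p.1 *: t_sign (eps_chi (mu p.1)) (x p.2).
Definition ract C (x : bar C) (a : novikov) : bar C := fun b =>
  \sum_(p \in decomp b) a p.2 *: x p.1.

Definition otens C (x y : bar C) : bar2 C := fun b =>
  \sum_(p \in decomp b) tens (x p.1) (t_sign (eps_chi (mu p.1)) (y p.2)).

Definition Delta C (x : bar C) : bar2 C := fun b => tsplit (x b).
Definition counit C (x : bar C) : novikov := fun b => tpart0 (x b).
Definition pi1 C (x : bar C) : completed C := fun b => tpart1 (x b).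
Definition i0 C (a : novikov) : bar C := fun b => a b *: word [::].
Definition nov1 : novikov := gconst (1 : R).

(* The right \Lambda-linear extension to B (x) B of a map defined on T(C) (x) T(C). *)
Definition rext C D (phi : tensor (talg C) (talg C) -> bar2 D) (z : bar2 C) :
    bar2 D := fun b => \sum_(p \in decomp b) phi (z p.1) p.2.

Definition otens_map C D (f1 f2 : bar C -> bar D) : bar2 C -> bar2 D :=
  rext (gen_lift (fun tu : talg C * talg C =>
    otens (f1 (gconst tu.1)) (f2 (gconst tu.2)))).

(* h \otimes f2 \pm f1 \otimes h for h of degree d *)
Definition otens_coder C D (d : int) (f1 f2 h : bar C -> bar D) :
    bar2 C -> bar2 D :=
  rext (gen_lift (fun tu : talg C * talg C =>
    otens (h (gconst tu.1)) (f2 (gconst tu.2))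
    + otens (f1 (gconst (t_sign (fun q => d * (q.1 - 1)) tu.1)))
        (h (gconst tu.2)))).

Record degree_map C D (d : int) (h : bar C -> bar D) : Prop := DegreeMap {
  dmD : forall x y : bar C, h (x + y) = h x + h y;
  dm_filt : forall e x, filt e x -> filt e (h x);
  dm_deg : forall p x, bar_homog p x -> bar_homog (p + (d, 0)) (h x);
  dm_bilin : forall (p : degree) a x c, nov_homog p a ->
    h (lact a (ract x c)) = (-1) ^+ `|(d * p.1)%R|%N *: lact a (ract (h x) c) }.

Record coalg_morphism C D (f : bar C -> bar D) : Prop := CoalgMorphism {
  cm_map : degree_map 0 f;
  cm_Delta : forall x, Delta (f x) = otens_map f f (Delta x);
  cm_counit : forall x, counit (f x) = counit x }.

Record coderivation C D (d : int) (f1 f2 h : bar C -> bar D) : Prop :=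
  Coderivation {
  cd_map : degree_map d h;
  cd_counit : forall x, counit (h x) = 0;
  cd_Delta : forall x, Delta (h x) = otens_coder d f1 f2 h (Delta x) }.

Definition tame C D (f : bar C -> bar D) : Prop :=
  filt_pos (pi1 (f (i0 C nov1))).

Record twisted_alg C (m : bar C -> bar C) : Prop := TwistedAlg {
  ta_coder : coderivation 1 id id m;
  ta_sq : forall x, m (m x) = 0;
  ta_tame : tame m }.

(* m_{k,b}(x_1, ..., x_k): the coefficient of pi1 (m (x_1 ... x_k)) at
   epsilon^mu(b) T^E(b), the Novikov variables being written on the left. *)
Definition component C (m : bar C -> bar C) (k : nat) (b : gelt G)
    (x : k.-tuple C) : C :=
  gsign (eps_chi (mu b)) (pi1 (m (gconst (word x))) b).

Definition perturbation (C : dg_mod R) (m : bar C -> bar C) : Prop :=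
  forall x : C, component m (gzero G) [tuple x] = dg_d' x.

Record twisted_morphism C D (m : bar C -> bar C) (m' : bar D -> bar D)
    (f : bar C -> bar D) : Prop := TwistedMorphism {
  tm_mor : coalg_morphism f;
  tm_tame : tame f;
  tm_comm : forall x, f (m x) = m' (f x) }.

Record homotopy C D (m : bar C -> bar C) (m' : bar D -> bar D)
    (f1 f2 h : bar C -> bar D) : Prop := Homotopy {
  ht_coder : coderivation (-1) f1 f2 h;
  ht_eq : forall x, m' (h x) + h (m x) = f2 x - f1 x }.

End Bar.

Section BarSeq.
Variables (K : realType) (G : discrete_submonoid K) (R : gr_alg K).
Variable C : gr_mod R.

(* The elements of the completed direct sum as sequences: x_k is a formal sum with
   coefficients in C^{\otimes k}, lying in F^{E_k} for some E_k tending to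
   infinity. *)
Definition bar_seq (x_ : nat -> bar G C) : Prop :=
  (forall k b, tpart k (x_ k b) = x_ k b) /\
  (exists2 e : nat -> K, e n @[n --> \oo] --> +oo & forall k, filt (e k) (x_ k)).

Lemma tpart_ext (t u : talg C) : (forall k, tpart k t = tpart k u) -> t = u.
Proof.
suff sub (v : talg C) : (forall k, tpart k v = 0) -> v = 0.
  move=> tu; apply/eqP; rewrite -subr_eq0; apply/eqP/sub => k.
  by rewrite addrC -scaleN1r tpartP tu scaleN1r addNr.
by move=> v0; have [n [_ ->]] := tpart_bound v; apply: big1 => k _.
Qed.

Lemma bar_seqP x_ :
  bar_seq x_ -> exists! x : bar G C, forall k b, tpart k (x b) = x_ k b.
Proof.
move=> [xk [e ey ex]].
have /choice[N HN] : forall b, exists N, forall k, (N <= k)%N -> x_ k b = 0.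
  move=> b; move/cvgryPgt: ey => /(_ (energy b))[N _ HN].
  by exists N => k Nk; apply: ex; apply: HN.
have Hx b j : tpart j (\sum_(k < N b) x_ k b) = x_ j b.
  rewrite (big_morph (tpart j) (id1 := 0) (op1 := +%R)); last exact: tpart0r.
    under eq_bigr do rewrite -xk tpartK xk.
    case: (ltnP j (N b)) => jN.
      rewrite (bigD1 (Ordinal jN)) //= eqxx big1 ?addr0 // => i.
      by rewrite -val_eqE /= eq_sym => /negPf ->.
    rewrite (HN _ _ jN) big1 // => i _; case: eqP => // ji.
    by move: (ltn_ord i); rewrite -ji ltnNge jN.
  by move=> t u; rewrite -[t]scale1r tpartP !scale1r.
exists (fun b => \sum_(k < N b) x_ k b); split=> // y Hy.
by apply/funext => b; apply: tpart_ext => j; rewrite Hy Hx.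
Qed.

Lemma bar_seq_tpart (x : bar G C) : bar_seq (fun k b => tpart k (x b)).
Proof.
split=> [k b|]; first by rewrite tpartK eqxx.
pose P k n := `[< filt (n%:R : K) (fun b => tpart k (x b)) >].
have P0 k : P k (ord0 : 'I_k.+1).
  by apply/asboolP => b; rewrite ltNge energy_ge0.
pose e k := [arg max_(n > (ord0 : 'I_k.+1) | P k n) (n : nat)].
exists (fun k => (e k : nat)%:R); last first.
  by move=> k; rewrite /e; case: arg_maxnP => // i /asboolP.
apply/cvgryPge => A.
have [n An] : exists n : nat, A <= n%:R.
  exists (Num.truncn `|A|).+1; apply: le_trans (ler_norm A) _.
  by apply: ltW; apply: truncnS_gt.
have /finite_fsetP[B eB] := finite_energy G n%:R.
have /choice[N HN] : forall b : gelt G,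
    exists N, forall k, (N <= k)%N -> tpart k (x b) = 0.
  by move=> b; have [N []] := tpart_bound (x b); exists N.
exists (maxn n (\max_(b <- B) N b)) => // k /=.
rewrite geq_max => /andP[nk Nk]; apply: le_trans An _; rewrite ler_nat.
rewrite /e; case: arg_maxnP => // i _ /(_ (inord n)).
rewrite inordK ?ltnS //; apply; apply/asboolP => b bn.
apply: HN; apply: leq_trans Nk.
have bB : [set` B] b by rewrite -eB /= ltW.
exact: leq_bigmax_seq bB _.
Qed.

End BarSeq.

(* Main.v *)
Require Import Defs.
From mathcomp Require Import all_boot all_order all_algebra finmap zify.
From mathcomp Require Import all_classical all_reals all_analysis.
Set Implicit Arguments.
Unset Strict Implicit.
Unset Printing Implicit Defensive.
Import Order.TTheory GRing.Theory Num.Theory.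
Local Open Scope classical_set_scope.
Local Open Scope ring_scope.

(** The theorem is the homological perturbation lemma, applied to bar
    coalgebras, together with the fact that the perturbation lemma respects
    coalgebra structures.

    Write m = D + e, where D is the coderivation of the bar coalgebra extending
    d'.  By the tensor trick the retraction (Pi, I, h) of C to HC extends to a
    contraction of the bar coalgebra of C, with differential D, onto that of
    HC, with zero differential: p and i apply Pi and I to every letter, and on
    words the homotopy is the sum of the maps
    1 (x) ... (x) 1 (x) h (x) I Pi (x) ... (x) I Pi, with Koszul signs
    ([tt_Dh], [tt_hh]).  It is a coderivation from the identity to i p, and the
    side conditions h h = 0, p h = 0, h i = 0 survive.

    If A is an inverse of 1 - e h, the perturbation lemma asserts that
      P = p A,   J = i + h A e i,   H = h A,   m^can = p A e i
    are maps of complexes, a homotopy from 1 to J P, and a differential, with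
    P J = 1.  All of this follows from the identity
    A e i p A = A (D + e) - D A ([hpl_Aei]).

    The inverse is the series of the powers of N = e h ([neumann]).  Modulo
    positive energy, m has no curvature and its linear part is d', so the
    coderivation e strictly lowers word length there ([leading_word]), while h
    preserves it.  Hence N modulo positive energy is locally nilpotent, and as
    only finitely many energies lie below a given one, N is topologically
    nilpotent ([iter_vanish]).  The same remark shows that P, J and m^can are
    tame and that m^can has no linear part at energy 0.

    Compatibility with the coproduct needs no formula for the components.
    The rules for e and h are identities
      Delta e = (e (x) 1 + 1 (x) e) Delta,
      Delta h = (h (x) i p + 1 (x) h) Delta.
    To see, for instance, that P is a coalgebra morphism, compose
    Delta P and (P (x) P) Delta with the surjection 1 - e h: the first becomes
    Delta p, and expanding the second with P h = 0, P i = 1 and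
    P e h = P - p leaves (p (x) p) Delta.  The other cases are similar
    ([Delta_hpl_p], [Delta_hpl_h], [Delta_hpl_i], [Delta_hpl_d]).

    To make these computations possible, maps of completed bar coalgebras are
    treated as maps of formal sums which are R-linear, continuous and commute
    with Novikov monomials on the right ([novlin]); they are determined by
    their values on constants.  Left linearity over the Novikov ring amounts
    to a sign which is a function of the degree, and is implied by preserving
    degrees ([gmap_degree]).  The Koszul rule for composing tensor products of
    such maps is proved once ([gtens_comp]). *)

(** * The monoid of energies *)

Section Monoid.
Variables (K : realType) (G : discrete_submonoid K).
Implicit Types b c : gelt G.

Definition gadd b c : gelt G :=
  SigSub (mem_set (dsD (set_valP b) (set_valP c))).
Definition gsub b c : option (gelt G) := insub (val b - val c).

Lemma val_gadd b c : val (gadd b c) = val b + val c. Proof. by []. Qed.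
Lemma val_gzero : val (gzero G) = 0. Proof. by []. Qed.

Lemma gsubP b c a : gsub b c = Some a <-> b = gadd c a.
Proof.
split=> [|->].
  rewrite /gsub; case: insubP => // u _ e [<-]; apply: val_inj.
  by rewrite val_gadd e addrC subrK.
rewrite /gsub val_gadd [val c + _]addrC addrK; case: insubP => [u _ /val_inj -> //|].
by rewrite (valP a).
Qed.

Lemma gsubK b a : gsub (gadd b a) b = Some a.
Proof. exact/gsubP. Qed.

Lemma gaddA a b c : gadd a (gadd b c) = gadd (gadd a b) c.
Proof. by apply: val_inj; rewrite !val_gadd addrA. Qed.
Lemma gaddC b c : gadd b c = gadd c b.
Proof. by apply: val_inj; rewrite !val_gadd addrC. Qed.
Lemma gadd0 b : gadd (gzero G) b = b.
Proof. by apply: val_inj; rewrite val_gadd val_gzero add0r. Qed.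
Lemma gaddI b : injective (gadd b).
Proof. by move=> c c' e; have := gsubK b c; rewrite e gsubK => -[]. Qed.

Lemma energyD b c : energy (gadd b c) = energy b + energy c.
Proof. by []. Qed.
Lemma energy0 : energy (gzero G) = 0. Proof. by []. Qed.
Lemma gdegD b c : gdeg (gadd b c) = gdeg b + gdeg c.
Proof. by rewrite /gdeg /mu val_gadd /= intrD. Qed.
Lemma gdeg0 : gdeg (gzero G) = 0. Proof. by []. Qed.
Lemma muD b c : mu (gadd b c) = mu b + mu c. Proof. by []. Qed.

Definition upto_energy (e : K) : {fset gelt G} := fset_set [set b | energy b <= e].

Lemma mem_upto_energy e b : (b \in upto_energy e) = (energy b <= e).
Proof.
by rewrite in_fset_set ?mem_setE //; exact: finite_energy.
Qed.

(** The multiples of an element of energy 0 all lie in one fibre of the energy,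
    which is finite; so the integer component has finite order. *)
Lemma energy_eq0 b : energy b = 0 -> b = gzero G.
Proof.
move=> b0; apply: val_inj; rewrite val_gzero.
pose f n := iter n (gadd b) (gzero G).
have vf n : val (f n) = (0, (mu b) *+ n).
  elim: n => [|n IH] //; rewrite /f iterS val_gadd [val (iter _ _ _)]IH.
  rewrite mulrS [val b]surjective_pairing [(val b).1]b0.
  by congr pair; rewrite /= addr0.
case: (eqVneq (mu b) 0) => [m0|m0].
  by rewrite [val b]surjective_pairing [(val b).1]b0 [(val b).2]m0.
have finj : injective f.
  by move=> n n' e; have := vf n; rewrite e vf => -[/(mulrIn m0)].
have : finite_set [set: nat].
  apply: (@sub_finite_set _ _ (f @^-1` [set b : gelt G | energy b <= 0])).
    by move=> n _ /=; rewrite /energy vf.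
  apply: finite_preimage; last exact: finite_energy.
  by move=> x y _ _; apply: finj.
by move/infinite_nat.
Qed.

(** Since only finitely many indices have energy at most 1, membership in
    F^{>0} reduces to the vanishing of the coefficient at [gzero G]: tameness
    and the perturbation condition are statements about energy 0. *)
Lemma energy_gap : exists2 e : K, 0 < e & forall b, energy b < e -> b = gzero G.
Proof.
pose s := [seq energy b | b <- upto_energy 1 & b != gzero G].
have [e [e0 es e1]] : exists e : K, [/\ 0 < e, forall x, x \in s -> e <= x & e <= 1].
  have : forall x, x \in s -> 0 < x.
    move=> x /mapP[b]; rewrite mem_filter => /andP[bn _] ->.
    rewrite lt_neqAle energy_ge0 andbT eq_sym; apply: contraNneq bn.
    by move/energy_eq0/eqP.
  elim: s => [|x s IH] H; first by exists 1.
  have [|e [e0 es e1]] := IH; first by move=> y ys; apply: H; rewrite inE ys orbT.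
  exists (Num.min x e); split.
  - by rewrite lt_min e0 H ?inE ?eqxx.
  - move=> y; rewrite inE => /orP[/eqP->|/es]; first by rewrite ge_min lexx.
    by move=> ey; rewrite ge_min ey orbT.
  - by rewrite ge_min e1 orbT.
exists e => // b be; apply: contraTeq be => bn; rewrite -leNgt.
case: (leP (energy b) 1) => b1; last by apply: (le_trans e1); apply: ltW.
by apply: es; apply/mapP; exists b; rewrite // mem_filter bn mem_upto_energy.
Qed.

Lemma big_pred1_fset (T : choiceType) (W : nmodType) (F : T -> W) (S : seq T) t :
  uniq S -> t \in S -> \sum_(s <- S | s == t) F s = F t.
Proof.
move=> uS tS; rewrite big_mkcond (bigD1_seq t) //= eqxx big1 ?addr0 // => s.
by move=> /negPf ->.
Qed.

(** Sums over decompositions are awkward to reindex.  They are rewritten here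
    as ordinary finite sums over the first summand c, the second one being
    b - c when this lies in the monoid; the index set S may be enlarged at
    will, which lets one S serve for several b. *)
Lemma decomp_sum (W : zmodType) (F : gelt G * gelt G -> W) (S : {fset gelt G}) b :
  {subset upto_energy (energy b) <= S} ->
  \sum_(p \in decomp b) F p =
  \sum_(c <- S) oapp (fun a => F (c, a)) 0 (gsub b c).
Proof.
move=> bS; have fD := finite_decomp b; rewrite fsbig_finite //=.
rewrite (eq_big_seq (fun p => \sum_(c <- S | c == p.1) F p)); last first.
  move=> p; rewrite in_fset_set // => /set_mem /= e.
  rewrite big_pred1_fset //.
  apply: bS; rewrite mem_upto_energy.
  rewrite [energy b](_ : _ = energy p.1 + energy p.2) ?lerDl ?energy_ge0 //.
  by rewrite /energy -e.
rewrite (exchange_big_dep xpredT) //=; apply: eq_bigr => c _.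
case E : (gsub b c) => [a|] /=.
  move/gsubP: E => E.
  have caD : (c, a) \in fset_set (decomp b).
    by rewrite in_fset_set //; apply/mem_set; rewrite /decomp /= E val_gadd.
  rewrite -[RHS](big_pred1_fset F (fset_uniq _) caD).
  rewrite big_seq_cond [RHS]big_seq_cond; apply: eq_bigl => p.
  case: (boolP (p \in _)) => //=; rewrite in_fset_set // => /set_mem /= e.
  have -> : (p == (c, a)) = (p.1 == c) && (p.2 == a) by case: (p).
  rewrite eq_sym; case: eqP => //= pc; symmetry; apply/eqP.
  apply: (@gaddI c); rewrite -E; apply: val_inj.
  by rewrite val_gadd -e pc.
rewrite big_seq_cond big_pred0 // => p; apply/negP => /andP[].
rewrite in_fset_set // => /set_mem /= e /eqP pc.
suff: gsub b c = Some p.2 by rewrite E.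
by apply/gsubP/val_inj; rewrite val_gadd pc -e.
Qed.

Lemma decomp_sum_swap (W : zmodType) (F : gelt G * gelt G -> W) b :
  \sum_(p \in decomp b) F p = \sum_(p \in decomp b) F (p.2, p.1).
Proof.
apply: (reindex_fsbig (fun p : gelt G * gelt G => (p.2, p.1))).
split.
- by move=> p /=; rewrite /decomp /= addrC.
- by move=> [p q] [p' q'] _ _ [-> ->].
- by move=> [p q] /= e; exists (q, p) => //=; rewrite /decomp /= addrC.
Qed.
End Monoid.

(** * Formal sums and Novikov linear maps *)

Section Families.
Variables (K : realType) (G : discrete_submonoid K) (R : comPzRingType).
Implicit Types (b c : gelt G) (U V W : lmodType R).

(** Right multiplication by the Novikov monomial T^E(c) epsilon^mu(c). *)
Definition nshift V c (x : gelt G -> V) : gelt G -> V :=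
  fun b => oapp x 0 (gsub b c).

Lemma nshift_gadd V c (x : gelt G -> V) a : nshift c x (gadd c a) = x a.
Proof. by rewrite /nshift gsubK. Qed.

Lemma nshift_ind V c b (P : V -> Prop) (x : gelt G -> V) :
  P 0 -> (forall a, b = gadd c a -> P (x a)) -> P (nshift c x b).
Proof. by move=> P0 Px; rewrite /nshift; case E: gsub => [a|] //=; apply/Px/gsubP. Qed.

Lemma nshift_nshift V c d (x : gelt G -> V) :
  nshift c (nshift d x) = nshift (gadd c d) x.
Proof.
apply/funext => b; rewrite /nshift.
case E: (gsub b c) => [a|] /=; last first.
  case F: (gsub b _) => [a|] //=; move/gsubP: F => F.
  have : gsub b c = Some (gadd d a) by apply/gsubP; rewrite F gaddA.
  by rewrite E.
move/gsubP: E => ->; case E: (gsub a d) => [a'|] /=; last first.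
  case F: (gsub _ _) => [a'|] //=; move/gsubP: F; rewrite -gaddA => /gaddI F.
  have : gsub a d = Some a' by apply/gsubP.
  by rewrite E.
by move/gsubP: E => ->; rewrite gaddA gsubK.
Qed.

Lemma nshift0 V (x : gelt G -> V) : nshift (gzero G) x = x.
Proof.
by apply/funext => b; rewrite -{1}[b]gadd0 nshift_gadd.
Qed.

Lemma nshift_gconst V c (v : V) b : nshift c (gconst v) b = if b == c then v else 0.
Proof.
rewrite /nshift; case: eqP => [->|bc].
  by rewrite -{1}[c]gadd0 gaddC gsubK /= /gconst eqxx.
case E: gsub => [a|] //=; move/gsubP: E => E; rewrite /gconst.
by case: eqP => // a0; case: bc; rewrite E a0 gaddC gadd0.
Qed.

Lemma nshiftP V c a (x y : gelt G -> V) :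
  nshift c (a *: x + y) = a *: nshift c x + nshift c y.
Proof.
apply/funext => b; rewrite /nshift.
transitivity (a *: oapp x 0 (gsub b c) + oapp y 0 (gsub b c)) => //.
by case: gsub => //=; rewrite scaler0 addr0.
Qed.

Lemma nshiftD V c (x y : gelt G -> V) : nshift c (x + y) = nshift c x + nshift c y.
Proof. by rewrite -{1}[x]scale1r nshiftP scale1r. Qed.

Lemma nshift_0 V c : nshift c (0 : gelt G -> V) = 0.
Proof. by apply: (addrI (nshift c 0)); rewrite -nshiftD !addr0. Qed.

Lemma nshiftZ V c a (x : gelt G -> V) : nshift c (a *: x) = a *: nshift c x.
Proof. by rewrite -[a *: x]addr0 nshiftP nshift_0 addr0. Qed.

Lemma nshift_filt V c e (x : gelt G -> V) : filt e x -> filt e (nshift c x).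
Proof.
move=> ex b be; apply: (@nshift_ind _ _ _ (fun v => v = 0)) => // a eb.
apply: ex; apply: le_lt_trans be.
by rewrite eb energyD lerDr energy_ge0.
Qed.

Lemma famP V a (x y : gelt G -> V) b : (a *: x + y) b = a *: x b + y b.
Proof. by []. Qed.
Lemma famD V (x y : gelt G -> V) b : (x + y) b = x b + y b.
Proof. by []. Qed.
Lemma famB V (x y : gelt G -> V) b : (x - y) b = x b - y b.
Proof. by []. Qed.
Lemma fam_sum V (I : Type) (r : seq I) (F : I -> gelt G -> V) b :
  (\sum_(i <- r) F i) b = \sum_(i <- r) F i b.
Proof. by elim: r => [|i r IH]; rewrite ?big_nil ?big_cons // famD IH. Qed.

Definition trunc V e (x : gelt G -> V) : gelt G -> V :=
  \sum_(c <- upto_energy G e) nshift c (gconst (x c)).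

Lemma truncE V e (x : gelt G -> V) b : energy b <= e -> trunc e x b = x b.
Proof.
move=> be; rewrite /trunc fam_sum.
under eq_bigr do rewrite nshift_gconst eq_sym.
by rewrite -big_mkcond big_pred1_fset ?fset_uniq // mem_upto_energy.
Qed.

Lemma filt_trunc V e (x : gelt G -> V) : filt e (x - trunc e x).
Proof. by move=> b /ltW be; rewrite famB truncE // subrr. Qed.

Lemma filt_eq0 V (x : gelt G -> V) : (forall e, filt e x) -> x = 0.
Proof.
by move=> ex; apply/funext => b; apply: (ex (energy b + 1)); rewrite ltrDl.
Qed.

Lemma filtD V e (x y : gelt G -> V) : filt e x -> filt e y -> filt e (x + y).
Proof. by move=> ex ey b be; rewrite famD ex ?ey ?addr0. Qed.
Lemma filtB V e (x y : gelt G -> V) : filt e x -> filt e y -> filt e (x - y).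
Proof. by move=> ex ey b be; rewrite famB ex ?ey ?subr0. Qed.

(** Additive maps which are continuous for the energy filtration.  The left
    action and the tensor product of formal sums are of this kind in each
    argument, but do not commute with [nshift] on the nose. *)
Record fadd V W (F : (gelt G -> V) -> (gelt G -> W)) : Prop := FAdd {
  fa_add : forall x y, F (x + y) = F x + F y;
  fa_filt : forall e x, filt e x -> filt e (F x) }.

Lemma fa0 V W (F : (gelt G -> V) -> (gelt G -> W)) : fadd F -> F 0 = 0.
Proof. by move=> fF; apply: (addrI (F 0)); rewrite -(fa_add fF) !addr0. Qed.
Lemma faN V W (F : (gelt G -> V) -> (gelt G -> W)) x : fadd F -> F (- x) = - F x.
Proof. by move=> fF; apply: (addrI (F x)); rewrite -(fa_add fF) !subrr fa0. Qed.
Lemma faB V W (F : (gelt G -> V) -> (gelt G -> W)) x y :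
  fadd F -> F (x - y) = F x - F y.
Proof. by move=> fF; rewrite (fa_add fF) faN. Qed.
Lemma fa_sum V W (F : (gelt G -> V) -> (gelt G -> W)) I (r : seq I) (x : I -> _) :
  fadd F -> F (\sum_(i <- r) x i) = \sum_(i <- r) F (x i).
Proof. by move=> fF; apply: big_morph; [apply: (fa_add fF)|apply: fa0]. Qed.

Lemma fadd_trunc V W (F : (gelt G -> V) -> (gelt G -> W)) e x b : fadd F ->
  energy b < e -> F x b = \sum_(c <- upto_energy G e) F (nshift c (gconst (x c))) b.
Proof.
move=> fF be; rewrite -[x in LHS](subrK (trunc e x)) (fa_add fF) famD.
rewrite (fa_filt fF (@filt_trunc _ e x)) // add0r fa_sum //.
by rewrite fam_sum.
Qed.

(** Below any given energy a formal sum is a finite sum of monomials. *)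
Lemma fadd_ext V W (F F' : (gelt G -> V) -> (gelt G -> W)) :
  fadd F -> fadd F' ->
  (forall c v, F (nshift c (gconst v)) = F' (nshift c (gconst v))) ->
  forall x, F x = F' x.
Proof.
move=> fF fF' FF' x; apply/funext => b.
have be : energy b < energy b + 1 by rewrite ltrDl.
rewrite (fadd_trunc x fF be) (fadd_trunc x fF' be).
by apply: eq_bigr => c _; rewrite FF'.
Qed.

(** The R-linear continuous maps which are right linear over the Novikov ring.
    Stated with the monomials alone, the condition is visibly closed under
    composition and sums, and such a map is determined by its values on
    constants; linearity over arbitrary Novikov elements follows ([nl_ract],
    [gmap_lact]). *)
Record novlin V W (F : (gelt G -> V) -> (gelt G -> W)) : Prop := NovLin {
  nl_lin : forall a x y, F (a *: x + y) = a *: F x + F y;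
  nl_filt : forall e x, filt e x -> filt e (F x);
  nl_shift : forall c x, F (nshift c x) = nshift c (F x) }.

Lemma nl_fadd V W (F : (gelt G -> V) -> (gelt G -> W)) : novlin F -> fadd F.
Proof.
move=> [lF eF _]; split=> // x y.
by rewrite -[x]scale1r lF !scale1r.
Qed.

Lemma nlZ V W (F : (gelt G -> V) -> (gelt G -> W)) a x :
  novlin F -> F (a *: x) = a *: F x.
Proof.
by move=> nF; rewrite -[a *: x]addr0 (nl_lin nF) fa0 ?addr0 //; apply: nl_fadd.
Qed.

Lemma nl_ext V W (F F' : (gelt G -> V) -> (gelt G -> W)) :
  novlin F -> novlin F' ->
  (forall v, F (gconst v) = F' (gconst v)) -> forall x, F x = F' x.
Proof.
move=> nF nF' FF'; apply: fadd_ext; [exact: nl_fadd|exact: nl_fadd|].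
by move=> c v; rewrite (nl_shift nF) (nl_shift nF') FF'.
Qed.

Lemma nl_id V : novlin (fun x : gelt G -> V => x).
Proof. by split. Qed.
Lemma nl_comp U V W (F : (gelt G -> V) -> (gelt G -> W)) (F' : (gelt G -> U) -> _) :
  novlin F -> novlin F' -> novlin (fun x => F (F' x)).
Proof.
move=> nF nF'; split=> [a x y|e x ex|c x].
- by rewrite (nl_lin nF') (nl_lin nF).
- by apply/(nl_filt nF)/(nl_filt nF').
- by rewrite (nl_shift nF') (nl_shift nF).
Qed.
Lemma nl_add V W (F F' : (gelt G -> V) -> (gelt G -> W)) :
  novlin F -> novlin F' -> novlin (fun x => F x + F' x).
Proof.
move=> nF nF'; split=> [a x y|e x ex|c x].
- by rewrite (nl_lin nF) (nl_lin nF') scalerDr addrACA.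
- by apply: filtD; [apply: (nl_filt nF)|apply: (nl_filt nF')].
- by rewrite (nl_shift nF) (nl_shift nF') nshiftD.
Qed.
Lemma nl_scale V W (F : (gelt G -> V) -> (gelt G -> W)) a :
  novlin F -> novlin (fun x => a *: F x).
Proof.
move=> nF; split=> [a' x y|e x ex b be|c x].
- by rewrite (nl_lin nF) scalerDr !scalerA mulrC.
- by transitivity (a *: F x b) => //; rewrite (nl_filt nF ex) ?scaler0.
- by rewrite (nl_shift nF) nshiftZ.
Qed.
Lemma nl_pointwise V W (phi : V -> W) :
  (forall a u v, phi (a *: u + v) = a *: phi u + phi v) ->
  novlin (fun (x : gelt G -> V) b => phi (x b)).
Proof.
move=> lphi; have phi0 : phi 0 = 0.
  by have := lphi (-1) 0 0; rewrite scaleN1r addNr scaleN1r addNr.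
split=> [a x y|e x ex b be|c x].
- by apply/funext => b; rewrite famP lphi.
- by rewrite ex.
- by apply/funext => b; rewrite /nshift; case: gsub.
Qed.

Lemma gconstE V (v : V) b : gconst v b = if b == gzero G then v else 0.
Proof. by []. Qed.

Lemma nl_gconst V a (u v : V) :
  gconst (a *: u + v) = a *: gconst u + gconst v :> (gelt G -> V).
Proof.
apply/funext => b; rewrite famP !gconstE; case: eqP => // _.
by rewrite scaler0 addr0.
Qed.

(** The Novikov linear map with prescribed values on constants. *)
Definition conv V W (phi : V -> gelt G -> W) (z : gelt G -> V) : gelt G -> W :=
  fun b => \sum_(p \in decomp b) phi (z p.1) p.2.

Section Ext.
Variables (V W : lmodType R) (phi : V -> gelt G -> W).
Hypothesis phiP : forall a u v, phi (a *: u + v) = a *: phi u + phi v.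

Lemma conv_sum (S : {fset gelt G}) z b : {subset upto_energy G (energy b) <= S} ->
  conv phi z b = \sum_(c <- S) nshift c (phi (z c)) b.
Proof.
move=> bS; rewrite /conv (decomp_sum (fun p => phi (z p.1) p.2) bS).
by apply: eq_bigr => c _; rewrite /nshift; case: gsub.
Qed.

Let phi0 : phi 0 = 0.
Proof. by have := phiP (-1) 0 0; rewrite scaleN1r addNr scaleN1r addNr. Qed.

Lemma conv_fadd : fadd (conv phi).
Proof.
split=> [x y|e x ex b be].
  apply/funext => b; rewrite famD !(@conv_sum (upto_energy G (energy b))) // -big_split /=.
  apply: eq_bigr => c _.
  by rewrite famD -[x c]scale1r phiP !scale1r nshiftD.
rewrite (@conv_sum (upto_energy G (energy b))) // big1 // => c _.
apply: (@nshift_ind _ _ _ (fun v => v = 0)) => // a eb.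
rewrite ex ?phi0 //; apply: le_lt_trans be.
by rewrite eb energyD lerDl energy_ge0.
Qed.

Lemma conv_mono c v : conv phi (nshift c (gconst v)) = nshift c (phi v).
Proof.
apply/funext => b.
rewrite (@conv_sum (c |` upto_energy G (energy b))%fset); last first.
  by move=> d db; rewrite inE db orbT.
rewrite (bigD1_seq c) ?fset_uniq ?inE ?eqxx //= big1 ?addr0.
  by rewrite nshift_gconst eqxx.
move=> d /negPf dc; rewrite nshift_gconst dc phi0.
by apply: (@nshift_ind _ _ _ (fun v => v = 0)).
Qed.

Lemma nl_conv : novlin (conv phi).
Proof.
have fe := conv_fadd; split=> [a x y|e x|c x]; last 2 first.
- exact: (fa_filt fe).
- apply: (@fadd_ext _ _ (fun x => conv phi (nshift c x)) (fun x => nshift c (conv phi x))).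
  + split=> [u v|e u eu]; first by rewrite nshiftD (fa_add fe).
    exact/(fa_filt fe)/nshift_filt.
  + split=> [u v|e u eu]; first by rewrite (fa_add fe) nshiftD.
    exact/nshift_filt/(fa_filt fe).
  by move=> d v; rewrite nshift_nshift !conv_mono nshift_nshift.
rewrite (fa_add fe); congr (_ + _); move: x.
apply: (@fadd_ext _ _ (fun x => conv phi (a *: x)) (fun x => a *: conv phi x)).
- split=> [u v|e u eu]; first by rewrite scalerDr (fa_add fe).
  apply: (fa_filt fe) => b be; transitivity (a *: u b) => //.
  by rewrite eu ?scaler0.
- split=> [u v|e u eu b be]; first by rewrite (fa_add fe) scalerDr.
  by transitivity (a *: conv phi u b) => //; rewrite (fa_filt fe eu) ?scaler0.
move=> d v; rewrite conv_mono -nshiftZ -(_ : gconst (a *: v) = a *: gconst v).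
  by rewrite conv_mono -nshiftZ -[a *: v]addr0 phiP phi0 addr0.
apply/funext => b; rewrite -[RHS]/(a *: gconst v b) !gconstE.
by case: eqP; rewrite ?scaler0.
Qed.

Lemma conv_gconst v : conv phi (gconst v) = phi v.
Proof. by rewrite -[gconst v]nshift0 conv_mono nshift0. Qed.

End Ext.

Lemma nl_phi V W (F : (gelt G -> V) -> (gelt G -> W)) : novlin F ->
  forall a u v, F (gconst (a *: u + v)) = a *: F (gconst u) + F (gconst v).
Proof. by move=> nF a u v; rewrite nl_gconst (nl_lin nF). Qed.

Lemma nl_convE V W (F : (gelt G -> V) -> (gelt G -> W)) z : novlin F ->
  F z = conv (fun v => F (gconst v)) z.
Proof.
move=> nF; move: z; apply: nl_ext => //.
  exact/nl_conv/nl_phi.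
by move=> v; rewrite conv_gconst //; apply: nl_phi.
Qed.

Lemma nl_sum V W (F : (gelt G -> V) -> (gelt G -> W)) (S : {fset gelt G}) z b :
  novlin F -> {subset upto_energy G (energy b) <= S} ->
  F z b = \sum_(c <- S) nshift c (F (gconst (z c))) b.
Proof. by move=> nF bS; rewrite nl_convE // (conv_sum _ _ bS). Qed.

(** Reduction modulo F^{>0} is functorial, because the monoid has no negative
    energies and no element of energy 0 but the unit. *)
Lemma nl_gzero V W (F : (gelt G -> V) -> (gelt G -> W)) x : novlin F ->
  F x (gzero G) = F (gconst (x (gzero G))) (gzero G).
Proof.
move=> nF; have [e e0 gap] := energy_gap G.
apply/eqP; rewrite -subr_eq0 -famB -faB; last exact: nl_fadd.
rewrite (@nl_filt _ _ _ nF e) ?energy0 // => b /gap ->.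
by rewrite famB gconstE eqxx subrr.
Qed.

End Families.

(** * Parities and Koszul signs *)

Section Parity.
Definition oddz (n : int) : bool := odd `|n|%N.

Lemma oddzD m n : oddz (m + n) = oddz m (+) oddz n.
Proof. rewrite /oddz; lia. Qed.
Lemma oddzN n : oddz (- n) = oddz n. Proof. by rewrite /oddz abszN. Qed.
Lemma oddzB m n : oddz (m - n) = oddz m (+) oddz n. Proof. by rewrite oddzD oddzN. Qed.
Lemma oddzM m n : oddz (m * n) = oddz m && oddz n. Proof. by rewrite /oddz abszM oddM. Qed.
Lemma oddz_even n : (2 %| n)%Z -> oddz n = false.
Proof. rewrite /oddz; lia. Qed.

(** The local system degree enters signs through its parity only. *)
Lemma oddz_lszD (p q : degree) : oddz (lsz (p + q)) = oddz (lsz p) (+) oddz (lsz q).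
Proof.
case: p q => [p1 p2] [q1 q2]; rewrite /lsz /=.
by case: p2 => [[|[|[]]] //= ?]; case: q2 => [[|[|[]]] //= ?].
Qed.

Lemma oddz_lsz_mu (n : int) : oddz (lsz (0, n%:~R)) = oddz n.
Proof.
have pos (k : nat) : oddz (lsz (0, (Posz k)%:~R)) = oddz k.
  by rewrite /lsz /= -pmulrn val_Zp_nat // /oddz /= modn2 oddb.
case: n => k; first exact: pos.
rewrite NegzE oddzN -pos.
have /(congr1 (fun p : degree => oddz (lsz p))) : ((0, (- Posz k.+1)%:~R) + (0, (Posz k.+1)%:~R) : degree) = 0.
  by rewrite mulrNz; congr pair; rewrite /= ?addNr ?addr0.
rewrite oddz_lszD; set a := oddz _; set b := oddz _; rewrite -/(oddz 0).
by case: a; case: b.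
Qed.

End Parity.

Section Linear.
Variable R : comPzRingType.
Implicit Types M N U V W : lmodType R.

Definition is_lin V W (f : V -> W) :=
  forall a u v, f (a *: u + v) = a *: f u + f v.

Lemma linD V W (f : V -> W) : is_lin f -> {morph f : u v / u + v}.
Proof. by move=> lf u v; rewrite -[u]scale1r lf !scale1r. Qed.
Lemma lin0 V W (f : V -> W) : is_lin f -> f 0 = 0.
Proof. by move=> lf; apply: (addrI (f 0)); rewrite -(linD lf) !addr0. Qed.
Lemma linZ V W (f : V -> W) a u : is_lin f -> f (a *: u) = a *: f u.
Proof. by move=> lf; rewrite -[_ *: _]addr0 lf lin0 // addr0. Qed.
Lemma lin_sum V W (f : V -> W) I (r : seq I) (x : I -> V) :
  is_lin f -> f (\sum_(i <- r) x i) = \sum_(i <- r) f (x i).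
Proof. by move=> lf; apply: big_morph; [apply: linD|apply: lin0]. Qed.
Lemma lin_comp U V W (f : V -> W) (g : U -> V) :
  is_lin f -> is_lin g -> is_lin (fun u => f (g u)).
Proof. by move=> lf lg a u v; rewrite lg lf. Qed.
Lemma lin_add V W (f g : V -> W) :
  is_lin f -> is_lin g -> is_lin (fun u => f u + g u).
Proof. by move=> lf lg a u v; rewrite lf lg scalerDr addrACA. Qed.
Lemma lin_scale V W (f : V -> W) c : is_lin f -> is_lin (fun u => c *: f u).
Proof. by move=> lf a u v; rewrite lf scalerDr !scalerA mulrC. Qed.
Lemma lin_id V : is_lin (fun u : V => u).
Proof. by []. Qed.
Lemma lin_linear V W (f : {linear V -> W}) : is_lin f.
Proof. by move=> a u v; rewrite linearP. Qed.

Lemma presented_ext (T : choiceType) (S : set (T -> R^o)) W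
  (f g : presented S -> W) : is_lin f -> is_lin g ->
  (forall t, f (gen S t) = g (gen S t)) -> f =1 g.
Proof.
move=> lf lg fg; elim/presented_ind => [|a t x IH]; first by rewrite !lin0.
by rewrite lf lg fg IH.
Qed.

Lemma lin_lift (T : choiceType) (S : set (T -> R^o)) W (phi : T -> W) :
  respects S phi -> is_lin (gen_lift (S := S) phi).
Proof. by move=> rphi a u v; rewrite liftD // liftZ. Qed.

Lemma word_ext M W (f g : talg M -> W) : is_lin f -> is_lin g ->
  (forall w, f (word w) = g (word w)) -> f =1 g.
Proof. exact: presented_ext. Qed.

Lemma tens_ext M N W (f g : tensor M N -> W) : is_lin f -> is_lin g ->
  (forall x y, f (tens x y) = g (tens x y)) -> f =1 g.
Proof. by move=> lf lg fg; apply: presented_ext => // -[x y]; apply: fg. Qed.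

Lemma lin_tensl M N (y : N) : is_lin (fun x : M => tens x y).
Proof. by move=> a u v; rewrite tensPl. Qed.
Lemma lin_tensr M N (x : M) : is_lin (fun y : N => tens x y).
Proof. by move=> a u v; rewrite tensPr. Qed.

Lemma lin_tsplit M : is_lin (@tsplit R M).
Proof. exact/lin_lift/tsplit_respects. Qed.
Lemma lin_tpart0 M : is_lin (@tpart0 R M).
Proof. exact/lin_lift/tpart0_respects. Qed.
Lemma lin_tpart1 M : is_lin (@tpart1 R M).
Proof. exact/lin_lift/tpart1_respects. Qed.
Lemma tpart0_word M (w : seq M) : tpart0 (word w) = if w is [::] then 1 : R^o else 0.
Proof. exact/lift_gen/tpart0_respects. Qed.
Lemma tpart1_word M (w : seq M) : tpart1 (word w) = if w is [:: x] then x else 0.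
Proof. exact/lift_gen/tpart1_respects. Qed.

Definition tlift M N W (phi : M -> N -> W) : tensor M N -> W :=
  gen_lift (fun p : M * N => phi p.1 p.2).

Section TLift.
Variables (M N W : lmodType R) (phi : M -> N -> W).
Hypothesis phil : forall y, is_lin (phi^~ y).
Hypothesis phir : forall x, is_lin (phi x).
Let r : respects (@bilin_rel R M N) (fun p : M * N => phi p.1 p.2).
Proof. by apply: bilin_respects => a x y z /=; [apply: phil|apply: phir]. Qed.
Lemma tlift_tens x y : tlift phi (tens x y) = phi x y.
Proof. exact: (lift_gen r). Qed.
Lemma lin_tlift : is_lin (tlift phi).
Proof. exact: lin_lift. Qed.
End TLift.

End Linear.

Section Signs.
Variables (K : realType) (R : gr_alg K).
Implicit Types (C : gr_mod R) (p q : degree).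

Lemma gr_ind (V : zmodType) (g : grading V) (P : V -> Prop) :
  P 0 -> (forall x y, P x -> P y -> P (x + y)) ->
  (forall p x, gr_homog g p x -> P x) -> forall x, P x.
Proof.
move=> P0 PD Ph x; have [A [_ ->]] := gr_sum_fset g x.
by elim/big_ind: _ => // p _; apply/Ph/gr_homog_proj.
Qed.

(** Every sign in the theory multiplies a word x_1 ... x_k by
    (-1)^(chi q_1 + ... + chi q_k), q_j the degree of x_j.  When chi comes from
    an additive parity psi of the shifted degree q - (1, 0), this sign depends
    only on the degree of the word in the bar construction; vanishing of psi
    on (2Z + 0) makes the sign operator R-linear. *)
Record sign_char (chi : degree -> int) (psi : degree -> bool) : Prop := SignChar {
  sc_add : forall p q, psi (p + q) = psi p (+) psi q;
  sc_even : forall p, (2 %| p.1)%Z -> p.2 = 0 -> psi p = false;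
  sc_letter : forall q, oddz (chi q) = psi (q - (1, 0)) }.

(** Sign for moving a map of codimension degree e past a letter of C[1]. *)
Definition koszul (e : int) (q : degree) : int := e * (q.1 - 1).
Definition koszul_parity (e : int) (p : degree) : bool := oddz (e * p.1).
Definition eps_parity (n : int) (p : degree) : bool := oddz n && (oddz p.1 (+) oddz (lsz p)).

Lemma koszul_char e : sign_char (koszul e) (koszul_parity e).
Proof.
split=> [p q|p p2 _|q]; rewrite /koszul_parity /koszul ?oddzM /=.
- by rewrite oddzD; case: (oddz e).
- by rewrite (oddz_even p2) andbF.
- by [].
Qed.

Lemma eps_char n : sign_char (@eps_chi n) (eps_parity n).
Proof.
split=> [p q|p p2 p0|q]; rewrite /eps_parity /eps_chi.
- rewrite oddz_lszD -[(p + q).1]/(p.1 + q.1) oddzD.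
  by case: (oddz n); case: (oddz p.1); case: (oddz q.1); case: (oddz (lsz p)); case: (oddz (lsz q)).
- by rewrite (oddz_even p2) /lsz p0 andbF.
- rewrite oddzM !oddzD oddz_lszD.
  have -> : oddz (lsz (- (1, 0))) = false by [].
  by rewrite addbF; case: (oddz n); case: (oddz q.1); case: (oddz (lsz q)).
Qed.

Lemma signE (n : nat) : (-1) ^+ n = (-1) ^+ odd n :> R.
Proof. by rewrite signr_odd. Qed.

Lemma sc_word chi psi (qs : seq degree) : sign_char chi psi ->
  psi (\sum_(q <- qs) (q - (1, 0))) = \big[addb/false]_(q <- qs) oddz (chi q).
Proof.
move=> sc; have psi0 : psi 0 = false by apply: (sc_even sc).
elim: qs => [|q qs IH]; first by rewrite !big_nil.
by rewrite !big_cons (sc_add sc) IH (sc_letter sc).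
Qed.

Section GSign.
Variables (C : gr_mod R) (chi : degree -> int).

Lemma gsign_homog p (x : C) : homog p x -> gsign chi x = (-1) ^+ oddz (chi p) *: x.
Proof.
move=> hx; rewrite /gsign (fsbigTE [fset p]%fset); last first.
  by move=> q; rewrite inE (gr_proj_homog q hx) => /negPf ->; rewrite scaler0.
by rewrite big_seq_fset1 (gr_proj_homog p hx) eqxx signE.
Qed.

Lemma gsignD (x y : C) : gsign chi (x + y) = gsign chi x + gsign chi y.
Proof.
have [A [A0 _]] := gr_sum_fset (gm_gr C) x.
have [B [B0 _]] := gr_sum_fset (gm_gr C) y.
rewrite /gsign !(fsbigTE (A `|` B)%fset) => [|p|p|p].
- by rewrite -big_split; apply: eq_bigr => p _; rewrite gr_projD scalerDr.
- by rewrite inE negb_or => /andP[_ /B0 ->]; rewrite scaler0.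
- by rewrite inE negb_or => /andP[/A0 -> _]; rewrite scaler0.
- by rewrite inE negb_or gr_projD => /andP[/A0 -> /B0 ->]; rewrite addr0 scaler0.
Qed.

Lemma gsign0 : gsign chi (0 : C) = 0.
Proof. by apply: (addrI (gsign chi 0)); rewrite -gsignD !addr0. Qed.

(** Scaling by a homogeneous element of R shifts degrees by (2Z + 0) only. *)
Lemma gsign_lin : (forall p q, (2 %| p.1)%Z -> p.2 = 0 -> oddz (chi (p + q)) = oddz (chi q)) ->
  is_lin (@gsign K R C chi).
Proof.
move=> ev a x y; rewrite gsignD; congr (_ + _).
elim/(gr_ind (g := ga_gr R)) : a => [|a a' IH IH'|p a pa].
- by rewrite !scale0r gsign0.
- by rewrite !scalerDl gsignD IH IH'.
elim/(gr_ind (g := gm_gr C)) : x => [|x x' IH IH'|q x qx].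
- by rewrite gsign0 scaler0 gsign0.
- by rewrite scalerDr !gsignD IH IH' scalerDr.
have [->|a0] := eqVneq a 0; first by rewrite !scale0r gsign0.
have [p2 p0] := ga_even pa a0.
rewrite (gsign_homog (gm_scale pa qx)) ev // (gsign_homog qx).
by rewrite !scalerA mulrC.
Qed.

Lemma gsign_lin_char psi : sign_char chi psi -> is_lin (@gsign K R C chi).
Proof.
move=> sc; apply: gsign_lin => p q p2 p0.
by rewrite !(sc_letter sc) -addrA (sc_add sc p) (sc_even sc p2 p0).
Qed.

End GSign.

(** Words with homogeneous letters span the tensor algebra: letters are made
    homogeneous one by one, from left to right. *)
Lemma talg_ind C (P : talg C -> Prop) : P 0 -> (forall a t, P t -> P (a *: t)) ->
  (forall t u, P t -> P u -> P (t + u)) ->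
  (forall qs w, List.Forall2 homog qs w -> P (word w)) -> forall t, P t.
Proof.
move=> P0 PZ PD Pw; elim/presented_ind => [|a w t Pt] //; apply: (PD) => //.
apply: (PZ); rewrite -/(word w).
suff H v u qs : List.Forall2 homog qs u -> P (word (u ++ v)).
  exact: (H w [::] [::] (List.Forall2_nil _)).
elim: v u qs => [|x v IH] u qs hu; first by rewrite cats0; apply: Pw hu.
elim/(gr_ind (g := gm_gr C)) : x => [|x x' IHx IHx'|q x qx].
- have := wordP (-1) (0 : C) 0 u v; rewrite scaler0 addr0 => ->.
  by rewrite scaleN1r addNr.
- by rewrite -[x]scale1r wordP scale1r; apply: PD.
rewrite -cat_rcons; apply: (IH _ (rcons qs q)).
by rewrite -!cats1; apply: List.Forall2_app => //; constructor.
Qed.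

Lemma talg_ext C (W : lmodType R) (f g : talg C -> W) : is_lin f -> is_lin g ->
  (forall qs w, List.Forall2 homog qs w -> f (word w) = g (word w)) -> f =1 g.
Proof.
move=> lf lg fg; elim/talg_ind => [|a t IH|t u IH IH'|//].
- by rewrite !lin0.
- by rewrite !linZ ?IH.
- by rewrite !linD // IH IH'.
Qed.

Lemma t_homog_word C (qs : seq degree) (w : seq C) : List.Forall2 homog qs w ->
  t_homog (\sum_(q <- qs) (q - (1, 0))) (word w).
Proof.
move=> hw; rewrite -[word w]scale1r -[\sum_(_ <- _) _]add0r.
by apply: TH_word hw; apply: ga_one.
Qed.

Lemma t_homog_ext C (W : lmodType R) (f g : talg C -> W) : is_lin f -> is_lin g ->
  (forall p t, t_homog p t -> f t = g t) -> f =1 g.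
Proof.
by move=> lf lg fg; apply: talg_ext => // qs w /t_homog_word; apply: fg.
Qed.

Section TSign.
Variables (C : gr_mod R) (chi : degree -> int) (psi : degree -> bool).
Hypothesis sc : sign_char chi psi.

Lemma t_sign_word (w : seq C) : t_sign chi (word w) = word (map (gsign chi) w).
Proof. exact/lift_gen/tmap_respects/gsign_lin_char/sc. Qed.

Lemma lin_tsign : is_lin (@t_sign K R C chi).
Proof. exact/lin_lift/tmap_respects/gsign_lin_char/sc. Qed.

Lemma t_sign_homog p (t : talg C) : t_homog p t -> t_sign chi t = (-1) ^+ psi p *: t.
Proof.
elim=> {p t} [p|p t u _ IH _ IH'|p a qs w pa hw].
- by rewrite scaler0; apply: lin0; apply: lin_tsign.
- by rewrite (linD lin_tsign) IH IH' scalerDr.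
rewrite (linZ _ _ lin_tsign) t_sign_word.
have [->|a0] := eqVneq a 0; first by rewrite !scale0r scaler0.
have [p2 p0] := ga_even pa a0.
rewrite (sc_add sc) (sc_even sc) // (sc_word _ sc) /= !scalerA mulrC -scalerA.
congr (_ *: _).
have -> : (-1) ^+ (\big[addb/false]_(q <- qs) oddz (chi q)) =
          \prod_(q <- qs) (-1) ^+ oddz (chi q) :> R.
  elim: (qs) => [|q s IH]; first by rewrite !big_nil.
  by rewrite !big_cons -IH signr_addb.
suff H u : word (u ++ map (gsign chi) w) =
    (\prod_(q <- qs) (-1) ^+ oddz (chi q)) *: word (u ++ w) by exact: (H [::]).
elim: hw u => {qs w pa} [|q x qs w qx _ IH] u; first by rewrite big_nil scale1r.
rewrite big_cons /= -cat_rcons IH cat_rcons (gsign_homog _ qx).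
rewrite -[_ *: x]addr0 wordP.
have := wordP (-1) (0 : C) 0 u w; rewrite scaler0 addr0 => ->.
by rewrite scaleN1r addNr addr0 scalerA mulrC.
Qed.

End TSign.
End Signs.

(** * Graded maps of bar coalgebras *)

Section BarMaps.
Variables (K : realType) (G : discrete_submonoid K) (R : gr_alg K).
Implicit Types (C D E : gr_mod R) (b c : gelt G).

Lemma koszul0 C (t : talg C) : t_sign (koszul 0) t = t.
Proof.
move: t; apply: t_homog_ext; first exact: lin_tsign (koszul_char 0).
  exact: lin_id.
move=> p t ht; rewrite (t_sign_homog (koszul_char 0) ht).
by rewrite /koszul_parity mul0r /= scale1r.
Qed.

Lemma eps0 C (t : talg C) : t_sign (eps_chi 0) t = t.
Proof.
move: t; apply: t_homog_ext; first exact: lin_tsign (eps_char 0).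
  exact: lin_id.
move=> p t ht; rewrite (t_sign_homog (eps_char 0) ht).
by rewrite /= scale1r.
Qed.

Lemma koszul_comp C e e' (t : talg C) :
  t_sign (koszul e) (t_sign (koszul e') t) = t_sign (koszul (e + e')) t.
Proof.
have lk e1 := @lin_tsign _ _ C _ _ (koszul_char e1).
move: t; apply: t_homog_ext; [exact: (lin_comp (lk _) (lk _))|exact: lk|].
move=> p t ht; rewrite (t_sign_homog (koszul_char e') ht) (linZ _ _ (lk e)).
rewrite !(t_sign_homog (koszul_char _) ht) scalerA -signr_addb addbC.
by rewrite /koszul_parity mulrDl oddzD.
Qed.

(** The sign produced by moving epsilon^n from the left of a formal sum to its
    right. *)
Definition eps_twist n C (x : bar G C) : bar G C := fun b => t_sign (eps_chi n) (x b).
(** The operator (-1)^(e cd x) on formal sums; the Novikov variable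
    epsilon^mu(b) contributes mu(b) to cd. *)
Definition koszul_twist e C (x : bar G C) : bar G C :=
  fun b => (-1) ^+ oddz (e * mu b) *: t_sign (koszul e) (x b).

Lemma nl_eps_twist n C : novlin (@eps_twist n C).
Proof. exact/nl_pointwise/lin_tsign/eps_char. Qed.

Lemma koszul_twist_mono e C c (t : talg C) : koszul_twist e (nshift c (gconst t)) =
  (-1) ^+ oddz (e * mu c) *: nshift c (gconst (t_sign (koszul e) t)).
Proof.
have lk := @lin_tsign _ _ C _ _ (koszul_char e).
apply/funext => b.
rewrite -[RHS]/(_ *: nshift c (gconst (t_sign (koszul e) t)) b) /koszul_twist !nshift_gconst.
by case: eqP => [->|] //; rewrite (lin0 lk) !scaler0.
Qed.

Lemma fadd_koszul_twist e C : fadd (@koszul_twist e C : (gelt G -> talg C) -> (gelt G -> talg C)).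
Proof.
have lk := @lin_tsign _ _ C _ _ (koszul_char e).
split=> [x y|e' x ex b be].
  by apply/funext => b; rewrite /koszul_twist famD (linD lk) scalerDr.
by rewrite /koszul_twist ex // (lin0 lk) scaler0.
Qed.

(** Equivalent to [degree_map] (see [gmap_degree] and [degree_gmap]): the left
    linearity required there is a consequence of preserving degrees. *)
Record graded_map C D (d : int) (F : bar G C -> bar G D) : Prop := GradedMap {
  gm_nl : novlin F;
  gm_deg : forall p x, bar_homog p x -> bar_homog (p + (d, 0)) (F x) }.

Lemma bar_homog_gconst C p (t : talg C) : t_homog p t -> bar_homog p (gconst t : bar G C).
Proof.
move=> ht b; rewrite gconstE; case: eqP => [->|_]; last exact: TH_zero.
by rewrite gdeg0 subr0.
Qed.

Lemma t_homogZ C p q a (t : talg C) : gr_homog (ga_gr R) p a -> t_homog q t ->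
  t_homog (p + q) (a *: t).
Proof.
move=> pa; elim=> {q t} [q|q t u _ IH _ IH'|q a' qs w qa hw].
- by rewrite scaler0; apply: TH_zero.
- by rewrite scalerDr; apply: TH_add.
- by rewrite scalerA addrA; apply: TH_word hw; apply: ga_mul.
Qed.

Lemma t_homog_sign C p (s : bool) (t : talg C) :
  t_homog p t -> t_homog p ((-1) ^+ s *: t).
Proof.
move=> ht; rewrite -[p]add0r; apply: t_homogZ ht.
case: s; last exact: ga_one.
rewrite /gr_homog /= expr1; apply: (addrI (gr_proj (ga_gr R) 0 1)).
by rewrite -gr_projD [in RHS]ga_one !subrr gr_proj0.
Qed.

Lemma t_homog_sum C p I (r : seq I) (F : I -> talg C) :
  (forall i, t_homog p (F i)) -> t_homog p (\sum_(i <- r) F i).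
Proof. by move=> hF; elim/big_ind: _ => //; [apply: TH_zero|apply: TH_add]. Qed.

Lemma gmap_gconst C D d (F : bar G C -> bar G D) : novlin F ->
  (forall p t, t_homog p t -> bar_homog (p + (d, 0)) (F (gconst t))) -> graded_map d F.
Proof.
move=> nF hF; split=> // p x hx b.
rewrite (nl_sum x nF (S := upto_energy G (energy b))) //.
apply: t_homog_sum => c; apply: nshift_ind; first exact: TH_zero.
move=> a ->; rewrite gdegD opprD addrA.
by rewrite [X in X - gdeg a]addrAC; apply: hF.
Qed.

Lemma gmap_comp C D E d d' (F : bar G D -> bar G E) (F' : bar G C -> bar G D) :
  graded_map d F -> graded_map d' F' -> graded_map (d + d') (fun x => F (F' x)).
Proof.
move=> gF gF'; split; first exact: nl_comp (gm_nl gF) (gm_nl gF').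
move=> p x hx.
have -> : p + (d + d', 0) = p + (d', 0) + (d, 0).
  by rewrite -addrA; congr (_ + _); congr pair; rewrite /= ?addr0 // addrC.
exact/(gm_deg gF)/(gm_deg gF').
Qed.

Lemma gmap_add C D d (F F' : bar G C -> bar G D) :
  graded_map d F -> graded_map d F' -> graded_map d (fun x => F x + F' x).
Proof.
move=> gF gF'; split; first exact: nl_add (gm_nl gF) (gm_nl gF').
by move=> p x hx b; apply: TH_add; [apply: (gm_deg gF)|apply: (gm_deg gF')].
Qed.

Lemma gmap_sign C D d (s : bool) (F : bar G C -> bar G D) :
  graded_map d F -> graded_map d (fun x => (-1) ^+ s *: F x).
Proof.
move=> gF; split; first exact: nl_scale (gm_nl gF).
by move=> p x hx b; apply: t_homog_sign; apply: (gm_deg gF).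
Qed.

Lemma gmap_id C : graded_map 0 (fun x : bar G C => x).
Proof. by split=> [|p x hx]; [exact: nl_id|rewrite addr0]. Qed.

(** epsilon has degree (1, 1), so codimension and local system degree of a
    Novikov monomial have the same parity. *)
Lemma eps_parity_gdeg n b : eps_parity n (gdeg b) = false.
Proof. by rewrite /eps_parity oddz_lsz_mu addbb andbF. Qed.

(** Left linearity over epsilon: on constants, the sign only depends on the
    parity of cd + ls, which F shifts by d up to Novikov monomials. *)
Lemma eps_twist_gmap C D d n (F : bar G C -> bar G D) x : graded_map d F ->
  F (eps_twist n x) = (-1) ^+ oddz (n * d) *: eps_twist n (F x).
Proof.
move=> gF; have nF := gm_nl gF; move: x; apply: nl_ext.
- exact: (nl_comp nF (@nl_eps_twist n C)).
- exact: (nl_scale _ (nl_comp (@nl_eps_twist n D) nF)).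
have epsC t : eps_twist n (gconst t : bar G C) = gconst (t_sign (eps_chi n) t).
  apply/funext => b; rewrite /eps_twist !gconstE; case: eqP => // _.
  exact/lin0/lin_tsign/eps_char.
have lC := @lin_tsign _ _ C _ _ (eps_char n).
apply: t_homog_ext.
- by move=> a u v; rewrite nl_gconst (nl_lin (@nl_eps_twist n C)) (nl_lin nF).
- move=> a u v; rewrite nl_gconst (nl_lin nF) (nl_lin (@nl_eps_twist n D)).
  by rewrite scalerDr !scalerA [_ * a]mulrC.
move=> p t ht; rewrite epsC (t_sign_homog (eps_char n) ht).
rewrite -[_ *: t]addr0 (nl_phi nF) (_ : gconst 0 = 0); last first.
  by apply/funext => b; rewrite gconstE if_same.
rewrite (fa0 (nl_fadd nF)) addr0; apply/funext => b.
have /(_ b) hb := gm_deg gF (bar_homog_gconst ht).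
rewrite -[LHS]/(_ *: F (gconst t) b) -[RHS]/(_ *: t_sign _ (F (gconst t) b)).
rewrite (t_sign_homog (eps_char n) hb) scalerA -signr_addb; congr (_ ^+ _ *: _).
have sc := eps_char n.
have psiN q : eps_parity n (- q) = eps_parity n q.
  have := sc_add sc q (- q); rewrite subrr (sc_even sc) //.
  by case: (eps_parity n q); case: (eps_parity n (- q)).
rewrite (sc_add sc) (sc_add sc p) psiN eps_parity_gdeg addbF.
have -> : eps_parity n (d, 0) = oddz (n * d) by rewrite oddzM /eps_parity addbF.
by rewrite addbCA addbb addbF.
Qed.

(** The analogous statement for the Koszul sign, which does see the Novikov
    monomials. *)
Lemma koszul_twist_gmap C D d e (F : bar G C -> bar G D) t : graded_map d F ->
  koszul_twist e (F (gconst t)) = (-1) ^+ oddz (e * d) *: F (gconst (t_sign (koszul e) t)).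
Proof.
move=> gF; have nF := gm_nl gF; have lF := nl_phi nF.
have lC := @lin_tsign _ _ C _ _ (koszul_char e).
have lD := @lin_tsign _ _ D _ _ (koszul_char e).
move: t; apply: t_homog_ext.
- move=> a u v; rewrite lF; apply/funext => b.
  rewrite -[RHS]/(a *: koszul_twist e (F (gconst u)) b + koszul_twist e (F (gconst v)) b) /koszul_twist.
  by rewrite famP lD scalerDr !scalerA [_ * a]mulrC.
- by move=> a u v; rewrite lC lF scalerDr !scalerA [_ * a]mulrC.
move=> p t ht; rewrite (t_sign_homog (koszul_char e) ht).
rewrite -[_ *: t]addr0 lF (_ : gconst 0 = 0); last first.
  by apply/funext => b; rewrite gconstE if_same.
rewrite (fa0 (nl_fadd nF)) addr0; apply/funext => b.
have /(_ b) hb := gm_deg gF (bar_homog_gconst ht).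
rewrite -[RHS]/(_ *: (_ *: F (gconst t) b)) /koszul_twist (t_sign_homog (koszul_char e) hb).
rewrite !scalerA -!signr_addb; congr (_ ^+ _ *: _).
rewrite /koszul_parity !oddzM -[(_ - _).1]/(p.1 + d - mu b) oddzB oddzD.
by case: (oddz e) (oddz (mu b)) (oddz p.1) (oddz d) => -[] [] [].
Qed.

Lemma ract_sum C (S : {fset gelt G}) (x : bar G C) (a : novikov G R) b :
  {subset upto_energy G (energy b) <= S} ->
  ract x a b = \sum_(c <- S) a c *: nshift c x b.
Proof.
move=> bS; rewrite /ract decomp_sum_swap (decomp_sum _ bS).
by apply: eq_bigr => c _; rewrite /nshift; case: gsub => //=; rewrite scaler0.
Qed.

Lemma lact_sum C (S : {fset gelt G}) (a : novikov G R) (x : bar G C) b :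
  {subset upto_energy G (energy b) <= S} ->
  lact a x b = \sum_(c <- S) a c *: nshift c (eps_twist (mu c) x) b.
Proof.
move=> bS; rewrite /lact (decomp_sum _ bS).
by apply: eq_bigr => c _; rewrite /nshift; case: gsub => //=; rewrite scaler0.
Qed.

Lemma otens_sum C (S : {fset gelt G}) (x y : bar G C) b :
  {subset upto_energy G (energy b) <= S} ->
  otens x y b = \sum_(c <- S) nshift c (fun a => tens (x c) (eps_twist (mu c) y a)) b.
Proof.
move=> bS; rewrite /otens (decomp_sum _ bS).
by apply: eq_bigr => c _; rewrite /nshift; case: gsub.
Qed.

(** A Novikov linear map commutes with the infinite sums which define the two
    actions, since these are finite below each energy. *)
Lemma nl_sum_filt C D (F : bar G C -> bar G D) (x : bar G C)
    (a : gelt G -> R) (y : gelt G -> bar G C) b : novlin F ->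
  (forall b' (S : {fset gelt G}), {subset upto_energy G (energy b') <= S} ->
     x b' = \sum_(c <- S) a c *: y c b') ->
  F x b = \sum_(c <- upto_energy G (energy b + 1)) a c *: F (y c) b.
Proof.
move=> nF ex; pose S := upto_energy G (energy b + 1).
pose z : gelt G -> talg C := \sum_(c <- S) a c *: y c.
have fxz : filt (energy b + 1) (x - z).
  move=> b' be; rewrite famB /z fam_sum (ex b' S) ?subrr // => c.
  by rewrite !mem_upto_energy => cb'; apply: le_trans cb' (ltW be).
have fF := nl_fadd nF.
have -> : x = (x - z) + z by rewrite subrK.
rewrite (fa_add fF) famD (nl_filt nF fxz) ?ltrDl // add0r.
rewrite /z (fa_sum _ _ fF) fam_sum; apply: eq_bigr => c _.
by rewrite (nlZ _ _ nF).
Qed.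

Lemma nl_ract C D (F : bar G C -> bar G D) x a : novlin F ->
  F (ract x a) = ract (F x) a.
Proof.
move=> nF; apply/funext => b.
rewrite (nl_sum_filt (a := a) (y := fun c => nshift c x) b nF); last first.
  by move=> b' S bS; apply: ract_sum.
rewrite (ract_sum (S := upto_energy G (energy b + 1))); last first.
  by move=> c; rewrite !mem_upto_energy => cb; apply: le_trans cb _; rewrite lerDl.
by apply: eq_bigr => c _; rewrite (nl_shift nF).
Qed.

(** A homogeneous Novikov element of codimension p.1 involves epsilon^n only
    for n of the parity of p.1, because R is evenly graded. *)
Lemma gmap_lact C D d (F : bar G C -> bar G D) p a x : graded_map d F ->
  nov_homog p a -> F (lact a x) = (-1) ^+ oddz (d * p.1) *: lact a (F x).
Proof.
move=> gF pa; have nF := gm_nl gF; apply/funext => b.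
rewrite (nl_sum_filt (a := a) (y := fun c => nshift c (eps_twist (mu c) x)) b nF);
  last by move=> b' S bS; apply: lact_sum.
rewrite -[RHS]/(_ *: lact a (F x) b).
rewrite (lact_sum (S := upto_energy G (energy b + 1))); last first.
  by move=> c; rewrite !mem_upto_energy => cb; apply: le_trans cb _; rewrite lerDl.
rewrite scaler_sumr; apply: eq_bigr => c _.
have [->|ac] := eqVneq (a c) 0; first by rewrite !scale0r scaler0.
have [h2 _] := @ga_even K R (p - gdeg c) (a c) (pa c) ac.
have epc : oddz p.1 = oddz (mu c).
  have := @oddz_even (p.1 - mu c) h2; rewrite oddzB.
  by case: (oddz p.1); case: (oddz (mu c)).
rewrite (nl_shift nF) (eps_twist_gmap _ _ gF) nshiftZ.
rewrite -[X in _ *: X]/(_ *: nshift c (eps_twist (mu c) (F x)) b) !scalerA mulrC.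
by rewrite !oddzM andbC -epc.
Qed.

Lemma gmap_degree C D d (F : bar G C -> bar G D) : graded_map d F -> degree_map d F.
Proof.
move=> gF; have nF := gm_nl gF; split.
- exact: (fa_add (nl_fadd nF)).
- exact: nl_filt.
- exact: gm_deg.
- move=> p a x c pa; rewrite (gmap_lact _ gF pa) (nl_ract _ _ nF).
  by rewrite [in RHS]signE.
Qed.
End BarMaps.

(** * Tensor products of graded maps *)

Section Tensors.
Variables (K : realType) (G : discrete_submonoid K) (R : gr_alg K).
Implicit Types (C D E : gr_mod R) (b c : gelt G).

Definition nov_monomial c : novikov G R := fun b => (b == c)%:R.

Lemma ract_monomial C (x : bar G C) c : ract x (nov_monomial c) = nshift c x.
Proof.
apply/funext => b; rewrite (ract_sum (S := c |` upto_energy G (energy b))%fset); last first.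
  by move=> d db; rewrite inE db orbT.
rewrite (bigD1_seq c) ?fset_uniq ?inE ?eqxx //= big1 ?addr0.
  by rewrite /nov_monomial eqxx scale1r.
by move=> d /negPf dc; rewrite /nov_monomial dc scale0r.
Qed.

Lemma ract_const C (x : bar G C) (a : R) : ract x (gconst a) = a *: x.
Proof.
apply/funext => b.
rewrite (ract_sum (S := gzero G |` upto_energy G (energy b))%fset); last first.
  by move=> d db; rewrite inE db orbT.
rewrite (bigD1_seq (gzero G)) ?fset_uniq ?inE ?eqxx //= big1 ?addr0.
  by rewrite gconstE eqxx nshift0.
by move=> d /negPf dc; rewrite gconstE dc scale0r.
Qed.

Lemma lact_nov1 C (x : bar G C) : lact (@nov1 K G R) x = x.
Proof.
apply/funext => b.
rewrite (lact_sum (S := gzero G |` upto_energy G (energy b))%fset); last first.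
  by move=> d db; rewrite inE db orbT.
rewrite (bigD1_seq (gzero G)) ?fset_uniq ?inE ?eqxx //= big1 ?addr0.
  by rewrite /nov1 gconstE eqxx nshift0 scale1r /eps_twist eps0.
by move=> d /negPf dc; rewrite /nov1 gconstE dc scale0r.
Qed.

Lemma nov1_homog : nov_homog 0 (@nov1 K G R).
Proof.
move=> b; rewrite /nov1 gconstE; case: eqP => [->|_]; last exact: gr_proj0.
by rewrite gdeg0 subr0; apply: ga_one.
Qed.

(** The bilinearity of [degree_map] is exploited for the unit on the left and
    for constants and monomials on the right. *)
Lemma degree_gmap C D d (F : bar G C -> bar G D) : degree_map d F -> graded_map d F.
Proof.
case=> DF eF hF bF; split=> //.
have rF x a : F (ract x a) = ract (F x) a.
  have := bF 0 _ x a nov1_homog; rewrite !lact_nov1 => ->.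
  by rewrite mulr0 scale1r.
split=> // [a x y|c x]; first by rewrite DF -[a *: x]ract_const rF ract_const.
by rewrite -!ract_monomial rF.
Qed.

Lemma fadd_comp (U V W : lmodType R) (F : (gelt G -> V) -> (gelt G -> W))
  (F' : (gelt G -> U) -> _) : fadd F -> fadd F' -> fadd (fun x => F (F' x)).
Proof.
move=> fF fF'; split=> [x y|e x ex]; first by rewrite (fa_add fF') (fa_add fF).
exact/(fa_filt fF)/(fa_filt fF').
Qed.

Lemma fadd_otens C (y : bar G C) :
  fadd (fun x : bar G C => otens x y : gelt G -> tensor (talg C) (talg C)).
Proof.
split=> [x x'|e x ex b be].
  apply/funext => b; rewrite famD !(otens_sum (S := upto_energy G (energy b))) //.
  rewrite -big_split; apply: eq_bigr => c _ /=.
  rewrite -[RHS]/((nshift c _ + nshift c _) b) -nshiftD; congr (nshift _ _ _).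
  by apply/funext => a; rewrite famD famD (linD (lin_tensl _)).
rewrite (otens_sum (S := upto_energy G (energy b))) // big1 // => c _.
apply: (@nshift_ind _ _ _ _ _ _ (fun v => v = 0)) => // a eb.
rewrite ex ?(lin0 (lin_tensl _)) //; apply: le_lt_trans be.
by rewrite eb energyD lerDl energy_ge0.
Qed.

Lemma otens_mono C c (t : talg C) (y : bar G C) :
  otens (nshift c (gconst t)) y = nshift c (fun b => tens t (eps_twist (mu c) y b)).
Proof.
apply/funext => b; rewrite (otens_sum (S := c |` upto_energy G (energy b))%fset).
  rewrite (bigD1_seq c) ?fset_uniq ?inE ?eqxx //= big1 ?addr0.
    by rewrite nshift_gconst eqxx.
  move=> d /negPf dc; rewrite nshift_gconst dc.
  apply: (@nshift_ind _ _ _ _ _ _ (fun v => v = 0)) => // a _.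
  exact: lin0 (lin_tensl _).
by move=> d db; rewrite inE db orbT.
Qed.

Lemma otens_gconst C (t : talg C) (y : bar G C) :
  otens (gconst t) y = (fun b => tens t (y b)) :> bar2 G C.
Proof.
rewrite -[gconst t]nshift0 otens_mono nshift0.
by apply/funext => b; rewrite /eps_twist eps0.
Qed.

Lemma otens_gconst2 C (t u : talg C) :
  otens (gconst t) (gconst u) = gconst (tens t u) :> bar2 G C.
Proof.
rewrite otens_gconst; apply/funext => b; rewrite !gconstE; case: eqP => // _.
exact: lin0 (lin_tensr _).
Qed.

Lemma nl_otens C (x : bar G C) :
  novlin (fun y : bar G C => otens x y : gelt G -> tensor (talg C) (talg C)).
Proof.
have ne c := @nl_eps_twist K G R (mu c) C.
split=> [a y y'|e y ey b be|d y].
- apply/funext => b; rewrite famP !(otens_sum (S := upto_energy G (energy b))) //.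
  rewrite scaler_sumr -big_split; apply: eq_bigr => c _ /=.
  rewrite -[RHS]/((a *: nshift c _ + nshift c _) b) -nshiftP.
  congr (nshift _ _ _).
  by apply/funext => b'; rewrite (nl_lin (ne c)) !famP tensPr.
- rewrite (otens_sum (S := upto_energy G (energy b))) // big1 // => c _.
  apply: (@nshift_ind _ _ _ _ _ _ (fun v => v = 0)) => // a eb.
  rewrite (nl_filt (ne c) ey) ?(lin0 (lin_tensr _)) //; apply: le_lt_trans be.
  by rewrite eb energyD lerDr energy_ge0.
- move: x; apply: (@fadd_ext _ _ _ _ _ (fun x => otens x _ : gelt G -> _)
    (fun x => nshift d (otens x y))).
  + exact: fadd_otens.
  + apply: fadd_comp (fadd_otens y).
    by split=> [x x'|e x]; [exact: nshiftD|exact: nshift_filt].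
  move=> c t; rewrite !otens_mono !nshift_nshift gaddC -nshift_nshift.
  rewrite (nl_shift (ne c)); congr nshift; apply/funext => b.
  by rewrite /nshift; case: gsub => //=; apply: lin0 (lin_tensr _).
Qed.

(** Sliding a monomial from the first factor to the second: epsilon^mu(c)
    moves past the second factor. *)
Lemma otens_shiftl C c (x y : bar G C) :
  otens (nshift c x) y = nshift c (otens x (eps_twist (mu c) y)).
Proof.
move: x; apply: (@fadd_ext _ _ _ _ _ (fun x => otens (nshift c x) y : gelt G -> _)
    (fun x => nshift c (otens x (eps_twist (mu c) y)))).
- apply: fadd_comp (fadd_otens y) _.
  by split=> [x x'|e x]; [exact: nshiftD|exact: nshift_filt].
- apply: fadd_comp (fadd_otens _).
  by split=> [x x'|e x]; [exact: nshiftD|exact: nshift_filt].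
move=> d t; rewrite nshift_nshift !otens_mono -nshift_nshift.
congr (nshift c (nshift d _)); apply/funext => b; congr tens.
have l n := @lin_tsign _ _ C _ _ (eps_char n).
rewrite /eps_twist; move: (y b); apply: t_homog_ext; [exact: l|exact: lin_comp (l _) (l _)|].
move=> p u hu; rewrite !(t_sign_homog (eps_char _) hu) (linZ _ _ (l _)).
rewrite !(t_sign_homog (eps_char _) hu) scalerA -signr_addb; congr (_ ^+ _ *: _).
rewrite /eps_parity muD oddzD.
by case: (oddz (mu c)); case: (oddz (mu d)); case: (oddz p.1); case: (oddz (lsz p)).
Qed.

Lemma otensZl C a (x y : bar G C) : otens (a *: x) y = a *: otens x y.
Proof.
apply/funext => b; rewrite -[RHS]/(a *: otens x y b).
rewrite !(otens_sum (S := upto_energy G (energy b))) // scaler_sumr.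
apply: eq_bigr => c _; rewrite -[RHS]/((a *: nshift c _) b) -nshiftZ.
congr (nshift _ _ _); apply/funext => b'.
by rewrite -[(a *: x) c]/(a *: x c) (linZ _ _ (lin_tensl _)).
Qed.

Lemma otensDl C (x x' y : bar G C) : otens (x + x') y = otens x y + otens x' y.
Proof. exact: (fa_add (fadd_otens y)). Qed.

Lemma otensDr C (x y y' : bar G C) : otens x (y + y') = otens x y + otens x y'.
Proof. exact: (fa_add (nl_fadd (nl_otens x))). Qed.

Lemma otensZr C a (x y : bar G C) : otens x (a *: y) = a *: otens x y.
Proof. exact: (nlZ a y (nl_otens x)). Qed.

(** The map f (x) g for g of codimension degree e, with its Koszul sign.  Both
    [otens_map] and [otens_coder] are built from it ([otens_mapE],
    [otens_coderE]), so that one composition rule, [gtens_comp], governs all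
    compatibilities with coproducts. *)
Definition gtens C D e (f g : bar G C -> bar G D) : bar2 G C -> bar2 G D :=
  conv (tlift (fun t u => otens (f (gconst (t_sign (koszul e) t))) (g (gconst u)))).

Lemma bar2_ext C (W : lmodType R)
  (F F' : (gelt G -> tensor (talg C) (talg C)) -> gelt G -> W) :
  novlin F -> novlin F' ->
  (forall t u, F (gconst (tens t u)) = F' (gconst (tens t u))) -> F =1 F'.
Proof.
move=> nF nF' FF'; apply: nl_ext => //; apply: tens_ext => //; exact: nl_phi.
Qed.

Section GTens.
Variables (C D : gr_mod R) (e : int) (f g : bar G C -> bar G D).
Hypotheses (nf : novlin f) (ng : novlin g).

Let phi (t u : talg C) : bar2 G D :=
  otens (f (gconst (t_sign (koszul e) t))) (g (gconst u)).

Let phil u : is_lin (phi^~ u).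
Proof.
move=> a t t'; rewrite /phi (lin_tsign (koszul_char e)) (nl_phi nf).
by rewrite otensDl otensZl.
Qed.
Let phir t : is_lin (phi t).
Proof. by move=> a u u'; rewrite /phi (nl_phi ng) otensDr otensZr. Qed.

Lemma nl_gtens : novlin (gtens e f g).
Proof. exact/nl_conv/lin_tlift. Qed.

Lemma gtens_tens t u : gtens e f g (gconst (tens t u)) =
  otens (f (gconst (t_sign (koszul e) t))) (g (gconst u)).
Proof.
rewrite /gtens conv_gconst; last exact: (lin_tlift phil phir).
exact: (tlift_tens phil phir).
Qed.

End GTens.

(** Reduces to monomials c t and constants u.  The epsilon^mu(c) of the first
    factor has to cross u on one side and g u on the other; the difference is
    (-1)^(e mu(c)), the Koszul sign of g and the monomial. *)
Lemma gtens_otens C D e (f g : bar G C -> bar G D) x y :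
  novlin f -> graded_map e g -> gtens e f g (otens x y) = otens (f (koszul_twist e x)) (g y).
Proof.
move=> nf gg; have ng := gm_nl gg; have nfg := nl_gtens e nf ng.
move: x; apply: (@fadd_ext _ _ _ _ _ (fun x : bar G C => gtens e f g (otens x y))
  (fun x => otens (f (koszul_twist e x)) (g y) : gelt G -> _)).
- exact: fadd_comp (nl_fadd nfg) (fadd_otens y).
- apply: (fadd_comp (fadd_otens (g y))).
  exact: (fadd_comp (nl_fadd nf) (@fadd_koszul_twist K G R e C)).
move=> c t; move: y.
apply: (@nl_ext _ _ _ _ _ (fun y : bar G C => gtens e f g (otens _ y))
  (fun y => otens _ (g y) : gelt G -> _)).
- exact: (nl_comp nfg (nl_otens _)).
- exact: (nl_comp (nl_otens _) ng).
move=> u; rewrite otens_mono.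
have eu : eps_twist (mu c) (gconst u : bar G C) =
          (gconst (t_sign (eps_chi (mu c)) u) : bar G C).
  apply/funext => b; rewrite /eps_twist !gconstE; case: eqP => // _.
  exact/lin0/lin_tsign/eps_char.
have -> : (fun b => tens t (eps_twist (mu c) (gconst u) b)) =
          gconst (tens t (t_sign (eps_chi (mu c)) u)).
  by rewrite eu -otens_gconst otens_gconst2.
rewrite (nl_shift nfg) gtens_tens // koszul_twist_mono (nlZ _ _ nf) (nl_shift nf).
rewrite otensZl otens_shiftl -eu (eps_twist_gmap _ _ gg) mulrC otensZr.
by rewrite nshiftZ.
Qed.

(** The Koszul rule for composing tensor products of maps. *)
Lemma gtens_comp C D E e e' d' (f : bar G D -> bar G E) g
    (f' : bar G C -> bar G D) g' z :
  novlin f -> graded_map e g -> graded_map d' f' -> novlin g' ->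
  gtens e f g (gtens e' f' g' z) =
  (-1) ^+ oddz (e * d') *: gtens (e + e') (fun x => f (f' x)) (fun x => g (g' x)) z.
Proof.
move=> nf gg gf' ng'; have nf' := gm_nl gf'; have ng := gm_nl gg.
move: z; apply: bar2_ext.
- exact: nl_comp (nl_gtens _ nf ng) (nl_gtens _ nf' ng').
- by apply/nl_scale/nl_gtens; apply: nl_comp.
move=> t u; rewrite !gtens_tens //; last 2 first.
- exact: nl_comp.
- exact: nl_comp.
rewrite gtens_otens // (koszul_twist_gmap _ _ gf') koszul_comp (nlZ _ _ nf) otensZl //.
Qed.

Lemma eq_gtens C D e (f f' g g' : bar G C -> bar G D) z :
  f =1 f' -> g =1 g' -> gtens e f g z = gtens e f' g' z.
Proof. by move=> /funext -> /funext ->. Qed.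

Lemma gtensDl C D e (f f' g : bar G C -> bar G D) z :
  novlin f -> novlin f' -> novlin g ->
  gtens e (fun x => f x + f' x) g z = gtens e f g z + gtens e f' g z.
Proof.
move=> nf nf' ng; move: z; apply: bar2_ext.
- by apply: nl_gtens => //; apply: nl_add.
- by apply: nl_add; apply: nl_gtens.
move=> t u; rewrite !gtens_tens //; last exact: nl_add.
by rewrite otensDl.
Qed.

Lemma gtensDr C D e (f g g' : bar G C -> bar G D) z :
  novlin f -> novlin g -> novlin g' ->
  gtens e f (fun x => g x + g' x) z = gtens e f g z + gtens e f g' z.
Proof.
move=> nf ng ng'; move: z; apply: bar2_ext.
- by apply: nl_gtens => //; apply: nl_add.
- by apply: nl_add; apply: nl_gtens.
move=> t u; rewrite !gtens_tens //; last exact: nl_add.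
by rewrite otensDr.
Qed.

Lemma gtensZl C D e a (f g : bar G C -> bar G D) z :
  novlin f -> novlin g ->
  gtens e (fun x => a *: f x) g z = a *: gtens e f g z.
Proof.
move=> nf ng; move: z; apply: bar2_ext.
- by apply: nl_gtens => //; apply: nl_scale.
- by apply: nl_scale; apply: nl_gtens.
move=> t u; rewrite !gtens_tens //; last exact: nl_scale.
by rewrite otensZl.
Qed.

Lemma otens_mapE C D (f g : bar G C -> bar G D) z :
  otens_map f g z = gtens 0 f g z.
Proof.
rewrite /otens_map /gtens /rext /conv; apply/funext => b; apply: eq_fsbigr => p _.
by congr (gen_lift _ _ _); apply/funext => -[t u] /=; rewrite koszul0.
Qed.

Lemma otens_coderE C D d (f1 f2 h : bar G C -> bar G D) z :
  novlin f1 -> novlin f2 -> novlin h ->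
  otens_coder d f1 f2 h z = gtens 0 h f2 z + gtens d f1 h z.
Proof.
move=> n1 n2 nh; have lk := @lin_tsign _ _ C _ _ (koszul_char d).
pose phi (t u : talg C) : bar2 G D := otens (h (gconst t)) (f2 (gconst u))
    + otens (f1 (gconst (t_sign (koszul d) t))) (h (gconst u)).
have phil u : is_lin (phi^~ u).
  move=> a t t'; rewrite /phi lk !nl_phi // !otensDl !otensZl scalerDr.
  by rewrite addrACA.
have phir t : is_lin (phi t).
  move=> a u u'; rewrite /phi !nl_phi // !otensDr !otensZr scalerDr.
  by rewrite addrACA.
move: z; apply: (@bar2_ext _ _ (conv (tlift phi))).
- exact/nl_conv/lin_tlift.
- by apply: nl_add; apply: nl_gtens.
move=> t u; rewrite !gtens_tens // conv_gconst; last exact: lin_tlift.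
by rewrite (tlift_tens phil phir) /phi koszul0.
Qed.

Lemma nl_Delta C : novlin (@Delta K G R C : (gelt G -> talg C) -> _).
Proof. exact/nl_pointwise/lin_tsplit. Qed.

End Tensors.

(** * The tensor algebra *)

(** The rearrangement of terms in the coproduct of a twisted derivation. *)
Lemma split_cons_add (V : nmodType) (t1 l1 t2 l2 l3 : V) :
  t1 + l1 + (t2 + (l2 + l3)) = l1 + l2 + (t1 + t2 + l3).
Proof.
by rewrite addrACA (addrA l1) [l1 + l2 + l3]addrC addrA addrC.
Qed.

Section TensorAlgebra.
Variable R : comPzRingType.
Implicit Types (M N W : lmodType R).

Definition lcons M (y : M) : talg M -> talg M := gen_lift (fun w => word (y :: w)).

Lemma lcons_respects M (y : M) :
  respects (@multilin_rel R M) (fun w => word (y :: w)).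
Proof. by apply: multilin_respects => a x x' u v; rewrite -!cat_cons wordP. Qed.

Lemma lcons_word M (y : M) w : lcons y (word w) = word (y :: w).
Proof. exact/lift_gen/lcons_respects. Qed.

Lemma lin_lconsr M (y : M) : is_lin (lcons y).
Proof. exact/lin_lift/lcons_respects. Qed.

Lemma lin_lconsl M (t : talg M) : is_lin (fun y => lcons y t).
Proof.
move=> a y y'; move: t; apply: word_ext; first exact: lin_lconsr.
  by apply: lin_add; [apply: lin_scale|]; exact: lin_lconsr.
by move=> w; rewrite !lcons_word -[_ :: w]cat0s wordP.
Qed.

Lemma cons_ext M W (f g : talg M -> W) : is_lin f -> is_lin g ->
  f (word [::]) = g (word [::]) ->
  (forall x t, f t = g t -> f (lcons x t) = g (lcons x t)) -> f =1 g.
Proof.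
move=> lf lg fg0 fgS; apply: word_ext => //.
by elim=> [|x w IH] //; rewrite -lcons_word fgS.
Qed.

Lemma tpart0_lcons M (x : M) t : tpart0 (lcons x t) = 0.
Proof.
move: t; apply: word_ext => [| |w]; first exact: lin_comp (@lin_tpart0 R M) (lin_lconsr x).
  by move=> a u v; rewrite scaler0 addr0.
by rewrite lcons_word tpart0_word.
Qed.

Lemma tpart1_lcons M (x : M) t : tpart1 (lcons x t) = (tpart0 t : R) *: x.
Proof.
move: t; apply: word_ext => [| |w]; first exact: lin_comp (@lin_tpart1 R M) (lin_lconsr x).
  by move=> a u v; rewrite (lin_tpart0 a u v) scalerDl scalerA.
rewrite lcons_word tpart1_word tpart0_word.
by case: w => [|y w]; rewrite ?scale1r ?scale0r.
Qed.

Definition tmor M N (c : M -> N) : talg M -> talg N :=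
  gen_lift (fun w => word (map c w)).

Lemma tmor_respects M N (c : M -> N) : is_lin c ->
  respects (@multilin_rel R M) (fun w => word (map c w)).
Proof.
by move=> lc; apply: multilin_respects => a x x' u v; rewrite !map_cat /= lc wordP.
Qed.

Lemma tmor_word M N (c : M -> N) w : is_lin c -> tmor c (word w) = word (map c w).
Proof. by move=> lc; apply/lift_gen/tmor_respects. Qed.

Lemma lin_tmor M N (c : M -> N) : is_lin c -> is_lin (tmor c).
Proof. by move=> lc; apply/lin_lift/tmor_respects. Qed.

Lemma tmor_nil M N (c : M -> N) : is_lin c -> tmor c (word [::]) = word [::].
Proof. exact: tmor_word. Qed.

Lemma tmor_lcons M N (c : M -> N) x t : is_lin c ->
  tmor c (lcons x t) = lcons (c x) (tmor c t).
Proof.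
move=> lc; have lt := lin_tmor lc; move: t; apply: word_ext.
- exact: lin_comp lt (lin_lconsr x).
- exact: lin_comp (lin_lconsr _) lt.
by move=> w; rewrite lcons_word !tmor_word // lcons_word.
Qed.

Lemma tmor_id M t : tmor (fun x : M => x) t = t.
Proof.
have l := @lin_id R M; move: t; apply: word_ext => [| |w].
- exact: lin_tmor.
- exact: lin_id.
- by rewrite tmor_word // map_id.
Qed.

Lemma tmor_comp M N W (c : N -> W) (c' : M -> N) t : is_lin c -> is_lin c' ->
  tmor c (tmor c' t) = tmor (fun x => c (c' x)) t.
Proof.
move=> lc lc'; have lcc := lin_comp lc lc'; move: t; apply: word_ext => [| |w].
- exact: lin_comp (lin_tmor lc) (lin_tmor lc').
- exact: lin_tmor.
- by rewrite !tmor_word // -map_comp.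
Qed.

Lemma tmor_tpart0 M N (c : M -> N) t : is_lin c -> tpart0 (tmor c t) = tpart0 t.
Proof.
move=> lc; move: t; apply: word_ext => [| |w].
- exact: lin_comp (@lin_tpart0 R N) (lin_tmor lc).
- exact: lin_tpart0.
- by rewrite tmor_word // !tpart0_word; case: w.
Qed.

(** On x_1 ... x_k this is the sum over j of
    a x_1 ... a x_(j-1) k x_j c x_(j+1) ... c x_k.  With a the sign operator
    and c the identity it is the coderivation extending k; with k a homotopy
    from the identity to c it is the homotopy of the tensor trick. *)
Fixpoint twder_word M N (a k c : M -> N) (w : seq M) : talg N :=
  if w is x :: w' then lcons (k x) (word (map c w')) + lcons (a x) (twder_word a k c w')
  else 0.
Definition twder M N (a k c : M -> N) : talg M -> talg N := gen_lift (twder_word a k c).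

Section KDer.
Variables (M N : lmodType R) (a k c : M -> N).
Hypotheses (la : is_lin a) (lk : is_lin k) (lc : is_lin c).

Lemma twder_respects : respects (@multilin_rel R M) (twder_word a k c).
Proof.
apply: multilin_respects => s x x' u v.
elim: u => [|y u IH] /=.
  rewrite la lk !(lin_lconsl _ s) scalerDr addrACA //.
by rewrite IH (lin_lconsr _ s) !map_cat /= lc wordP (lin_lconsr _ s) scalerDr addrACA.
Qed.

Lemma lin_twder : is_lin (twder a k c).
Proof. exact/lin_lift/twder_respects. Qed.

Lemma twder_wordE w : twder a k c (word w) = twder_word a k c w.
Proof. exact/lift_gen/twder_respects. Qed.

Lemma twder_nil : twder a k c (word [::]) = 0.
Proof. exact: twder_wordE. Qed.

Lemma twder_lcons x t :
  twder a k c (lcons x t) = lcons (k x) (tmor c t) + lcons (a x) (twder a k c t).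
Proof.
have lK := lin_twder; have lT := lin_tmor lc; move: t; apply: word_ext => [| |w].
- exact: lin_comp lK (lin_lconsr x).
- by apply: lin_add; apply: lin_comp => //; apply: lin_lconsr.
- by rewrite lcons_word !twder_wordE tmor_word.
Qed.

Lemma twder_tpart0 t : tpart0 (twder a k c t) = 0.
Proof.
move: t; apply: cons_ext.
- exact: lin_comp (@lin_tpart0 R N) lin_twder.
- by move=> s u v; rewrite scaler0 addr0.
- by rewrite twder_nil (lin0 (@lin_tpart0 R N)).
by move=> x t _; rewrite twder_lcons (linD (@lin_tpart0 R N)) !tpart0_lcons addr0.
Qed.

End KDer.

Definition tens_map M N (f g : talg M -> talg N) :
  tensor (talg M) (talg M) -> tensor (talg N) (talg N) :=
  tlift (fun s u => tens (f s) (g u)).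

Section TBi.
Variables (M N : lmodType R) (f g : talg M -> talg N).
Hypotheses (lf : is_lin f) (lg : is_lin g).
Let l1 u : is_lin (fun s => tens (f s) (g u)).
Proof. exact: lin_comp (lin_tensl _) lf. Qed.
Let l2 s : is_lin (fun u => tens (f s) (g u)).
Proof. exact: lin_comp (lin_tensr _) lg. Qed.
Lemma tens_map_tens s u : tens_map f g (tens s u) = tens (f s) (g u).
Proof. exact: tlift_tens l1 l2 s u. Qed.
Lemma lin_tens_map : is_lin (tens_map f g).
Proof. exact: lin_tlift l1 l2. Qed.
End TBi.

Definition lcons2 M (x : M) := tens_map (lcons x) id.

Lemma lin_lcons2 M (x : M) : is_lin (lcons2 x).
Proof. by apply: lin_tens_map; [exact: lin_lconsr|]. Qed.

Lemma lcons2_tens M (x : M) s u : lcons2 x (tens s u) = tens (lcons x s) u.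
Proof. by rewrite /lcons2 tens_map_tens //; exact: lin_lconsr. Qed.

Lemma tsplit_nil M : tsplit (word [::]) = tens (word [::]) (word [::]) :> tensor (talg M) _.
Proof. by rewrite tsplit_word big_ord1. Qed.

Lemma tsplit_lcons M (x : M) t :
  tsplit (lcons x t) = tens (word [::]) (lcons x t) + lcons2 x (tsplit t).
Proof.
have ls := @lin_tsplit R M; have lx := lin_lconsr x; have l2 := lin_lcons2 x.
move: t; apply: word_ext.
- exact: lin_comp ls lx.
- by apply: lin_add; [apply: lin_comp lx; apply: lin_tensr|apply: lin_comp].
move=> w; rewrite lcons_word !tsplit_word big_ord_recl /=; congr (_ + _).
rewrite (lin_sum _ _ l2); apply: eq_bigr => i _.
by rewrite lcons2_tens lcons_word.
Qed.

Lemma tsplit_tmor M N (c : M -> N) t : is_lin c ->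
  tsplit (tmor c t) = tens_map (tmor c) (tmor c) (tsplit t).
Proof.
move=> lc; have lT := lin_tmor lc; have lB := lin_tens_map lT lT.
have [lsM lsN] := (@lin_tsplit R M, @lin_tsplit R N).
move: t; apply: cons_ext.
- exact: lin_comp lsN lT.
- exact: lin_comp lB lsM.
- by rewrite tmor_nil // !tsplit_nil tens_map_tens // tmor_nil.
move=> x t IH; rewrite tmor_lcons // !tsplit_lcons IH (linD lB) tens_map_tens //.
rewrite tmor_nil // tmor_lcons //; congr (_ + _).
move: (tsplit t); apply: tens_ext => [| |s u].
- exact: lin_comp (lin_lcons2 _) lB.
- exact: lin_comp lB (lin_lcons2 _).
- by rewrite !(lcons2_tens, tens_map_tens) // tmor_lcons.
Qed.

(** Cutting a word after the distinguished position leaves it in the first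
    factor, with c acting on the second; cutting before it, the other way
    round. *)
Lemma tsplit_twder M N (a k c : M -> N) t : is_lin a -> is_lin k -> is_lin c ->
  tsplit (twder a k c t) =
  tens_map (twder a k c) (tmor c) (tsplit t) + tens_map (tmor a) (twder a k c) (tsplit t).
Proof.
move=> la lk lc; have lK := lin_twder la lk lc.
have lT := lin_tmor lc; have lA := lin_tmor la.
have [lsM lsN] := (@lin_tsplit R M, @lin_tsplit R N).
have [lB1 lB2] := (lin_tens_map lK lT, lin_tens_map lA lK).
move: t; apply: cons_ext.
- exact: lin_comp lsN lK.
- by apply: lin_add; apply: lin_comp.
- rewrite twder_nil // (lin0 lsN) tsplit_nil !tens_map_tens // twder_nil //.
  by rewrite (lin0 (lin_tensl _)) (lin0 (lin_tensr _)) addr0.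
move=> x t IH; rewrite twder_lcons // (linD lsN) !tsplit_lcons IH.
rewrite !(linD lB1) !(linD lB2) !tens_map_tens // twder_nil // tmor_nil //.
rewrite (lin0 (lin_tensl _)) add0r twder_lcons // (linD (lin_tensr _)).
rewrite (linD (lin_lcons2 _)) tsplit_tmor //.
have E1 z : tens_map (twder a k c) (tmor c) (lcons2 x z) =
    lcons2 (k x) (tens_map (tmor c) (tmor c) z)
    + lcons2 (a x) (tens_map (twder a k c) (tmor c) z).
  have lTT := lin_tens_map lT lT.
  move: z; apply: tens_ext => [| |s u].
  - exact: lin_comp lB1 (lin_lcons2 _).
  - by apply: lin_add; apply: lin_comp => //; apply: lin_lcons2.
  - rewrite !(lcons2_tens, tens_map_tens) // twder_lcons //.
    by rewrite (linD (lin_tensl _)).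
have E2 z : tens_map (tmor a) (twder a k c) (lcons2 x z) =
    lcons2 (a x) (tens_map (tmor a) (twder a k c) z).
  move: z; apply: tens_ext => [| |s u].
  - exact: lin_comp lB2 (lin_lcons2 _).
  - exact: lin_comp (lin_lcons2 _) lB2.
  - by rewrite !(lcons2_tens, tens_map_tens) // tmor_lcons.
by rewrite E1 E2; apply: split_cons_add.
Qed.

Definition rho M : tensor (talg M) (talg M) -> talg M :=
  tlift (fun s u => lcons (tpart1 s) u).

Lemma rho_lin M : is_lin (@rho M).
Proof.
apply: lin_tlift => u; last exact: lin_lconsr.
exact: lin_comp (lin_lconsl u) (@lin_tpart1 R M).
Qed.

Lemma rho_tens M (s u : talg M) : rho (tens s u) = lcons (tpart1 s) u.
Proof.
apply: tlift_tens => v; last exact: lin_lconsr.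
exact: lin_comp (lin_lconsl v) (@lin_tpart1 R M).
Qed.

(** A tensor of positive length is recovered from its coproduct; this is what
    allows induction on word length for a coderivation. *)
Lemma rho_split M (t : talg M) : t = (tpart0 t : R) *: word [::] + rho (tsplit t).
Proof.
have l1 := @lin_tpart1 R M.
move: t; apply: cons_ext.
- exact: lin_id.
- move=> a u v; rewrite (lin_tsplit a u v) (rho_lin a) (lin_tpart0 a u v).
  by rewrite scalerDl scalerDr addrACA -scalerA.
- rewrite tsplit_nil rho_tens tpart0_word tpart1_word scale1r.
  by rewrite (lin0 (lin_lconsl _)) addr0.
move=> x t IH; rewrite tpart0_lcons scale0r add0r tsplit_lcons (linD (@rho_lin M)).
rewrite rho_tens tpart1_word (lin0 (lin_lconsl _)) add0r.
suff -> : rho (lcons2 x (tsplit t)) = lcons x t by [].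
have l2 := lin_lcons2 x.
have H : forall z, rho (lcons2 x z) =
   tlift (fun s u => lcons ((tpart0 s : R) *: x) u) z.
  have q u : is_lin (fun s : talg M => lcons ((tpart0 s : R) *: x) u).
    move=> a v v'; rewrite (lin_tpart0 a v v') scalerDl -scalerA.
    exact: lin_lconsl.
  have q' s : is_lin (fun u : talg M => lcons ((tpart0 s : R) *: x) u).
    exact: lin_lconsr.
  apply: tens_ext => [| |s u].
  - exact: lin_comp (@rho_lin M) l2.
  - exact: lin_tlift.
  - by rewrite lcons2_tens rho_tens tlift_tens // tpart1_lcons.
rewrite H; move: {IH} t; apply: word_ext.
- apply: lin_comp (@lin_tsplit R M); apply: lin_tlift => u.
    move=> a v v'; rewrite (lin_tpart0 a v v') scalerDl -scalerA.
    exact: lin_lconsl.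
  exact: lin_lconsr.
- exact: lin_lconsr.
move=> w; rewrite tsplit_word -H (lin_sum _ _ l2) (lin_sum _ _ (@rho_lin M)).
rewrite big_ord_recl /= take0 drop0 lcons2_tens rho_tens tpart1_lcons.
rewrite tpart0_word scale1r big1 ?addr0 // => i _.
rewrite lcons2_tens rho_tens tpart1_lcons tpart0_word.
by case: w i => [[]|y w] //= i; rewrite scale0r (lin0 (lin_lconsl _)).
Qed.

Definition wlt M (n : nat) : submod (talg M) :=
  sm_span [set t | exists2 w, (size w < n)%N & t = word w].

Lemma wlt_map M W (f : talg M -> W) (S : submod W) n : is_lin f ->
  (forall w, (size w < n)%N -> S (f (word w))) -> forall t, wlt M n t -> S (f t).
Proof.
move=> lf fS t.
have p0 : S (f 0) by rewrite lin0 //; apply: sm0.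
have pD u v : S (f u) -> S (f v) -> S (f (u + v)).
  by rewrite linD //; apply: smD.
have pZ a u : S (f u) -> S (f (a *: u)) by rewrite linZ //; apply: smZ.
move=> /(_ (@Submod _ _ (fun u => S (f u)) p0 pD pZ)); apply.
by move=> _ [w wn ->]; apply: fS.
Qed.

Lemma wlt_word M n (w : seq M) : (size w < n)%N -> wlt M n (word w).
Proof. by move=> wn; apply: span_incl; exists w. Qed.

Lemma wlt_mono M m n t : (m <= n)%N -> wlt M m t -> wlt M n t.
Proof.
move=> mn; apply: (@wlt_map _ _ id (wlt M n)) => // w wm; apply: wlt_word.
exact: leq_trans wm mn.
Qed.

Definition zero_submod M : submod M := @Submod R M (fun u => u = 0) erefl
  (fun u v u0 v0 => etrans (congr2 +%R u0 v0) (addr0 0))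
  (fun a u u0 => etrans (congr1 ( *:%R a) u0) (scaler0 _ a)).

Lemma wlt0 M (t : talg M) : wlt M 0 t -> t = 0.
Proof.
by move=> H; apply: (H (zero_submod (talg M))) => u [].
Qed.

Lemma wlt_lcons M n (x : M) t : wlt M n t -> wlt M n.+1 (lcons x t).
Proof.
apply: (@wlt_map _ _ _ (wlt M n.+1)) => [|w wn]; first exact: lin_lconsr.
by rewrite lcons_word; apply: wlt_word.
Qed.

Lemma wlt_tmor M N (c : M -> N) n t : is_lin c -> wlt M n t -> wlt N n (tmor c t).
Proof.
move=> lc; apply: (@wlt_map _ _ _ (wlt N n)) => [|w wn]; first exact: lin_tmor.
rewrite tmor_word //.
by apply: wlt_word; rewrite size_map.
Qed.

Lemma wlt_twder M N (a k c : M -> N) n t : is_lin a -> is_lin k -> is_lin c ->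
  wlt M n t -> wlt N n (twder a k c t).
Proof.
move=> la lk lc; apply: (@wlt_map _ _ _ (wlt N n)); first exact: lin_twder.
move=> w; rewrite twder_wordE //; elim: w n => [|x w IH] n wn.
  exact: (sm0 (wlt N n)).
case: n wn => // n wn.
apply: (smD (s := wlt N n.+1)); apply: wlt_lcons; last exact: IH.
by apply: wlt_word; rewrite size_map.
Qed.

Lemma wlt_ex M (t : talg M) : exists n, wlt M n t.
Proof.
elim/presented_ind: t => [|a w t [n IH]]; first by exists 0%N; apply: sm0.
exists (maxn n (size w).+1); apply: smD.
  by apply/smZ/wlt_word; rewrite leq_max leqnn orbT.
by apply: wlt_mono IH; rewrite leq_max leqnn.
Qed.

End TensorAlgebra.

(** * The tensor trick *)

(** The cancellation in the homotopy formula of the tensor trick. *)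
Lemma cancel_mid (V : zmodType) (b a c a' c' : V) :
  a + (b + c) + (a' - b + c') = a + a' + (c + c').
Proof.
by rewrite (addrC b c) (addrA a) [a' - b]addrC -(addrA (- b)) (addrA (a + c + b)) addrK addrACA.
Qed.

(** A contraction (p, i, h) of a complex (M, d) onto H with zero differential,
    and a sign operator s anticommuting with d, induce a contraction of tensor
    algebras: D and h' below extend d and h, and the side conditions of
    (p, i, h) are what makes h' square to zero and be annihilated by p' and
    i'. *)
Section TensorTrick.
Variables (R : comPzRingType) (M H : lmodType R).
Variables (s d h : M -> M) (p : M -> H) (i : H -> M).
Hypotheses (ls : is_lin s) (ld : is_lin d) (lh : is_lin h).
Hypotheses (lp : is_lin p) (li : is_lin i).
Hypotheses (ss : forall x, s (s x) = x).
Hypotheses (sd : forall x, s (d x) = - d (s x)).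
Hypotheses (dd : forall x, d (d x) = 0) (pd : forall x, p (d x) = 0).
Hypotheses (di : forall y, d (i y) = 0) (pi : forall y, p (i y) = y).
Hypotheses (dh : forall x, d (h x) + h (d x) = i (p x) - x).
Hypotheses (hh : forall x, h (h x) = 0) (ph : forall x, p (h x) = 0).
Hypotheses (hi : forall y, h (i y) = 0).

Let lip : is_lin (fun x => i (p x)) := lin_comp li lp.
Let lid : is_lin (fun x : M => x) := @lin_id R M.
Let D := twder s d (fun x => x).
Let h' := twder s h (fun x => i (p x)).
Let p' := tmor p.
Let i' := tmor i.

Let lD : is_lin D. Proof. exact: lin_twder. Qed.
Let lh' : is_lin h'. Proof. exact: lin_twder. Qed.
Let lp' : is_lin p'. Proof. exact: lin_tmor. Qed.
Let li' : is_lin i'. Proof. exact: lin_tmor. Qed.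

Let l0 (V W : lmodType R) : is_lin (fun _ : V => 0 : W).
Proof. by move=> a u v; rewrite scaler0 addr0. Qed.

Let lcons0 (V : lmodType R) (t : talg V) : lcons 0 t = 0.
Proof. exact: lin0 (lin_lconsl t). Qed.

Let lcons_0 (V : lmodType R) (x : V) : lcons x 0 = 0.
Proof. exact: lin0 (lin_lconsr x). Qed.

Let tmor_ip t : tmor (fun x => i (p x)) t = i' (p' t).
Proof. by rewrite /i' /p' tmor_comp. Qed.

Let D_cons x t : D (lcons x t) = lcons (d x) t + lcons (s x) (D t).
Proof. by rewrite /D twder_lcons // tmor_id. Qed.

Let h_cons x t : h' (lcons x t) = lcons (h x) (i' (p' t)) + lcons (s x) (h' t).
Proof. by rewrite /h' twder_lcons // tmor_ip. Qed.

Lemma tt_pi u : tmor p (tmor i u) = u.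
Proof.
rewrite tmor_comp // (_ : (fun x => _) = (fun x => x)) ?tmor_id //.
by apply/funext => x; rewrite pi.
Qed.

Lemma tt_pD t : tmor p (twder s d (fun x => x) t) = 0.
Proof.
rewrite -/D -/p'; move: t; apply: cons_ext => [|||x t IH].
- exact: lin_comp.
- exact: l0.
- by rewrite /D twder_nil // lin0.
- by rewrite D_cons (linD lp') /p' !tmor_lcons // pd -/p' IH lcons0 lcons_0 addr0.
Qed.

Lemma tt_Di u : twder s d (fun x => x) (tmor i u) = 0.
Proof.
rewrite -/D -/i'; move: u; apply: cons_ext => [|||x t IH].
- exact: lin_comp.
- exact: l0.
- by rewrite /i' tmor_nil // /D twder_nil.
- by rewrite /i' tmor_lcons // D_cons di -/i' IH lcons0 lcons_0 addr0.
Qed.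

Lemma tt_hi u : twder s h (fun x => i (p x)) (tmor i u) = 0.
Proof.
rewrite -/h' -/i'; move: u; apply: cons_ext => [|||x t IH].
- exact: lin_comp.
- exact: l0.
- by rewrite /i' tmor_nil // /h' twder_nil.
- by rewrite /i' tmor_lcons // h_cons hi -/i' IH lcons0 lcons_0 addr0.
Qed.

Lemma tt_ph t : tmor p (twder s h (fun x => i (p x)) t) = 0.
Proof.
rewrite -/h' -/p'; move: t; apply: cons_ext => [|||x t IH].
- exact: lin_comp.
- exact: l0.
- by rewrite /h' twder_nil // lin0.
- by rewrite h_cons (linD lp') /p' !tmor_lcons // ph -/p' IH lcons0 lcons_0 addr0.
Qed.

Lemma tt_hh t :
  twder s h (fun x => i (p x)) (twder s h (fun x => i (p x)) t) = 0.
Proof.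
rewrite -/h'; move: t; apply: cons_ext => [|||x t IH].
- exact: lin_comp.
- exact: l0.
- by rewrite /h' twder_nil // lin0.
rewrite h_cons (linD lh') !h_cons hh lcons0 add0r IH lcons_0 addr0.
rewrite [h' (i' _)]tt_hi [p' (h' t)]tt_ph lcons_0 (lin0 li') lcons_0.
by rewrite addr0.
Qed.

Let lconsN (V : lmodType R) (x : V) t : lcons (- x) t = - lcons x t.
Proof. by rewrite -scaleN1r (linZ _ _ (lin_lconsl t)) scaleN1r. Qed.

Let lcons_N (V : lmodType R) (x : V) t : lcons x (- t) = - lcons x t.
Proof. by rewrite -scaleN1r (linZ _ _ (lin_lconsr x)) scaleN1r. Qed.

Lemma tt_DD t : twder s d (fun x => x) (twder s d (fun x => x) t) = 0.
Proof.
rewrite -/D; move: t; apply: cons_ext => [|||x t IH].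
- exact: lin_comp.
- exact: l0.
- by rewrite /D twder_nil // lin0.
rewrite D_cons (linD lD) !D_cons dd lcons0 add0r IH lcons_0 addr0.
by rewrite sd lconsN addNr.
Qed.

(** In D h' + h' D applied to x t, the terms that carry d on the letter x and
    h' on t cancel as s anticommutes with d; the remaining ones are
    (d h + h d) x followed by i' p' t and x followed by (D h' + h' D) t, and
    their sum telescopes. *)
Lemma tt_Dh t : twder s d (fun x => x) (twder s h (fun x => i (p x)) t)
  + twder s h (fun x => i (p x)) (twder s d (fun x => x) t) = tmor i (tmor p t) - t.
Proof.
rewrite -/D -/h' -/p' -/i'; move: t; apply: cons_ext => [|||x t IH].
- by apply: lin_add; apply: lin_comp.
- by move=> a u v; rewrite (lin_comp li' lp') scalerBr opprD addrACA.
- have [h0 D0] : h' (word [::]) = 0 /\ D (word [::]) = 0.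
    by rewrite /h' /D !twder_nil.
  by rewrite h0 D0 (lin0 lD) (lin0 lh') /p' /i' !tmor_nil // subrr addr0.
rewrite h_cons D_cons (linD lD) (linD lh') !D_cons !h_cons.
rewrite [D (i' _)]tt_Di [p' (D t)]tt_pD (lin0 li') !lcons_0 addr0 add0r.
rewrite /p' tmor_lcons // /i' tmor_lcons // -/i' -/p' ss sd lconsN.
rewrite (cancel_mid (lcons (d (s x)) (h' t))).
rewrite -(linD (lin_lconsl _)) -(linD (lin_lconsr _)) dh IH.
rewrite (linD (lin_lconsl _)) (linD (lin_lconsr _)) lconsN lcons_N.
by rewrite addrA subrK.
Qed.

End TensorTrick.

Section CoefBar.
Variables (K : realType) (G : discrete_submonoid K) (R : gr_alg K).
Implicit Types (C D : gr_mod R).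

Definition coefwise C D (phi : talg C -> talg D) (x : bar G C) : bar G D :=
  fun b => phi (x b).

Lemma nl_coefwise C D (phi : talg C -> talg D) : is_lin phi -> novlin (coefwise phi).
Proof. exact: nl_pointwise. Qed.

Lemma coefwise_gconst C D (phi : talg C -> talg D) t : is_lin phi ->
  coefwise phi (gconst t) = gconst (phi t).
Proof.
move=> lp; apply/funext => b; rewrite /coefwise !gconstE; case: eqP => // _.
exact: lin0.
Qed.

Lemma gmap_coefwise C D (phi : talg C -> talg D) d : is_lin phi ->
  (forall p t, t_homog p t -> t_homog (p + (d, 0)) (phi t)) -> graded_map d (coefwise phi).
Proof.
move=> lp hp; apply: gmap_gconst => [|p t ht]; first exact: nl_coefwise.
by rewrite coefwise_gconst //; apply/bar_homog_gconst/hp.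
Qed.

Lemma gtens_coefwise C D e (phi psi : talg C -> talg D) x : is_lin phi -> is_lin psi ->
  gtens e (coefwise phi) (coefwise psi) (Delta x) =
  (fun b => tens_map (fun t => phi (t_sign (koszul e) t)) psi (tsplit (x b))) :> bar2 G D.
Proof.
move=> lp lq; have lk := lin_comp lp (@lin_tsign _ _ C _ _ (koszul_char e)).
move: x.
have nD := nl_Delta G C.
have [np nq] := (nl_coefwise lp, nl_coefwise lq).
suff H z : gtens e (coefwise phi) (coefwise psi) z =
  (fun b => tens_map (fun t => phi (t_sign (koszul e) t)) psi (z b)) :> bar2 G D.
  by move=> x; rewrite H.
move: z; apply: bar2_ext.
- exact: nl_gtens.
- exact/nl_pointwise/lin_tens_map.
move=> t u; rewrite gtens_tens // !coefwise_gconst // otens_gconst2.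
apply/funext => b; rewrite !gconstE; case: eqP => _; first by rewrite tens_map_tens.
by rewrite (lin0 (lin_tens_map lk lq)).
Qed.

Lemma Delta_tmor C D (c : C -> D) (x : bar G C) : is_lin c ->
  Delta (coefwise (tmor c) x) = gtens 0 (coefwise (tmor c)) (coefwise (tmor c)) (Delta x).
Proof.
move=> lc; have lT := lin_tmor lc; rewrite gtens_coefwise //; apply/funext => b.
rewrite /Delta /coefwise tsplit_tmor //.
by congr (tens_map _ _ _); apply/funext => t; rewrite koszul0.
Qed.

Lemma Delta_twder C (e : int) (k c : C -> C) (x : bar G C) : is_lin k -> is_lin c ->
  let F := coefwise (twder (gsign (koszul e)) k c) in
  Delta (F x) = gtens 0 F (coefwise (tmor c)) (Delta x) + gtens e id F (Delta x).
Proof.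
move=> lk lc F; have ls := gsign_lin_char (C := C) (koszul_char e).
have lK := lin_twder ls lk lc; have lT := lin_tmor lc.
rewrite -[id in gtens e id]/(coefwise id) /F !gtens_coefwise //; apply/funext => b.
rewrite famD /Delta /coefwise tsplit_twder //; congr (_ + _).
by congr (tens_map _ _ _); apply/funext => t; rewrite koszul0.
Qed.

Lemma t_homog_lcons C p q (x : C) t : homog q x -> t_homog p t ->
  t_homog (p + (q - (1, 0))) (lcons x t).
Proof.
move=> qx; have ll := lin_lconsr x.
elim=> {p t} [p|p t u _ IH _ IH'|p a qs w pa hw].
- by rewrite (lin0 ll); apply: TH_zero.
- by rewrite (linD ll); apply: TH_add.
rewrite (linZ _ _ ll) lcons_word -addrA [X in p + X]addrC.
have -> : q - (1, 0) + \sum_(q <- qs) (q - (1, 0)) = \sum_(q <- q :: qs) (q - (1, 0)).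
  by rewrite big_cons.
by apply: TH_word => //; constructor.
Qed.

Lemma t_homog_ind C D (f : talg C -> talg D) d : is_lin f ->
  (forall qs w, List.Forall2 homog qs w ->
    t_homog (\sum_(q <- qs) (q - (1, 0)) + d) (f (word w))) ->
  forall p t, t_homog p t -> t_homog (p + d) (f t).
Proof.
move=> lf hf p t; elim=> {p t} [p|p t u _ IH _ IH'|p a qs w pa hw].
- by rewrite lin0 //; apply: TH_zero.
- by rewrite linD //; apply: TH_add.
- by rewrite linZ // -addrA; apply: t_homogZ (hf _ _ hw).
Qed.

Lemma t_homog_tmor C D (c : C -> D) : is_lin c -> is_graded 0 c ->
  forall p t, t_homog p t -> t_homog (p + 0) (tmor c t).
Proof.
move=> lc gc; apply: t_homog_ind; first exact: lin_tmor.
move=> qs w hw; rewrite addr0 tmor_word //; apply: t_homog_word.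
elim: hw => [|q x {}qs {}w qx _ IH] /=; constructor=> //.
by rewrite -[q]addr0; apply: gc.
Qed.

Lemma t_homog_twder C D e (a k c : C -> D) : is_lin a -> is_lin k -> is_lin c ->
  is_graded 0 a -> is_graded (e, 0) k -> is_graded 0 c ->
  forall p t, t_homog p t -> t_homog (p + (e, 0)) (twder a k c t).
Proof.
move=> la lk lc ga gk gc; apply: t_homog_ind; first exact: lin_twder.
move=> qs w; elim=> [|q x {}qs {}w qx hw IH].
  by rewrite twder_nil //; apply: TH_zero.
rewrite -lcons_word twder_lcons // big_cons; apply: TH_add.
  set S := \sum_(_ <- _) _.
  have -> : q - (1, 0) + S + (e, 0) = S + (q + (e, 0) - (1, 0)).
    by rewrite [X in X + (e, 0)]addrC -addrA [q + _ - _]addrAC.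
  apply: t_homog_lcons; first exact: gk.
  rewrite -[X in t_homog X]addr0; apply: t_homog_tmor => //.
  exact: t_homog_word.
rewrite -addrA addrC; apply: t_homog_lcons IH.
by rewrite -[q]addr0; apply: ga.
Qed.

Lemma gsign_graded C chi : is_graded 0 (@gsign K R C chi).
Proof.
move=> p x px; rewrite addr0 (gsign_homog chi px).
case: oddz; rewrite ?scale1r // scaleN1r /gr_homog /=.
apply: (addrI (gr_proj (gm_gr C) p x)).
by rewrite -gr_projD [in RHS]px !subrr gr_proj0.
Qed.

End CoefBar.

(** * The Neumann series *)

Section Neumann.
Variables (K : realType) (G : discrete_submonoid K) (R : comPzRingType).
Variables (V : lmodType R) (N : (gelt G -> V) -> (gelt G -> V)).
Hypothesis nN : novlin N.

(** N modulo F^{>0}, acting on coefficients of lowest energy. *)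
Definition leading (t : V) : V := N (gconst t) (gzero G).

Hypothesis leading_nil : forall t, exists n, iter n leading t = 0.

Let fN := nl_fadd nN.

Lemma leading0 : leading 0 = 0.
Proof.
rewrite /leading (_ : gconst 0 = 0) ?(fa0 fN) //.
by apply/funext => b; rewrite gconstE if_same.
Qed.

(** A decomposition of b contributes only if its first part has energy at
    least e, hence exactly e; then the second part has energy 0. *)
Lemma leadingE e x b : filt e x -> energy b = e -> N x b = leading (x b).
Proof.
move=> ex be; rewrite (nl_sum x nN (S := upto_energy G (energy b))) //.
rewrite (bigD1_seq b) ?fset_uniq ?mem_upto_energy //= big1 ?addr0 => [|c cb].
  by rewrite -[X in nshift b _ X]gadd0 gaddC nshift_gadd.
apply: (@nshift_ind _ _ _ _ _ _ (fun v => v = 0)) => // a ba.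
rewrite ex; last first.
  rewrite -be ba energyD ltrDl lt_neqAle energy_ge0 andbT eq_sym.
  by apply: contraNneq cb => /energy_eq0 a0; rewrite ba a0 gaddC gadd0.
by rewrite (_ : gconst 0 = 0) ?(fa0 fN) //; apply/funext => d; rewrite gconstE if_same.
Qed.

Lemma iter_filt k e x : filt e x -> filt e (iter k N x).
Proof. by move=> ex; elim: k => [|k IH] //=; apply: (nl_filt nN). Qed.

Lemma iter_leading k e x b : filt e x -> energy b = e ->
  iter k N x b = iter k leading (x b).
Proof.
move=> ex be; elim: k => [|k IH] //=.
by rewrite (leadingE (iter_filt k ex) be) IH.
Qed.

(** Induction over the finitely many smaller energies: a power of N kills the
    coefficients below b, after which N acts on the coefficient at b by its
    leading part, and a further power kills that one as well. *)
Lemma iter_vanish_at x b : exists n, forall k, (n <= k)%N -> iter k N x b = 0.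
Proof.
pose below (a : gelt G) := [fset c in upto_energy G (energy a) | energy c < energy a]%fset.
have mem_below a c : (c \in below a) = (energy c < energy a).
  by rewrite !inE /= mem_upto_energy; case: ltP => [/ltW ->|]; rewrite ?andbF.
have [m] := ubnP #|` below b|.
elim: m b => // m IH b /ltnSE cm.
have /choice[n Hn] : forall c, exists n, energy c < energy b ->
    forall k, (n <= k)%N -> iter k N x c = 0.
  move=> c; case: (ltP (energy c) (energy b)) => [cb|_]; last by exists 0%N.
  have [|n Hn] := IH c; last by exists n.
  apply: leq_trans cm; apply: fproper_ltn_card; rewrite fproperE.
  apply/andP; split; first by apply/fsubsetP => a; rewrite !mem_below => /lt_trans->.
  by apply/negP => /fsubsetP/(_ c); rewrite !mem_below ltxx => /(_ cb).
pose n0 := \max_(c <- below b) n c.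
have fy : filt (energy b) (iter n0 N x).
  by move=> c cb; apply: (Hn c) => //; apply: leq_bigmax_seq; rewrite ?mem_below.
have [j Hj] := leading_nil (iter n0 N x b).
exists (j + n0)%N => k jk.
have nk : (n0 <= k)%N by apply: leq_trans jk; apply: leq_addl.
have jkn : (j <= k - n0)%N by rewrite leq_subRL // addnC.
rewrite -(subnK nk) iterD (iter_leading _ fy) // -(subnK jkn).
rewrite iterD Hj; elim: (_ - j)%N => //= l ->; exact: leading0.
Qed.

Lemma iter_vanish e x : exists n, filt e (iter n N x).
Proof.
have /choice[n Hn] := iter_vanish_at x.
exists (\max_(c <- upto_energy G e) n c)%N => b be; apply: (Hn b).
by apply: leq_bigmax_seq; rewrite ?mem_upto_energy ?ltW.
Qed.

(** The inverse of 1 - N, as the series of the N^k; at b the series is cut off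
    at an exponent beyond which all terms vanish at b. *)
Definition neumann (x : gelt G -> V) : gelt G -> V := fun b =>
  \sum_(k < xget 0%N [set n | filt (energy b + 1) (iter n N x)]) iter k N x b.

Lemma partial_stable e x b n m : filt e (iter n N x) -> energy b < e -> (n <= m)%N ->
  \sum_(k < m) iter k N x b = \sum_(k < n) iter k N x b.
Proof.
move=> en be nm; rewrite -(subnKC nm) big_split_ord /= [X in _ + X]big1 ?addr0 //.
by move=> k _; rewrite addnC iterD (iter_filt _ en).
Qed.

Lemma neumannE e x b n : filt e (iter n N x) -> energy b < e ->
  neumann x b = \sum_(k < n) iter k N x b.
Proof.
move=> en be; rewrite /neumann; case: xgetP => [m _ /= em|]; last first.
  by have [m em] := iter_vanish (energy b + 1) x => /(_ m).
have b1 : energy b < energy b + 1 by rewrite ltrDl.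
case/orP: (leq_total m n) => mn; first by rewrite (partial_stable em b1 mn).
by rewrite (partial_stable en be mn).
Qed.

Lemma neumann_filt e x n : filt e (iter n N x) ->
  filt e (neumann x - \sum_(k < n) iter k N x).
Proof.
by move=> en b be; rewrite famB fam_sum (neumannE en be) subrr.
Qed.

Lemma neumann_eq x : neumann x - N (neumann x) = x.
Proof.
apply/eqP; rewrite -subr_eq0; apply/eqP/filt_eq0 => e.
have [n en] := iter_vanish e x; have fs := neumann_filt en.
set s := \sum_(k < n) iter k N x in fs.
have es : s - N s = x - iter n N x.
  rewrite /s (fa_sum _ _ fN) -sumrB.
  by elim: (n) => [|m IH]; rewrite ?big_ord0 ?subrr // big_ord_recr /= IH subrKA.
rewrite (_ : _ - x = (neumann x - s) - N (neumann x - s) - iter n N x).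
  by apply: filtB => //; apply: filtB => //; apply: (nl_filt nN).
have gen (W : zmodType) (u nu t nt y z : W) : t - nt = y - z ->
    u - nu - y = u - t - (nu - nt) - z.
  move=> tz; rewrite -[y](subrK z) -tz !opprD !opprK.
  by rewrite [in RHS](addrACA u) !addrA.
by rewrite (faB _ _ fN); apply: gen.
Qed.

Lemma fixed0 x : N x = x -> x = 0.
Proof.
move=> Nx; apply: filt_eq0 => e; have [n] := iter_vanish e x.
by elim: n => //= n IH; rewrite -[X in filt e (N X)]/(iter n N x) iter_fix // Nx.
Qed.

(** 1 - N is injective, since a fixed point of N lies in every F^e.  Linearity
    of the series follows from uniqueness alone. *)
Lemma neumann_uniq x y : y - N y = x -> y = neumann x.
Proof.
move=> yx; apply/eqP; rewrite -subr_eq0; apply/eqP/fixed0.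
have gen (W : zmodType) (a b c d : W) : a - b = c - d -> b - d = a - c.
  by move=> h; rewrite -[a](subrK b) h addrAC [c - d - c]addrAC subrr add0r addrC.
by rewrite (faB _ _ fN); apply: gen; rewrite neumann_eq.
Qed.

Lemma neumannK x : neumann (x - N x) = x.
Proof. by rewrite -(neumann_uniq (erefl (x - N x))). Qed.

Lemma nl_neumann : novlin neumann.
Proof.
split=> [a x y|e x ex b be|c x].
- apply/esym/neumann_uniq; rewrite (nl_lin nN) opprD addrACA -scalerBr.
  by rewrite !neumann_eq.
- rewrite (neumannE (n := 0%N) (e := e)) ?big_ord0 //.
- apply/esym/neumann_uniq; rewrite (nl_shift nN) -[in RHS](neumann_eq x).
  by rewrite -scaleN1r -nshiftZ -nshiftD scaleN1r.
Qed.

Lemma neumannDr x : neumann x = x + neumann (N x).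
Proof.
have fn := nl_fadd nl_neumann.
by apply/eqP; rewrite -subr_eq -(faB _ _ fn) neumannK.
Qed.

Lemma leading_iter x k : iter k N x (gzero G) = iter k leading (x (gzero G)).
Proof. by elim: k => //= k IH; rewrite (nl_gzero _ nN) IH. Qed.

Lemma neumann_leading (S : submod V) x : (forall t, S t -> S (leading t)) ->
  S (x (gzero G)) -> S (neumann x (gzero G)).
Proof.
move=> lS Sx; have [n en] := iter_vanish 1 x.
rewrite (neumannE en); last by rewrite energy0 ltr01.
elim/big_ind: _ => [|u v|[k _] _ /=]; [exact: sm0|exact: smD|].
by rewrite leading_iter; elim: k => //= k IH; apply: lS.
Qed.

End Neumann.

(** * The perturbation lemma *)

(** A contraction (p, i, h) of (V, D) onto W with zero differential, a
    perturbation e of D with (D + e)^2 = D^2 ([De]), and an inverse A of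
    1 - e h. *)
Section Perturbation.
Variables V W : zmodType.
Variables (D e h A : V -> V) (p : V -> W) (i : W -> V).
Hypotheses (aD : {morph D : x y / x + y}) (ae : {morph e : x y / x + y}).
Hypotheses (ah : {morph h : x y / x + y}) (aA : {morph A : x y / x + y}).
Hypotheses (ap : {morph p : x y / x + y}) (ai : {morph i : x y / x + y}).
Hypothesis De : forall x, D (e x) + e (D x) + e (e x) = 0.
Hypotheses (pD : forall x, p (D x) = 0) (Di : forall y, D (i y) = 0).
Hypotheses (pi : forall y, p (i y) = y).
Hypothesis Dh : forall x, D (h x) + h (D x) = i (p x) - x.
Hypotheses (hh : forall x, h (h x) = 0) (ph : forall x, p (h x) = 0).
Hypotheses (hi : forall y, h (i y) = 0).
Hypotheses (Al : forall x, A (x - e (h x)) = x) (Ar : forall x, A x - e (h (A x)) = x).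

Let add0 (U U' : zmodType) (f : U -> U') : {morph f : x y / x + y} -> f 0 = 0.
Proof. by move=> af; apply: (addrI (f 0)); rewrite -af !addr0. Qed.
Let addB (U U' : zmodType) (f : U -> U') : {morph f : x y / x + y} ->
  {morph f : x y / x - y}.
Proof. by move=> af x y; apply/eqP; rewrite eq_sym subr_eq -af subrK. Qed.

Let ipE z : i (p z) = D (h z) + h (D z) + z.
Proof. by rewrite Dh subrK. Qed.

Lemma hpl_Ah z : A (h z) = h z.
Proof. by rewrite -[RHS]Al hh (add0 ae) subr0. Qed.
Lemma hpl_Ai y : A (i y) = i y.
Proof. by rewrite -[RHS]Al hi (add0 ae) subr0. Qed.
Lemma hpl_Aeh z : A (e (h z)) = A z - z.
Proof. by rewrite -{3}[z]Al (addB aA) subKr. Qed.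

(** The identity behind all the others.  Writing x = z - e h z with z = A x, it
    follows from (D + e) x = D z + e z + e D h z and ip = D h + h D + 1. *)
Lemma hpl_Aei x : A (e (i (p (A x)))) = A (D x + e x) - D (A x).
Proof.
set z := A x; rewrite -[x]Ar -/z.
have -> : D (z - e (h z)) + e (z - e (h z)) = D z + e z + e (D (h z)).
  rewrite (addB aD) (addB ae) addrACA -opprD; congr (_ + _); apply/eqP.
  by rewrite eqr_oppLR -addr_eq0 addrAC De.
rewrite ipE !ae !aA hpl_Aeh.
have gen (a b c d : V) : a + (b - d) + c = b + c + a - d.
  by rewrite addrA [LHS]addrAC; congr (_ - d); rewrite -addrA addrC.
exact: gen.
Qed.

Definition hpl_p x := p (A x).
Definition hpl_i y := i y + h (A (e (i y))).
Definition hpl_h x := h (A x).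
Definition hpl_d y := p (A (e (i y))).

Lemma hpl_morph_p x : hpl_p (D x + e x) = hpl_d (hpl_p x).
Proof. by rewrite /hpl_d /hpl_p hpl_Aei (addB ap) pD subr0. Qed.

Let Dei y : D (e (i y)) + e (e (i y)) = 0.
Proof. by have := De (i y); rewrite Di (add0 ae) addr0. Qed.

Let zE y : A (e (i y)) = e (i y) + e (h (A (e (i y)))).
Proof. by apply/eqP; rewrite -subr_eq Ar. Qed.

Lemma hpl_morph_i y : D (hpl_i y) + e (hpl_i y) = hpl_i (hpl_d y).
Proof.
rewrite /hpl_i /hpl_d hpl_Aei Dei (add0 aA) (addB ah) (add0 ah) sub0r ipE.
rewrite addrAC addrK aD ae Di add0r; congr (_ + _).
by rewrite -zE.
Qed.

Lemma hpl_dd y : hpl_d (hpl_d y) = 0.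
Proof. by rewrite /hpl_d hpl_Aei Dei (add0 aA) (addB ap) pD (add0 ap) subr0. Qed.

Lemma hpl_pi y : hpl_p (hpl_i y) = y.
Proof. by rewrite /hpl_p /hpl_i aA hpl_Ai hpl_Ah ap pi ph addr0. Qed.

Lemma hpl_htpy x : D (hpl_h x) + e (hpl_h x) + hpl_h (D x + e x) = hpl_i (hpl_p x) - x.
Proof.
rewrite /hpl_i /hpl_p /hpl_h hpl_Aei (addB ah) ipE; set z := A x.
have -> : e (h z) = z - x by rewrite -[in RHS](Ar x) subKr.
have gen (a b c d u : V) : a + (b - c) + u = a + d + b + (u - d) - c.
  rewrite addrA [LHS]addrAC; congr (_ - c).
  by rewrite [a + d + b]addrAC [u - d]addrC addrA addrK.
exact: gen.
Qed.

Lemma hpl_Pi y : hpl_p (i y) = y. Proof. by rewrite /hpl_p hpl_Ai pi. Qed.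
Lemma hpl_Ph x : hpl_p (h x) = 0. Proof. by rewrite /hpl_p hpl_Ah ph. Qed.
Lemma hpl_Hh x : hpl_h (h x) = 0. Proof. by rewrite /hpl_h hpl_Ah hh. Qed.
Lemma hpl_Hi y : hpl_h (i y) = 0. Proof. by rewrite /hpl_h hpl_Ai hi. Qed.
Lemma hpl_PE x : hpl_p x = p x + hpl_p (e (h x)).
Proof. by rewrite /hpl_p hpl_Aeh (addB ap) addrC subrK. Qed.
Lemma hpl_HE x : hpl_h x = h x + hpl_h (e (h x)).
Proof. by rewrite /hpl_h hpl_Aeh (addB ah) addrC subrK. Qed.

End Perturbation.

(** * Coalgebra structure of the perturbed maps *)

Section BarPerturbation.
Variables (K : realType) (G : discrete_submonoid K) (R : gr_alg K).

Lemma gtens0l (C D : gr_mod R) e (f g : bar G C -> bar G D) z :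
  (forall x, f x = 0) -> novlin g -> gtens e f g z = 0.
Proof.
move=> f0 ng; have nf : novlin f.
  split=> [a x y|e' x _|c x]; rewrite !f0 ?scaler0 ?addr0 //.
  by rewrite (nshift_0 _ c).
rewrite (@eq_gtens _ _ _ _ _ _ _ (fun x => 0 *: f x) _ g) //.
  by rewrite gtensZl // scale0r.
by move=> x; rewrite scale0r f0.
Qed.

Lemma gtens0r (C D : gr_mod R) e (f g : bar G C -> bar G D) z :
  novlin f -> (forall x, g x = 0) -> gtens e f g z = 0.
Proof.
move=> nf g0; have ng : novlin g.
  split=> [a x y|e' x _|c x]; rewrite !g0 ?scaler0 ?addr0 //.
  by rewrite (nshift_0 _ c).
move: z; apply: (bar2_ext (nl_gtens e nf ng)).
  split=> [a x y|e' x _|c x] //; rewrite ?scaler0 ?addr0 //.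
  by rewrite (nshift_0 _ c).
move=> t u; rewrite gtens_tens // g0.
exact: (fa0 (nl_fadd (nl_otens _))).
Qed.

Lemma gtens_splitl (C D : gr_mod R) e (f f1 f2 g : bar G C -> bar G D) z :
  novlin f1 -> novlin f2 -> novlin g -> (forall x, f x = f1 x + f2 x) ->
  gtens e f g z = gtens e f1 g z + gtens e f2 g z.
Proof. by move=> n1 n2 ng ff; rewrite -gtensDl //; apply: eq_gtens. Qed.

Lemma gtens_splitr (C D : gr_mod R) e (f g g1 g2 : bar G C -> bar G D) z :
  novlin f -> novlin g1 -> novlin g2 -> (forall x, g x = g1 x + g2 x) ->
  gtens e f g z = gtens e f g1 z + gtens e f g2 z.
Proof. by move=> nf n1 n2 gg; rewrite -gtensDr //; apply: eq_gtens. Qed.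

Variables (C H : gr_mod R) (e h A : bar G C -> bar G C).
Variables (p : bar G C -> bar G H) (i : bar G H -> bar G C).
Hypotheses (ge : graded_map 1 e) (gh : graded_map (-1) h) (gA : graded_map 0 A).
Hypotheses (gp : graded_map 0 p) (gi : graded_map 0 i).
Hypothesis pi : forall y, p (i y) = y.
Hypotheses (hh : forall x, h (h x) = 0) (ph : forall x, p (h x) = 0).
Hypotheses (hi : forall y, h (i y) = 0).
Hypotheses (Al : forall x, A (x - e (h x)) = x) (Ar : forall x, A x - e (h (A x)) = x).
Hypothesis Delta_e : forall x,
  Delta (e x) = gtens 0 e id (Delta x) + gtens 1 id e (Delta x).
Hypothesis Delta_h : forall x, Delta (h x) =
  gtens 0 h (fun x => i (p x)) (Delta x) + gtens (-1) id h (Delta x).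
Hypothesis Delta_p : forall x, Delta (p x) = gtens 0 p p (Delta x).
Hypothesis Delta_i : forall y, Delta (i y) = gtens 0 i i (Delta y).

Let ne := gm_nl ge. Let nh := gm_nl gh. Let nA := gm_nl gA.
Let np := gm_nl gp. Let ni := gm_nl gi.
Let add_of (V W : lmodType R) (F : (gelt G -> V) -> (gelt G -> W)) (n : novlin F) :
  {morph F : x y / x + y} := fa_add (nl_fadd n).

Local Notation P := (hpl_p A p).
Local Notation I := (hpl_i e h A i).
Local Notation h' := (hpl_h h A).
Local Notation d := (hpl_d e A p i).
Local Notation J := (fun x => I (P x)).

Let nP : novlin P. Proof. exact: nl_comp. Qed.
Let gP : graded_map 0 P. Proof. exact: (gmap_comp gp gA). Qed.
Let gH : graded_map (-1) h'. Proof. by have := gmap_comp gh gA; rewrite addr0. Qed.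
Let nH : novlin h' := gm_nl gH.
Let gHei : graded_map 0 (fun y => h' (e (i y))).
Proof. by have := gmap_comp gH (gmap_comp ge gi); rewrite addr0 addNr. Qed.
Let gI : graded_map 0 I. Proof. exact: gmap_add gi gHei. Qed.
Let nI : novlin I := gm_nl gI.
Let gJ : graded_map 0 J. Proof. exact: (gmap_comp gI gP). Qed.
Let gip : graded_map 0 (fun x => i (p x)). Proof. exact: (gmap_comp gi gp). Qed.
Let nid : novlin (fun x : bar G C => x) := @nl_id _ _ _ _.

(** Expansion by the coderivation rules for e and h.  Of the four products, the
    one with g h in the second factor vanishes. *)
Lemma gtens_eh (D' : gr_mod R) e0 (f g : bar G C -> bar G D') x :
  novlin f -> graded_map e0 g -> (forall y, g (h y) = 0) ->
  gtens e0 f g (Delta (e (h x))) =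
    gtens e0 (fun x => f (e (h x))) (fun x => g (i (p x))) (Delta x)
  + ((-1) ^+ (~~ oddz e0) : R) *:
      gtens (e0 + 1) (fun x => f (h x)) (fun x => g (e (i (p x)))) (Delta x)
  + gtens e0 f (fun x => g (e (h x))) (Delta x).
Proof.
move=> nf gg gh0; have ng := gm_nl gg.
have nip := gm_nl gip; have gid := gmap_id G C.
have nT := nl_gtens e0 nf ng.
rewrite Delta_e (add_of nT).
rewrite (gtens_comp _ _ nf gg ge nid) (gtens_comp _ _ nf gg gid ne).
rewrite !addr0 mulr0 mulr1 scale1r.
have nfe : novlin (fun x => f (e x)) := nl_comp nf ne.
have gge : graded_map (e0 + 1) (fun x => g (e x)) := gmap_comp gg ge.
have nge := gm_nl gge.
rewrite Delta_h (add_of (nl_gtens _ nfe ng)) (add_of (nl_gtens _ nf nge)).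
rewrite (gtens_comp _ _ nfe gg gh nip) (gtens_comp _ _ nfe gg gid nh).
rewrite (gtens_comp _ _ nf gge gh nip) (gtens_comp _ _ nf gge gid nh).
rewrite [X in _ *: (_ + _ *: X)](gtens0r _ _ nfe gh0) scaler0 addr0.
rewrite !addr0 addrK mulr0 scale1r !mulrN1 !oddzN oddzD addbT addrA.
by rewrite scalerA -signr_addb addbb scale1r.
Qed.

Lemma gtens_ei (D' : gr_mod R) e0 (f g : bar G C -> bar G D') y :
  novlin f -> graded_map e0 g ->
  gtens e0 f g (Delta (e (i y))) =
    ((-1) ^+ oddz e0 : R) *:
      gtens e0 (fun x => f (e (i x))) (fun x => g (i x)) (Delta y)
  + gtens (e0 + 1) (fun x => f (i x)) (fun x => g (e (i x))) (Delta y).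
Proof.
move=> nf gg; have ng := gm_nl gg; have gid := gmap_id G C.
have nT := nl_gtens e0 nf ng.
rewrite Delta_e (add_of nT).
rewrite (gtens_comp _ _ nf gg ge nid) (gtens_comp _ _ nf gg gid ne).
rewrite !addr0 mulr0 mulr1 scale1r.
have nfe : novlin (fun x => f (e x)) := nl_comp nf ne.
have gge : graded_map (e0 + 1) (fun x => g (e x)) := gmap_comp gg ge.
rewrite Delta_i (gtens_comp _ _ nfe gg gi ni) (gtens_comp _ _ nf gge gi ni).
by rewrite !addr0 !mulr0 !scale1r.
Qed.

Let ae := add_of ne. Let ah := add_of nh.
Let aA := add_of nA. Let ap := add_of np.

Let Ph x : P (h x) = 0. Proof. exact: (hpl_Ph ae hh ph Al). Qed.
Let Pi y : P (i y) = y. Proof. exact: (hpl_Pi ae pi hi Al). Qed.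
Let Hh x : h' (h x) = 0. Proof. exact: (hpl_Hh ae hh Al). Qed.
Let Hi y : h' (i y) = 0. Proof. exact: (hpl_Hi ae hi Al). Qed.
Let PE x : P x = p x + P (e (h x)). Proof. exact: (hpl_PE aA ap Al). Qed.
Let HE x : h' x = h x + h' (e (h x)). Proof. exact: (hpl_HE ah aA Al). Qed.

Let nPeh : novlin (fun x => P (e (h x))) := nl_comp nP (nl_comp ne nh).
Let nHeh : novlin (fun x => h' (e (h x))) := nl_comp nH (nl_comp ne nh).
Let nHei : novlin (fun x => h' (e (i x))) := nl_comp nH (nl_comp ne ni).
Let nJ := gm_nl gJ.
Let nDl := nl_Delta G C.

Let Delta_sub x : x = A x - e (h (A x)). Proof. by rewrite Ar. Qed.

(** It is enough to compare both sides on x = z - e h z, where P x = p z.  In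
    (P (x) P) Delta e h z the mixed terms vanish by P h = 0, and the others
    are P e h (x) p + P (x) P e h = (P - p) (x) p + P (x) (P - p). *)
Lemma Delta_hpl_p x : Delta (P x) = gtens 0 P P (Delta x).
Proof.
have nT := nl_gtens 0 nP nP.
rewrite [in RHS](Delta_sub x) (faB _ _ (nl_fadd nDl)) (faB _ _ (nl_fadd nT)).
rewrite {1}/hpl_p Delta_p; set z := A x.
rewrite (gtens_eh _ nP gP Ph) [X in _ *: X]gtens0l //; last first.
  exact: (nl_comp nP (nl_comp ne (gm_nl gip))).
rewrite scaler0 addr0.
rewrite (gtens_splitr 0 (Delta z) nP np nPeh PE).
rewrite (gtens_splitl 0 (Delta z) np nPeh np PE).
have PipE x1 : P (i (p x1)) = p x1 by rewrite Pi.
rewrite [gtens 0 _ (fun x => P (i (p x))) _](eq_gtens 0 (Delta z) (frefl _) PipE).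
by rewrite -(addrA (gtens 0 p p _)) addrK.
Qed.

(** As for P, it is enough to compare both sides on x = z - e h z, where
    h' x = h z; the products that remain are matched by h' h = 0, h' i = 0,
    P h = 0, P i = 1, h' = h + h' e h and I p = i p + h' e i p. *)
Lemma Delta_hpl_h x : Delta (h' x) = gtens 0 h' J (Delta x) + gtens (-1) id h' (Delta x).
Proof.
have nT1 := nl_gtens 0 nH nJ; have nT2 := nl_gtens (-1) nid nH.
rewrite [in RHS](Delta_sub x) (faB _ _ (nl_fadd nDl)).
rewrite (faB _ _ (nl_fadd nT1)) (faB _ _ (nl_fadd nT2)).
rewrite {1}/hpl_h Delta_h; set z := A x.
have Jh y : J (h y) = 0 by rewrite /= Ph (fa0 (nl_fadd nI)).
rewrite (gtens_eh _ nH gJ Jh) [X in _ *: X]gtens0l //; last first.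
  exact: (nl_comp nJ (nl_comp ne (gm_nl gip))).
rewrite scaler0 addr0 (gtens_eh _ nid gH Hh) [X in X + _ *: _]gtens0r; last first.
  by move=> y; apply: Hi.
  exact: (nl_comp ne nh).
rewrite add0r addNr scale1r.
have nIp : novlin (fun x => I (p x)) := nl_comp nI np.
have nIPeh : novlin (fun x => I (P (e (h x)))) := nl_comp nI nPeh.
have nip := gm_nl gip.
have nHeip : novlin (fun x => h' (e (i (p x)))) := nl_comp nHei np.
have JE y : J y = I (p y) + I (P (e (h y))) by rewrite /= PE (add_of nI).
rewrite [gtens 0 h' J _](gtens_splitr 0 (Delta z) nH nIp nIPeh JE).
rewrite [gtens 0 h' (fun x => I (p x)) _](gtens_splitl 0 (Delta z) nh nHeh nIp HE).
rewrite [gtens 0 h (fun x => I (p x)) _](gtens_splitr 0 (Delta z) nh nip nHeip) //.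
rewrite [gtens (-1) id h' _](gtens_splitr (-1) (Delta z) nid nh nHeh HE).
have JipE y : J (i (p y)) = I (p y) by rewrite /= Pi.
rewrite [gtens 0 _ (fun x => J (i (p x))) _](eq_gtens 0 (Delta z) (frefl _) JipE).
set a1 := gtens 0 h _ _; set a2 := gtens (-1) id h _.
set b1 := gtens 0 _ (fun x => I (p x)) _; set b2 := gtens 0 h' _ _.
set b3 := gtens 0 h _ _; set b4 := gtens (-1) _ _ _.
have gen (W : zmodType) (u1 u2 v1 v2 v3 v4 : W) :
    u1 + u2 = u1 + v3 + v1 + v2 - (v1 + v2) + (u2 + v4 - (v3 + v4)).
  rewrite -(addrA (u1 + v3)) addrK [v3 + v4]addrC [u2 + v4 - _]addrKA.
  by rewrite [u2 - v3]addrC addrA addrK.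
exact: gen.
Qed.

(** From I = i + h' e i and the rule for h': the terms are
    i (x) i + h' e i (x) I + i (x) h' e i, which is I (x) I. *)
Lemma Delta_hpl_i y : Delta (I y) = gtens 0 I I (Delta y).
Proof.
rewrite -[I y]/(i y + h' (e (i y))) (add_of nDl) Delta_hpl_h.
rewrite (gtens_ei _ nH gJ) (gtens_ei _ nid gH) [X in _ + X + _]gtens0l //; last first.
  exact: (nl_comp nJ (nl_comp ne ni)).
rewrite [X in _ *: X + _]gtens0r //; last exact: (nl_comp ne ni).
rewrite scaler0 add0r addr0 scale1r addNr Delta_i.
have JiE x : J (i x) = I x by rewrite /= Pi.
rewrite [gtens 0 _ (fun x => J (i x)) _](eq_gtens 0 (Delta y) (frefl _) JiE).
rewrite [in RHS](gtens_splitl 0 (Delta y) ni nHei nI) //.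
rewrite [gtens 0 i I _](gtens_splitr 0 (Delta y) ni ni nHei) //.
by rewrite addrA addrAC.
Qed.

(** From d = P e i and P i = 1. *)
Lemma Delta_hpl_d y : Delta (d y) = gtens 0 d id (Delta y) + gtens 1 id d (Delta y).
Proof.
rewrite -[d y]/(P (e (i y))) Delta_hpl_p (gtens_ei _ nP gP) scale1r.
by congr (_ + _); apply: eq_gtens => x //; rewrite Pi.
Qed.

End BarPerturbation.

(** * The perturbation lowers word length at energy 0 *)

Section LetterSigns.
Variables (K : realType) (R : gr_alg K).

Lemma eq_gsign (C : gr_mod R) chi chi' (x : C) :
  (forall q, oddz (chi q) = oddz (chi' q)) -> gsign chi x = gsign chi' x.
Proof.
by move=> e; apply: eq_fsbigr => q _; rewrite signE -/(oddz (chi q)) e -signE.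
Qed.

Lemma gsign_triv (C : gr_mod R) chi (x : C) :
  (forall q, oddz (chi q) = false) -> gsign chi x = x.
Proof.
move=> c0; elim/(gr_ind (g := gm_gr C)): x => [|x y IH IH'|q x qx].
- exact: gsign0.
- by rewrite gsignD IH IH'.
- by rewrite (gsign_homog _ qx) c0 scale1r.
Qed.

Lemma gsignK (C : gr_mod R) chi (x : C) : gsign chi (gsign chi x) = x.
Proof.
elim/(gr_ind (g := gm_gr C)): x => [|x y IH IH'|q x qx].
- by rewrite !gsign0.
- by rewrite !gsignD IH IH'.
have qx' := gsign_graded chi qx; rewrite addr0 in qx'.
rewrite (gsign_homog chi qx') (gsign_homog chi qx) scalerA -signr_addb addbb.
by rewrite scale1r.
Qed.

(** A map of odd codimension degree anticommutes with the Koszul sign. *)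
Lemma gsign_odd (C D : gr_mod R) e (f : C -> D) x : is_lin f ->
  is_graded (e, 0) f -> oddz e -> gsign (koszul 1) (f x) = - f (gsign (koszul 1) x).
Proof.
move=> lf gf oe; elim/(gr_ind (g := gm_gr C)): x => [|x y IH IH'|q x qx].
- by rewrite gsign0 (lin0 lf) gsign0 oppr0.
- by rewrite gsignD !(linD lf) gsignD IH IH' opprD.
rewrite (gsign_homog _ qx) (linZ _ _ lf) (gsign_homog _ (gf _ _ qx)).
rewrite -scaleNr /koszul !oddzM -[(q + (e, 0)).1]/(q.1 + e) !oddzB oddzD oe.
by case: (oddz q.1); rewrite /= ?opprK.
Qed.

Lemma lin_dgd (C : dg_mod R) : is_lin (@dg_d' K R C).
Proof.
apply: lin_comp; first exact: lin_linear.
apply: gsign_lin => p q p2 _.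
by rewrite -[(p + q).1]/(p.1 + q.1) oddzD (oddz_even p2).
Qed.

Lemma dgd_graded (C : dg_mod R) : is_graded (1, 0) (@dg_d' K R C).
Proof.
move=> p x px; apply: dg_deg; rewrite -[p]addr0.
exact: gsign_graded.
Qed.

(** On homogeneous elements the signs are scalars, so d' d' is a multiple of
    d d. *)
Lemma dgd_sq (C : dg_mod R) x : @dg_d' K R C (dg_d' x) = 0.
Proof.
have ld := lin_dgd (C := C).
elim/(gr_ind (g := gm_gr C)): x => [|x y IH IH'|q x qx].
- by rewrite !(lin0 ld).
- by rewrite !(linD ld) IH IH' addr0.
rewrite {1}/dg_d' (gsign_homog _ (dgd_graded qx)) linearZ /= /dg_d'.
by rewrite (gsign_homog _ qx) !linearZ /= dg_sq !scaler0.
Qed.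

End LetterSigns.

(** A coderivation e of degree 1 without scalar part whose components of arity
    0 and 1 vanish at energy 0 lowers word length there. *)
Section LeadingLength.
Variables (K : realType) (G : discrete_submonoid K) (R : gr_alg K).
Variables (C : gr_mod R) (e : bar G C -> bar G C).
Hypothesis ne : novlin e.
Hypothesis Delta_e : forall x,
  Delta (e x) = gtens 0 e id (Delta x) + gtens 1 id e (Delta x).
Hypothesis counit_e : forall x, counit (e x) = 0.

Let f (t : talg C) : talg C := e (gconst t) (gzero G).
Hypothesis f0 : tpart1 (f (word [::])) = 0.
Hypothesis f1 : forall x, tpart1 (f (word [:: x])) = 0.

Let lf : is_lin f.
Proof. by move=> a u v; rewrite /f (nl_phi ne). Qed.

Lemma otens_gzero (x y : bar G C) :
  otens x y (gzero G) = tens (x (gzero G)) (y (gzero G)).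
Proof.
rewrite (otens_sum (S := upto_energy G (energy (gzero G)))) //.
rewrite (bigD1_seq (gzero G)) ?fset_uniq ?mem_upto_energy //= big1 ?addr0.
  by rewrite nshift0 /eps_twist eps0.
move=> c c0; apply: (@nshift_ind _ _ _ _ _ _ (fun v => v = 0)) => // a ca.
case/eqP: c0; apply/energy_eq0/eqP; rewrite eq_le energy_ge0 andbT.
by rewrite -[leRHS](energy0 G) ca energyD lerDl energy_ge0.
Qed.

Lemma tsplit_leading t : tsplit (f t) =
  tens_map f id (tsplit t) + tens_map (@t_sign K R C (koszul 1)) f (tsplit t).
Proof.
have lk := @lin_tsign _ _ C _ _ (koszul_char 1).
have nid : novlin (fun x : bar G C => x) := @nl_id _ _ _ _.
have := congr1 (fun x : bar2 G C => x (gzero G)) (Delta_e (gconst t)).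
rewrite -[LHS]/(tsplit (f t)) => ->.
have -> : Delta (gconst t : bar G C) = gconst (tsplit t).
  apply/funext => b; rewrite /Delta !gconstE; case: eqP => // _.
  exact: lin0 (@lin_tsplit R C).
rewrite famD; congr (_ + _); move: (tsplit t); apply: tens_ext.
- by move=> a u v; rewrite (nl_phi (nl_gtens 0 ne nid)) famP.
- by apply: lin_tens_map.
- by move=> s u; rewrite gtens_tens // otens_gzero tens_map_tens // koszul0 gconstE eqxx.
- by move=> a u v; rewrite (nl_phi (nl_gtens 1 nid ne)) famP.
- by apply: lin_tens_map.
- by move=> s u; rewrite gtens_tens // otens_gzero tens_map_tens // gconstE eqxx.
Qed.

(** By [rho_split], the value on w is the sum of the terms
    (pi_1 f (w_1 ... w_i)) w_(i+1) ... w_k, which vanish for i < 2, and of a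
    signed first letter followed by the value on the rest of w. *)
Lemma leading_word w : wlt C (size w) (f (word w)).
Proof.
have lk := @lin_tsign _ _ C _ _ (koszul_char 1).
have [n] := ubnP (size w); elim: n w => // n IH w /ltnSE wn.
rewrite (rho_split (f (word w))).
have -> : tpart0 (f (word w)) = 0.
  by have := congr1 (fun a : novikov G R => a (gzero G)) (counit_e (gconst (word w))).
rewrite scale0r add0r tsplit_leading tsplit_word.
rewrite (linD (@rho_lin R C)).
rewrite !(lin_sum _ _ (lin_tens_map _ _)) // !(lin_sum _ _ (@rho_lin R C)).
apply: smD.
  elim/big_ind: _ => [|u v|i _]; [exact: sm0|exact: smD|].
  rewrite tens_map_tens // rho_tens.
  case: (leqP i 1) => i1.
    suff -> : tpart1 (f (word (take i w))) = 0.
      by rewrite (lin0 (lin_lconsl _)); apply: sm0.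
    case: (i : nat) i1 => [|[|//]] _; first by rewrite take0.
    by case: (w) => [|x w'] //=; rewrite take0.
  apply: (@wlt_mono _ _ (size w - i).+2).
    by have := ltn_ord i; move: i1; lia.
  by apply/wlt_lcons/wlt_word; rewrite size_drop.
elim/big_ind: _ => [|u v|i _]; [exact: sm0|exact: smD|].
rewrite tens_map_tens // rho_tens (t_sign_word (koszul_char 1)) tpart1_word.
case E : (map _ _) => [|y [|//]]; try by rewrite (lin0 (lin_lconsl _)); apply: sm0.
have i1 : (i : nat) = 1%N.
  have := congr1 size E; rewrite size_map size_takel //.
  by rewrite -ltnS.
have w0 : (0 < size w)%N by rewrite -[(0 < _)%N]ltnS -i1 ltn_ord.
rewrite i1; apply: (@wlt_mono _ _ (size (drop 1 w)).+1).
  by rewrite size_drop subn1 prednK.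
apply: wlt_lcons; apply: IH.
by rewrite size_drop subn1 prednK.
Qed.

Lemma leading_wlt n t : wlt C n.+1 t -> wlt C n (f t).
Proof.
apply: (@wlt_map _ _ _ f (wlt C n)) => // w wn.
by apply: (@wlt_mono _ _ (size w) n) => //; apply: leading_word.
Qed.

End LeadingLength.

(** * Homotopy transfer *)

Lemma gmap_neumann (K : realType) (G : discrete_submonoid K) (R : gr_alg K)
    (C : gr_mod R) (N : bar G C -> bar G C) :
  graded_map 0 N -> (forall t, exists n, iter n (leading N) t = 0) -> graded_map 0 (neumann N).
Proof.
move=> gN nil; have nN := gm_nl gN; split; first exact: nl_neumann.
move=> p x hx b; have [n en] := iter_vanish nN nil (energy b + 1) x.
rewrite (neumannE nN nil en) ?ltrDl //.
apply: t_homog_sum => k.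
have gk : graded_map 0 (iter k N).
  elim: (k : nat) => [|j IH]; first exact: gmap_id.
  exact: (gmap_comp gN IH).
exact: gm_deg gk _ _ hx b.
Qed.

Section Transfer.
Variables (K : realType) (G : discrete_submonoid K) (R : gr_alg K).
Variables (C : dg_mod R) (H : gr_mod R) (m : bar G C -> bar G C).
Hypotheses (m_tw : twisted_alg m) (m_pert : perturbation m).
Variable r : retraction C H.

Let s : C -> C := gsign (koszul 1).
Let ip (x : C) : C := rt_I r (rt_Pi r x).

Let ls : is_lin s. Proof. exact: gsign_lin_char (koszul_char 1). Qed.
Let lh : is_lin (rt_h r) := lin_linear (rt_h r).
Let lp : is_lin (rt_Pi r) := lin_linear (rt_Pi r).
Let li : is_lin (rt_I r) := lin_linear (rt_I r).
Let ld : is_lin (@dg_d' K R C) := lin_dgd (C := C).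
Let lip : is_lin ip := lin_comp li lp.
Let lid : is_lin (fun x : C => x) := @lin_id _ _.

Let Dt := twder s (@dg_d' K R C) (fun x => x).
Let ht := twder s (rt_h r) ip.
Let lDt : is_lin Dt. Proof. exact: lin_twder. Qed.
Let lht : is_lin ht. Proof. exact: lin_twder. Qed.
Let lpt := lin_tmor lp.
Let lit := lin_tmor li.

(** The contraction of bar coalgebras given by the tensor trick, and the
    perturbation m - D. *)
Let D : bar G C -> bar G C := coefwise Dt.
Let h : bar G C -> bar G C := coefwise ht.
Let p : bar G C -> bar G H := coefwise (tmor (rt_Pi r)).
Let i : bar G H -> bar G C := coefwise (tmor (rt_I r)).
Let e (x : bar G C) : bar G C := m x - D x.

Let ss x : s (s x) = x. Proof. exact: gsignK. Qed.
Let sd x : s (dg_d' x) = - dg_d' (s x).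
Proof. exact: (gsign_odd _ ld (@dgd_graded _ _ C)). Qed.

Let gs0 : is_graded 0 s. Proof. exact: gsign_graded. Qed.
Let gid0 : is_graded 0 (fun x : C => x).
Proof. by move=> q x qx; rewrite addr0. Qed.
Let gip0 : is_graded 0 ip.
Proof.
move=> q x qx; rewrite addr0 -[q]addr0 -[q + 0]addr0.
exact/(@rt_I_deg _ _ _ _ r)/(@rt_Pi_deg _ _ _ _ r).
Qed.

Let gD : graded_map 1 D.
Proof. by apply: gmap_coefwise => //; apply: t_homog_twder => //; exact: dgd_graded. Qed.
Let gh : graded_map (-1) h.
Proof. by apply: gmap_coefwise => //; apply: t_homog_twder => //; exact: rt_h_deg. Qed.
Let gp : graded_map 0 p.
Proof. by apply: gmap_coefwise => //; apply: t_homog_tmor => //; exact: rt_Pi_deg. Qed.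
Let gi : graded_map 0 i.
Proof. by apply: gmap_coefwise => //; apply: t_homog_tmor => //; exact: rt_I_deg. Qed.
Let gm : graded_map 1 m. Proof. exact/degree_gmap/(cd_map (ta_coder m_tw)). Qed.
Let ge : graded_map 1 e.
Proof.
have -> : e = fun x => m x + (-1) ^+ true *: D x.
  by apply/funext => x; rewrite /e expr1 scaleN1r.
exact/gmap_add/gmap_sign.
Qed.
Let ne := gm_nl ge.
Let nD := gm_nl gD.
Let mE x : m x = D x + e x. Proof. by rewrite /e addrC subrK. Qed.

Let nid : novlin (fun x : bar G C => x) := @nl_id _ _ _ _.

Let Delta_D x : Delta (D x) = gtens 0 D id (Delta x) + gtens 1 id D (Delta x).
Proof.
rewrite /D /Dt Delta_twder //; congr (_ + _); apply: eq_gtens => // y.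
by apply/funext => b; rewrite /coefwise tmor_id.
Qed.

Let Delta_m x : Delta (m x) = gtens 0 m id (Delta x) + gtens 1 id m (Delta x).
Proof.
by rewrite (cd_Delta (ta_coder m_tw)) (otens_coderE _ _ nid nid (gm_nl gm)).
Qed.

Let Delta_e x : Delta (e x) = gtens 0 e id (Delta x) + gtens 1 id e (Delta x).
Proof.
have nDl := nl_fadd (nl_Delta G C).
apply: (addrI (Delta (D x))); rewrite -(fa_add nDl) -mE Delta_m Delta_D.
rewrite (gtens_splitl 0 (Delta x) nD ne nid mE) (gtens_splitr 1 (Delta x) nid nD ne mE).
by rewrite addrACA.
Qed.

Let kosN1 : @gsign K R C (koszul (-1)) = s.
Proof. by apply/funext => x; apply: eq_gsign => q; rewrite !oddzM. Qed.

Let Delta_h x : Delta (h x) =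
  gtens 0 h (fun x => i (p x)) (Delta x) + gtens (-1) id h (Delta x).
Proof.
have := @Delta_twder K G R C (-1) (rt_h r) ip x lh lip.
rewrite kosN1 /= -/ht -/h => ->; congr (_ + _); apply: eq_gtens => // y.
by apply/funext => b; rewrite /coefwise /i /p /coefwise tmor_comp.
Qed.

Let Delta_p x : Delta (p x) = gtens 0 p p (Delta x).
Proof. exact: Delta_tmor. Qed.
Let Delta_i x : Delta (i x) = gtens 0 i i (Delta x).
Proof. exact: Delta_tmor. Qed.

Let hh x : h (h x) = 0.
Proof.
apply/funext => b; rewrite /h /coefwise /ht.
apply: (tt_hh ls lh lp li); [exact: rt_hh|exact: rt_Pih|exact: rt_hI].
Qed.
Let ph x : p (h x) = 0.
Proof. by apply/funext => b; apply: (tt_ph ls lh lp li); exact: rt_Pih. Qed.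
Let hi x : h (i x) = 0.
Proof. by apply/funext => b; apply: (tt_hi ls lh lp li); exact: rt_hI. Qed.
Let pD x : p (D x) = 0.
Proof. by apply/funext => b; apply: (tt_pD ls ld lp); exact: rt_Pid. Qed.
Let Di x : D (i x) = 0.
Proof. by apply/funext => b; apply: (tt_Di ls ld li); exact: rt_dI. Qed.
Let pi x : p (i x) = x.
Proof. by apply/funext => b; apply: (tt_pi lp li); exact: rt_PiI. Qed.
Let Dh x : D (h x) + h (D x) = i (p x) - x.
Proof.
apply/funext => b; rewrite famD famB.
apply: (tt_Dh ls ld lh lp li ss sd).
- exact: rt_Pid.
- exact: rt_dI.
- exact: rt_htpy.
Qed.
Let DD x : D (D x) = 0.
Proof. by apply/funext => b; apply: (tt_DD ls ld sd); exact: dgd_sq. Qed.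

Let aD : {morph D : x y / x + y} := fa_add (nl_fadd nD).
Let ae : {morph e : x y / x + y} := fa_add (nl_fadd ne).

Let De x : D (e x) + e (D x) + e (e x) = 0.
Proof.
have := ta_sq m_tw x; rewrite !mE aD ae DD add0r.
by rewrite ae addrA.
Qed.

Let tpart0_e x b : tpart0 (e x b) = 0.
Proof.
have l0 := @lin_tpart0 R C.
rewrite /e famB (linD l0) -scaleN1r (linZ _ _ l0) [tpart0 (D x b)]twder_tpart0 //.
rewrite scaler0 addr0.
exact: (congr1 (fun a : novikov G R => a b) (cd_counit (ta_coder m_tw) x)).
Qed.

Let counit_e x : counit (e x) = 0.
Proof. by apply/funext => b; apply: tpart0_e. Qed.

Let i0_nov1 (C' : gr_mod R) : i0 C' (@nov1 K G R) = gconst (word [::]).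
Proof.
apply/funext => b; rewrite /i0 /nov1 !gconstE.
by case: eqP; rewrite ?scale1r ?scale0r.
Qed.

(** Tameness: the curvature of m has positive energy. *)
Let e_nil : tpart1 (e (gconst (word [::])) (gzero G)) = 0.
Proof.
have l1 := @lin_tpart1 R C.
rewrite /e famB /D coefwise_gconst // /Dt twder_nil // gconstE eqxx subr0.
have [E E0] := ta_tame m_tw; rewrite i0_nov1 => /(_ (gzero G)); apply.
by rewrite energy0.
Qed.

(** The perturbation condition: m and D have the same linear part. *)
Let e_one x : tpart1 (e (gconst (word [:: x])) (gzero G)) = 0.
Proof.
have l1 := @lin_tpart1 R C.
have := m_pert x; rewrite /component gsign_triv; last by move=> q; rewrite oddzM andbF.
rewrite /e famB (linD l1) -scaleN1r (linZ _ _ l1) scaleN1r => mx.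
apply/eqP; rewrite subr_eq0 -[X in X == _]/(pi1 _ _) [X in X == _]mx.
rewrite /D coefwise_gconst // gconstE eqxx /Dt twder_wordE //= lcons_word.
by rewrite (lin0 (lin_lconsr _)) addr0 tpart1_word.
Qed.

Let N x := e (h x).
Let gN : graded_map 0 N. Proof. exact: (gmap_comp ge gh). Qed.
Let nN := gm_nl gN.

Let leading_e n t : wlt C n.+1 t -> wlt C n (e (gconst t) (gzero G)).
Proof. exact: (leading_wlt ne Delta_e counit_e e_nil e_one). Qed.

Let leading_N n t : wlt C n.+1 t -> wlt C n (leading N t).
Proof.
move=> tn; rewrite /leading /N /h coefwise_gconst //; apply: leading_e.
exact: wlt_twder.
Qed.

(** h preserves word length, so N lowers it at energy 0. *)
Let leading_nil t : exists n, iter n (leading N) t = 0.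
Proof.
have [n tn] := wlt_ex t; exists n.
elim: n t tn => [|n IH] t tn; first exact: wlt0.
by rewrite iterSr; apply/IH/leading_N.
Qed.

Let A := neumann N.
Let gA : graded_map 0 A. Proof. exact: gmap_neumann. Qed.
Let nA := gm_nl gA.
Let Al x : A (x - e (h x)) = x. Proof. exact: neumannK. Qed.
Let Ar x : A x - e (h (A x)) = x. Proof. exact: neumann_eq. Qed.
Let aA : {morph A : x y / x + y} := fa_add (nl_fadd nA).
Let ah : {morph h : x y / x + y} := fa_add (nl_fadd (gm_nl gh)).
Let ap : {morph p : x y / x + y} := fa_add (nl_fadd (gm_nl gp)).

Let P := hpl_p A p.
Let I := hpl_i e h A i.
Let h' := hpl_h h A.
Let d := hpl_d e A p i.

Let gP : graded_map 0 P. Proof. exact: (gmap_comp gp gA). Qed.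
Let gH : graded_map (-1) h'. Proof. by have := gmap_comp gh gA; rewrite addr0. Qed.
Let gI : graded_map 0 I.
Proof.
have g := gmap_comp gH (gmap_comp ge gi); rewrite addr0 addNr in g.
exact: gmap_add gi g.
Qed.
Let gd : graded_map 1 d. Proof. by have := gmap_comp gP (gmap_comp ge gi); rewrite addr0 add0r. Qed.

Let tameP (C1 C2 : gr_mod R) (F : bar G C1 -> bar G C2) :
  tpart1 (F (gconst (word [::])) (gzero G)) = 0 -> tame F.
Proof.
move=> F0; have [E E0 gap] := energy_gap G.
by exists E => // b /gap ->; rewrite i0_nov1.
Qed.

Let gc0 (V : zmodType) : gconst (0 : V) = 0 :> (gelt G -> V).
Proof. by apply/funext => b; rewrite /gconst if_same. Qed.

Let e_nil0 : e (gconst (word [::])) (gzero G) = 0.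
Proof. by apply: wlt0; apply: leading_e; apply: wlt_word. Qed.

Let A_wlt n x : wlt C n (x (gzero G)) -> wlt C n (A x (gzero G)).
Proof.
apply: (neumann_leading (N := N) nN leading_nil) => t tn.
by apply: leading_N; apply: wlt_mono tn.
Qed.

Let A_zero x : x (gzero G) = 0 -> A x (gzero G) = 0.
Proof.
by move=> x0; apply: wlt0; apply: A_wlt; rewrite x0; apply: (sm0 (wlt C 0)).
Qed.

Let d_wlt n t : wlt H n.+1 t -> wlt H n (d (gconst t) (gzero G)).
Proof.
move=> tn; rewrite /d /hpl_d /p /coefwise; apply: wlt_tmor => //; apply: A_wlt.
by rewrite /i coefwise_gconst //; apply/leading_e/wlt_tmor.
Qed.

Let wlt1_tpart1 (M : gr_mod R) (t : talg M) : wlt M 1 t -> tpart1 t = 0.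
Proof.
apply: (@wlt_map _ _ _ (@tpart1 R M) (zero_submod M)); first exact: lin_tpart1.
by case=> // _; rewrite /= tpart1_word.
Qed.

(** The target may be any graded module H onto which C retracts; its
    differential is then zero. *)
Theorem transfer : exists mcan : bar G H -> bar G H,
    [/\ twisted_alg mcan,
        (forall y, component mcan (gzero G) [tuple y] = 0) &
        exists (Pi : bar G C -> bar G H) (I : bar G H -> bar G C),
          [/\ twisted_morphism m mcan Pi,
              twisted_morphism mcan m I,
              (forall x, Pi (I x) = x) &
              exists h : bar G C -> bar G C,
                homotopy m m id (fun x => I (Pi x)) h]].
Proof.
have [l0C l0H] := (@lin_tpart0 R C, @lin_tpart0 R H).
have p0p x b : tpart0 (p x b) = tpart0 (x b) by exact: tmor_tpart0.
have p0i x b : tpart0 (i x b) = tpart0 (x b) by exact: tmor_tpart0.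
have p0h x b : tpart0 (h x b) = 0 by exact: twder_tpart0.
have p0A x b : tpart0 (A x b) = tpart0 (x b).
  rewrite -[x in RHS]Ar /= famB (linD l0C) -scaleN1r (linZ _ _ l0C) tpart0_e.
  by rewrite scaler0 addr0.
have d_word : d (gconst (word [::])) (gzero G) = 0.
  by apply: wlt0; apply: d_wlt; apply: wlt_word.
exists d; split.
- split.
  + split; first exact: gmap_degree.
      by move=> x; apply/funext => b; rewrite /counit p0p p0A tpart0_e.
    move=> x; rewrite otens_coderE; [|exact: nl_id|exact: nl_id|exact: (gm_nl gd)].
    exact: (Delta_hpl_d ge gh gA gp gi).
  + exact: (hpl_dd aD ae aA ap De pD Di Dh Al Ar).
  + by apply: tameP; rewrite d_word (lin0 (@lin_tpart1 R H)).
- move=> y; rewrite /component gsign_triv; last by move=> q; rewrite oddzM andbF.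
  by apply: wlt1_tpart1; apply: d_wlt; apply: wlt_word.
exists P, I; split.
- split.
  + split; first exact: gmap_degree.
      by move=> x; rewrite otens_mapE; apply: (Delta_hpl_p ge gh gA gp gi).
    by move=> x; apply/funext => b; rewrite /counit p0p p0A.
  + apply: tameP; rewrite /P /hpl_p [A _](neumannDr nN leading_nil) -/A ap famD.
    rewrite {1}/p coefwise_gconst // tmor_nil // gconstE eqxx (linD (@lin_tpart1 R H)).
    rewrite tpart1_word add0r /p /coefwise A_zero; last first.
      rewrite /N /h coefwise_gconst // /ht twder_nil // gc0.
      by rewrite (fa0 (nl_fadd ne)).
    by rewrite (lin0 lpt) (lin0 (@lin_tpart1 R H)).
  + by move=> x; rewrite mE; apply: (hpl_morph_p aD ae aA ap De pD Dh Al Ar).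
- split.
  + split; first exact: gmap_degree.
      by move=> x; rewrite otens_mapE; apply: (Delta_hpl_i ge gh gA gp gi).
    move=> x; apply/funext => b; rewrite /counit /I /hpl_i famD (linD l0C) p0i p0h.
    by rewrite addr0.
  + apply: tameP; rewrite /I /hpl_i famD (linD (@lin_tpart1 R C)).
    rewrite {1}/i coefwise_gconst // tmor_nil // gconstE eqxx tpart1_word add0r.
    rewrite /h /coefwise A_zero; last by rewrite /i coefwise_gconst // tmor_nil // e_nil0.
    by rewrite (lin0 lht) (lin0 (@lin_tpart1 R C)).
  + by move=> x; rewrite mE; apply/esym; apply: (hpl_morph_i aD ae ah aA De Di Dh Al Ar).
- exact: (hpl_pi ae aA ap pi hh ph hi Al).
exists h'; split.
  split; first exact: gmap_degree.
    by move=> x; apply/funext => b; rewrite /counit p0h.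
  move=> x; rewrite otens_coderE; last exact: gm_nl gH.
    exact: (Delta_hpl_h ge gh gA gp gi).
    exact: nl_id.
  exact: (gm_nl (gmap_comp gI gP)).
by move=> x; rewrite !mE; apply: (hpl_htpy aD ae ah aA De Dh Al Ar).
Qed.

End Transfer.

Theorem theorem24 (K : realType) (G : discrete_submonoid K) (R : gr_alg K)
    (C : dg_mod R) (m : bar G C -> bar G C)
    (m_tw : twisted_alg m) (m_pert : perturbation m)
    (r : retraction C (cohomology C)) :
  exists mcan : bar G (cohomology C) -> bar G (cohomology C),
    [/\ twisted_alg mcan,
        perturbation (C := zero_dg (cohomology C)) mcan &
        exists (Pi : bar G C -> bar G (cohomology C))
               (I : bar G (cohomology C) -> bar G C),
          [/\ twisted_morphism m mcan Pi,
              twisted_morphism mcan m I,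
              (forall x, Pi (I x) = x) &
              exists h : bar G C -> bar G C,
                homotopy m m id (fun x => I (Pi x)) h]].
Proof. exact: transfer. Qed.
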